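(* Let $M$ be a differentiable manifold and $\pi:A\to M$ a differentiable vector bundle with dual bundle $\pi^\ast:A^\ast\to M$. Let $\tilde{\mathcal{A}}$ be the set of pairs $(([\![\cdot,\cdot]\!],\rho),\phi)$, where $([\![\cdot,\cdot]\!],\rho)$ is a Lie algebroid structure on $\pi:A\to M$ and $\phi\in\Gamma(A^\ast)$ is a 1-cocycle of it. Let $\mathcal{J}$ be the set of Jacobi structures $(\Lambda,E)$ on $A^\ast$ which satisfy the two conditions: (C1) the Jacobi bracket of any two linear functions on $A^\ast$ is again a linear function; (C2) the Jacobi bracket of any linear function on $A^\ast$ and the constant function $1$ is a basic function. Then the mapping $\Psi:\tilde{\mathcal{A}}\to\mathcal{J}$ given by $$\Psi(([\![\cdot,\cdot]\!],\rho),\phi)=(\Lambda_{(A^\ast,\phi)},E_{(A^\ast,\phi)}),\qquad \Lambda_{(A^\ast,\phi)}=\Lambda_{A^\ast}+\Delta\wedge\phi^v,\quad E_{(A^\ast,\phi)}=-\phi^v,$$ is a bijection.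
   Context: All manifolds, bundles, sections and functions are $C^\infty$. $\Gamma(A)$ is the space of global sections of $A$, and $\mathfrak{X}(M)$ is the Lie algebra of vector fields on $M$. Jacobi structure: a pair $(\Lambda,E)$ on a manifold $N$, with $\Lambda$ a 2-vector (bivector field) and $E$ a vector field, such that $[\Lambda,\Lambda]_{SN}=2E\wedge\Lambda$ and $[E,\Lambda]_{SN}=0$, where $[\cdot,\cdot]_{SN}$ is the Schouten-Nijenhuis bracket. Its Jacobi bracket is $\{F,G\}=\Lambda(dF,dG)+F\,E(G)-G\,E(F)$ for $F,G\in C^\infty(N,\mathbb{R})$. The sign convention for the Schouten-Nijenhuis bracket is the one for which $(\Lambda,E)$ is a Jacobi structure if and only if $\{\cdot,\cdot\}$ satisfies the Jacobi identity. Wedge convention: $(X\wedge Y)(\alpha,\beta)=\alpha(X)\beta(Y)-\alpha(Y)\beta(X)$. A Poisson structure is a Jacobi structure with $E=0$. Lie algebroid structure on $\pi:A\to M$: a pair $([\![\cdot,\cdot]\!],\rho)$ consisting of a (real) Lie algebra bracket $[\![\cdot,\cdot]\!]$ on $\Gamma(A)$ and a vector bundle homomorphism $\rho:A\to TM$ (the anchor map; the induced $C^\infty(M,\mathbb{R})$-module map $\Gamma(A)\to\mathfrak{X}(M)$ is also denoted $\rho$) such that $\rho:\Gamma(A)\to\mathfrak{X}(M)$ is a Lie algebra homomorphism and $[\![\mu,\bar f\eta]\!]=\bar f[\![\mu,\eta]\!]+(\rho(\mu)(\bar f))\eta$ for all $\mu,\eta\in\Gamma(A)$, $\bar f\in C^\infty(M,\mathbb{R})$.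 1-cocycle: a section $\phi\in\Gamma(A^\ast)$ with $\phi([\![\mu,\eta]\!])=\rho(\mu)(\phi(\eta))-\rho(\eta)(\phi(\mu))$ for all $\mu,\eta\in\Gamma(A)$. For $\mu\in\Gamma(A)$, $\tilde\mu\in C^\infty(A^\ast,\mathbb{R})$ is the fibrewise linear function $\tilde\mu(\alpha)=\alpha(\mu(\pi^\ast(\alpha)))$. A linear function on $A^\ast$ is a function of the form $\tilde\mu$ with $\mu\in\Gamma(A)$; a basic function on $A^\ast$ is a function of the form $\bar f\circ\pi^\ast$ with $\bar f\in C^\infty(M,\mathbb{R})$. Local coordinates: let $(x^1,\dots,x^m)$ be coordinates on an open set $U\subseteq M$, $\{e_i\}_{i=1,\dots,n}$ a local basis of sections of $A$ over $U$ with dual basis $\{e^i\}$, and $(x^i,\mu_j)$ the induced coordinates on $(\pi^\ast)^{-1}(U)$, with $\mu_j=\tilde e_j$. Given a Lie algebroid structure, write $[\![e_i,e_j]\!]=\sum_k c_{ij}^k e_k$ and $\rho(e_i)=\sum_l\rho_i^l\,\partial/\partial x^l$. $\Lambda_{A^\ast}$ is the Poisson structure on $A^\ast$ induced by the Lie algebroid structure, given locally by $$\Lambda_{A^\ast}=\sum_{i<j}\sum_k c_{ij}^k\mu_k\frac{\partial}{\partial\mu_i}\wedge\frac{\partial}{\partial\mu_j}+\sum_{i,l}\rho_i^l\frac{\partial}{\partial\mu_i}\wedge\frac{\partial}{\partial x^l}.$$ $\Delta$ is the Liouville vector field of $A^\ast$, locally $\Delta=\sum_i\mu_i\,\partial/\partial\mu_i$.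 $\phi^v\in\mathfrak{X}(A^\ast)$ is the vertical lift of $\phi\in\Gamma(A^\ast)$: if $\phi=\sum_i\phi_i e^i$ locally, then $\phi^v=\sum_i\phi_i\,\partial/\partial\mu_i$ (with $\phi_i$ regarded as a function on $(\pi^\ast)^{-1}(U)$ by composition with $\pi^\ast$, and similarly for $c_{ij}^k,\rho_i^l$).
   Formalization: The vector bundle A is assumed to have rank at least 1; for rank 0 over a positive-dimensional M the claim fails, since the set of algebroid-cocycle pairs is a single point while every Jacobi structure on M satisfies (C1) and (C2). *)

(* Defs.v *)
From HB Require Import structures.
From mathcomp Require Import all_boot all_order all_algebra.
From mathcomp Require Import all_classical all_reals all_analysis.

Set Implicit Arguments.
Unset Strict Implicit.
Unset Printing Implicit Defensive.

Import Order.TTheory GRing.Theory Num.Theory.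
Import numFieldNormedType.Exports.

Local Open Scope classical_set_scope.
Local Open Scope ring_scope.

Definition partial (R : realType) (d : nat) (f : 'rV[R]_d -> R) (l : 'I_d) :
    'rV[R]_d -> R :=
  fun x => 'D_(delta_mx 0 l) f x.

(* C^oo on an open set O: all iterated partial derivatives, of every order,
   are differentiable on O.  Values of f outside O are irrelevant. *)
Definition smooth_on (R : realType) (d : nat) (O : set 'rV[R]_d)
    (f : 'rV[R]_d -> R) : Prop :=
  forall (s : seq 'I_d) (x : 'rV[R]_d), O x ->
    differentiable (foldr (fun l g => partial g l) f s) x.

(* A set with an atlas.  [coords c] is meant on [cdom c], and [param c] on
   [coords c @` cdom c], where it is the inverse of [coords c]; both are total
   functions with arbitrary values elsewhere.  The axioms are in
   [is_manifold]; the topology is the one determined by the atlas. *)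
Record charted (R : realType) (d : nat) := Charted {
  point_of :> Type;
  chart_idx : Type;
  cdom : chart_idx -> set point_of;
  coords : chart_idx -> point_of -> 'rV[R]_d;
  param : chart_idx -> 'rV[R]_d -> point_of;
  chart_at : point_of -> chart_idx }.

Section Manifold.
Context {R : realType} {d : nat} {N : charted R d}.
Implicit Types (c : chart_idx N) (p q : N).

Definition mopen (W : set N) : Prop :=
  forall c, open (coords c @` (cdom c `&` W)).

Definition smooth_fun_on (D : set N) (f : N -> R) : Prop :=
  forall c, smooth_on (coords c @` (cdom c `&` D)) (f \o param c).

Definition smooth_fun (f : N -> R) : Prop := smooth_fun_on setT f.

Definition cpartial c (f : N -> R) (l : 'I_d) (p : N) : R :=
  partial (f \o param c) l (coords c p).

Definition jacobian c c' (p : N) : 'M[R]_d :=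
  \matrix_(k, l) cpartial c (fun q => coords c' q 0 l) k p.

(* A tangent vector at p is given by its components in all charts around p;
   components in the other charts are set to 0, so that Leibniz equality is
   equality of tangent vectors. *)
Definition is_tangent (p : N) (v : chart_idx N -> 'rV[R]_d) : Prop :=
  (forall c, ~ cdom c p -> v c = 0) /\
  (forall c c', cdom c p -> cdom c' p -> v c' = v c *m jacobian c c' p).

End Manifold.

Arguments mopen {R d} N W.

Record is_manifold (R : realType) (d : nat) (N : charted R d) : Prop := {
  chart_at_dom : forall p : N, cdom (chart_at p) p;
  coordsK : forall (c : chart_idx N) (p : N), cdom c p ->
    param c (coords c p) = p;
  cdom_open : forall c : chart_idx N, mopen N (cdom c);
  transition_smooth : forall (c c' : chart_idx N) (l : 'I_d),
    smooth_fun_on (cdom c') (fun p : N => coords c' p 0 l);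
  manifold_hausdorff : forall p q : N, p <> q ->
    exists W W' : set N,
      [/\ mopen N W, mopen N W', W p, W' q & W `&` W' = set0];
  manifold_second_countable : exists B : nat -> set N,
    (forall k, mopen N (B k)) /\
    (forall (W : set N) (p : N), mopen N W -> W p ->
       exists k, B k p /\ B k `<=` W) }.

(* Fields are families of components, one for each chart, with value 0
   outside the domain of the chart. *)
Definition vfield (R : realType) (d : nat) (N : charted R d) : Type :=
  chart_idx N -> N -> 'rV[R]_d.

Definition bivfield (R : realType) (d : nat) (N : charted R d) : Type :=
  chart_idx N -> N -> 'M[R]_d.

(* Entry (k, l) is (u /\ v)(dx^k, dx^l) = u_k v_l - v_k u_l. *)
Definition wedge (R : realType) (d : nat) (u v : 'rV[R]_d) : 'M[R]_d :=
  u^T *m v - v^T *m u.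

Section Tensors.
Context {R : realType} {d : nat} {N : charted R d}.
Implicit Types (X Y E : vfield N) (L : bivfield N) (F G : N -> R).

Record is_vfield X : Prop := {
  vfield_tangent : forall p, is_tangent p (X^~ p);
  vfield_smooth : forall c l, smooth_fun_on (cdom c) (fun p => X c p 0 l) }.

Record is_bivfield L : Prop := {
  bivfield_out : forall c p, ~ cdom c p -> L c p = 0;
  bivfield_skew : forall c p, cdom c p -> (L c p)^T = - L c p;
  bivfield_change : forall c c' p, cdom c p -> cdom c' p ->
    L c' p = (jacobian c c' p)^T *m L c p *m jacobian c c' p;
  bivfield_smooth : forall c k l,
    smooth_fun_on (cdom c) (fun p => L c p k l) }.

Definition vf_apply X F (p : N) : R :=
  \sum_l X (chart_at p) p 0 l * cpartial (chart_at p) F l p.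

Definition biv_apply L F G (p : N) : R :=
  \sum_k \sum_l L (chart_at p) p k l
     * cpartial (chart_at p) F k p * cpartial (chart_at p) G l p.

Definition lie_bracket X Y : vfield N := fun c p =>
  \row_l \sum_k (X c p 0 k * cpartial c (fun q => Y c q 0 l) k p
                 - Y c p 0 k * cpartial c (fun q => X c q 0 l) k p).

(* Components (i, j, k) of the Schouten-Nijenhuis bracket [L, L], i.e.
   2 (L(d(L(dx^j, dx^k)), dx^i) + cyclic); for the opposite convention
   ([L, L] replaced by its opposite), [L, L] = 2 E /\ L would not correspond
   to the Jacobi identity for [jacobi_bracket L E]. *)
Definition schouten_LL L (c : chart_idx N) (p : N) (i j k : 'I_d) : R :=
  2 * \sum_l (L c p l i * cpartial c (fun q => L c q j k) l p
              + L c p l j * cpartial c (fun q => L c q k i) l p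
              + L c p l k * cpartial c (fun q => L c q i j) l p).

(* Components of [E, L], the Lie derivative of L along E. *)
Definition schouten_EL E L (c : chart_idx N) (p : N) (i j : 'I_d) : R :=
  \sum_l (E c p 0 l * cpartial c (fun q => L c q i j) l p
          - L c p l j * cpartial c (fun q => E c q 0 i) l p
          - L c p i l * cpartial c (fun q => E c q 0 j) l p).

Definition wedge_EL E L (c : chart_idx N) (p : N) (i j k : 'I_d) : R :=
  E c p 0 i * L c p j k + E c p 0 j * L c p k i + E c p 0 k * L c p i j.

Record is_jacobi L E : Prop := {
  jacobi_bivfield : is_bivfield L;
  jacobi_vfield : is_vfield E;
  jacobi_LL : forall c p, cdom c p -> forall i j k,
    schouten_LL L c p i j k = 2 * wedge_EL E L c p i j k;
  jacobi_EL : forall c p, cdom c p -> forall i j,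
    schouten_EL E L c p i j = 0 }.

Definition jacobi_bracket L E F G : N -> R := fun p =>
  biv_apply L F G p + F p * vf_apply E G p - G p * vf_apply E F p.

End Tensors.

(* A rank n vector bundle over M, given by its fibres and an atlas of local
   trivializations; [triv i p] is meant for p in [tdom i], where [untriv i p]
   is its inverse.  The axioms are in [is_vbundle]. *)
Record vbundle (R : realType) (m : nat) (M : charted R m) (n : nat) :=
  VBundle {
    fiber :> M -> vectType R;
    triv_idx : Type;
    tdom : triv_idx -> set M;
    triv : triv_idx -> forall p : M, fiber p -> 'rV[R]_n;
    untriv : triv_idx -> forall p : M, 'rV[R]_n -> fiber p;
    triv_at : M -> triv_idx }.

Definition frame (R : realType) (m n : nat) (M : charted R m)
    (A : vbundle M n) (i : triv_idx A) (j : 'I_n) (p : M) : A p :=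
  untriv i p (delta_mx 0 j).

Record is_vbundle (R : realType) (m n : nat) (M : charted R m)
    (A : vbundle M n) : Prop := {
  triv_at_dom : forall p : M, tdom (triv_at A p) p;
  tdom_open : forall i : triv_idx A, mopen M (tdom i);
  triv_linear : forall (i : triv_idx A) (p : M), tdom i p ->
    linear (triv i (p := p));
  trivK : forall (i : triv_idx A) (p : M), tdom i p ->
    cancel (triv i (p := p)) (untriv i p);
  untrivK : forall (i : triv_idx A) (p : M), tdom i p ->
    cancel (untriv i p) (triv i (p := p));
  bundle_transition_smooth : forall (i i' : triv_idx A) (j k : 'I_n),
    smooth_fun_on (tdom i `&` tdom i')
      (fun p => triv i' (frame i j p) 0 k) }.

(* The total space, with the charts (x, y) where x are coordinates of the base
   point and y the components in a local trivialization. *)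
Definition total_space (R : realType) (m n : nat) (M : charted R m)
    (A : vbundle M n) : charted R (m + n) :=
  @Charted R (m + n) {p : M & A p} (chart_idx M * triv_idx A)
    (fun c => [set a | cdom c.1 (projT1 a) /\ tdom c.2 (projT1 a)])
    (fun c a => row_mx (coords c.1 (projT1 a)) (triv c.2 (projT2 a)))
    (fun c x => existT _ (param c.1 (lsubmx x))
                         (untriv c.2 (param c.1 (lsubmx x)) (rsubmx x)))
    (fun a => (chart_at (projT1 a), triv_at A (projT1 a))).

(* The components of a covector are its values on the local frame. *)
Definition dual (R : realType) (m n : nat) (M : charted R m)
    (A : vbundle M n) : vbundle M n :=
  @VBundle R m M n (fun p => 'Hom(A p, R^o) : vectType R)
    (triv_idx A) (@tdom _ _ _ _ A)
    (fun i p alpha => \row_j alpha (frame i j p))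
    (fun i p y =>
       linfun (fun v : A p => (\sum_j y 0 j * triv i v 0 j : R^o)))
    (triv_at A).

Record section (R : realType) (m n : nat) (M : charted R m)
    (A : vbundle M n) := Section {
  section_fun :> forall p : M, A p;
  section_smooth : forall (i : triv_idx A) (k : 'I_n),
    smooth_fun_on (tdom i) (fun p => triv i (section_fun p) 0 k) }.

Section LieAlgebroid.
Context {R : realType} {m n : nat} {M : charted R m} {A : vbundle M n}.

Definition bracket_type : Type := section A -> section A -> section A.

Definition anchor_type : Type := forall p : M, A p -> chart_idx M -> 'rV[R]_m.

Implicit Types (br : bracket_type) (rho : anchor_type) (phi : section (dual A)).

Definition anchor_vf rho (s : section A) : vfield M := fun c p => rho p (s p) c.

Record is_anchor rho : Prop := {
  anchor_tangent : forall p v, is_tangent p (rho p v);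
  anchor_linear : forall p a u v c,
    rho p (a *: u + v) c = a *: rho p u c + rho p v c;
  anchor_smooth : forall (i : triv_idx A) (c : chart_idx M) j l,
    smooth_fun_on (tdom i `&` cdom c) (fun p => rho p (frame i j p) c 0 l) }.

(* Linear combinations a s + t and products f t in the module of sections are
   described by a section u with the corresponding values. *)
Record is_lie_algebroid br rho : Prop := {
  algebroid_anchor : is_anchor rho;
  bracket_linear : forall (a : R) (s t u w : section A),
    (forall p, u p = a *: s p + t p) ->
    forall p, br u w p = a *: br s w p + br t w p;
  bracket_skew : forall (s t : section A) p, br s t p = - br t s p;
  bracket_jacobi : forall (s t u : section A) p,
    br s (br t u) p + br t (br u s) p + br u (br s t) p = 0;
  anchor_morphism : forall (s t : section A) c p, cdom c p ->
    anchor_vf rho (br s t) c p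
      = lie_bracket (anchor_vf rho s) (anchor_vf rho t) c p;
  bracket_leibniz : forall (f : M -> R) (s t u : section A), smooth_fun f ->
    (forall p, u p = f p *: t p) ->
    forall p, br s u p
      = f p *: br s t p + vf_apply (anchor_vf rho s) f p *: t p }.

Definition is_cocycle br rho phi : Prop := forall (s t : section A) p,
  phi p (br s t p)
    = vf_apply (anchor_vf rho s) (fun q => phi q (t q)) p
      - vf_apply (anchor_vf rho t) (fun q => phi q (s q)) p.

Definition algebroid_cocycles :
    set (bracket_type * anchor_type * section (dual A)) :=
  [set a | is_lie_algebroid a.1.1 a.1.2 /\ is_cocycle a.1.1 a.1.2 a.2].

Local Notation Astar := (total_space (dual A)).

Definition linear_fun (s : section A) : Astar -> R :=
  fun a => projT2 a (s (projT1 a)).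

Definition basic_fun (f : M -> R) : Astar -> R := fun a => f (projT1 a).

Definition linear_jacobi_structures : set (bivfield Astar * vfield Astar) :=
  [set J | [/\ is_jacobi J.1 J.2,
     forall s t : section A, exists u : section A,
       jacobi_bracket J.1 J.2 (linear_fun s) (linear_fun t) = linear_fun u &
     forall s : section A, exists f : M -> R, smooth_fun f /\
       jacobi_bracket J.1 J.2 (linear_fun s) (fun=> 1) = basic_fun f]].

Definition agree_near (p : M) (e e' : forall q : M, A q) : Prop :=
  exists W : set M, [/\ mopen M W, W p & forall q, W q -> e q = e' q].

(* Value at p of the bracket of two local sections e, e' defined near p: the
   value at p of the bracket of global sections with the same germs (for a Lie
   algebroid this value does not depend on their choice). *)
Definition local_bracket br (e e' : forall q : M, A q) (p : M) : A p :=
  xget 0 [set v | exists s t : section A,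
    [/\ agree_near p s e, agree_near p t e' & v = br s t p]].

Definition structure_fun br (i : triv_idx A) (j k l : 'I_n) (p : M) : R :=
  triv i (local_bracket br (frame i j) (frame i k) p) 0 l.

Definition ddx (l : 'I_m) : 'rV[R]_(m + n) := delta_mx 0 (lshift n l).

Definition ddmu (j : 'I_n) : 'rV[R]_(m + n) := delta_mx 0 (rshift m j).

Definition Lambda_dual br rho : bivfield Astar :=
  fun (c : chart_idx Astar) (a : Astar) =>
    let p := projT1 a in
    let mu := triv (v := dual A) c.2 (projT2 a) in
    if `[< cdom c a >] then
      \sum_(i < n) \sum_(j < n | (i < j)%N) \sum_(k < n)
        (structure_fun br c.2 i j k p * mu 0 k) *: wedge (ddmu i) (ddmu j)
      + \sum_(i < n) \sum_(l < m)
        rho p (frame (A := A) c.2 i p) c.1 0 l *: wedge (ddmu i) (ddx l)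
    else 0.

Definition liouville : vfield Astar :=
  fun (c : chart_idx Astar) (a : Astar) =>
    let mu := triv (v := dual A) c.2 (projT2 a) in
    if `[< cdom c a >] then \sum_(i < n) mu 0 i *: ddmu i else 0.

Definition vertical_lift phi : vfield Astar :=
  fun (c : chart_idx Astar) (a : Astar) =>
    let p := projT1 a in
    if `[< cdom c a >] then \sum_(i < n) phi p (frame (A := A) c.2 i p) *: ddmu i
    else 0.

Definition Psi (a : bracket_type * anchor_type * section (dual A)) :
    bivfield Astar * vfield Astar :=
  let: (br, rho, phi) := a in
  ((fun c x => Lambda_dual br rho c x
               + wedge (liouville c x) (vertical_lift phi c x)),
   (fun c x => - vertical_lift phi c x)).

End LieAlgebroid.

Arguments algebroid_cocycles {R m n M} A.
Arguments linear_jacobi_structures {R m n M} A.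
Arguments Psi {R m n M} A a.

(* Main.v *)
Require Import Defs.
From HB Require Import structures.
From mathcomp Require Import all_boot all_order all_algebra.
From mathcomp Require Import all_classical all_reals all_analysis.
From mathcomp Require Import ring lra.

(* Write lin s for the linear function of a section s and bas f for the basic
   function of f. If (L, E) is the image of ((br, rho), phi), then
     {lin s, lin t} = lin (br s t),
     {lin s, bas f} = bas (rho(s) f + f phi(s)),   {bas f, bas g} = 0,
   and these formulas determine (L, E): near every point the coordinates of the
   total space agree with linear or basic functions, thanks to bump functions.
   The Jacobiator of a bracket satisfies
     J(F, G, H) = - (1/2 [L, L] - E /\ L)(dF, dG, dH)
                  + sum_cyc F [E, L](dG, dH),
   so that (L, E) is a Jacobi structure if and only if J vanishes on linear and
   basic functions; by the formulas above this is the Jacobi identity of br, the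
   morphism property of the anchor and, with H = 1, the cocycle condition.
   Conversely, (C1) and (C2) force E (bas f) = 0, {bas f, bas g} = 0 and make
   L (lin s, bas f) basic, because a function g on the dual bundle such that
   g (lin s) is basic for all s is zero, and g is basic if every g (lin s) is
   linear; then br, rho and phi are read off from the three formulas. *)

Set Implicit Arguments.
Unset Strict Implicit.
Unset Printing Implicit Defensive.

Import Order.TTheory GRing.Theory Num.Theory.
Import numFieldNormedType.Exports.

Local Open Scope classical_set_scope.
Local Open Scope ring_scope.

(** * Smooth functions on Euclidean spaces *)

(** Fields are families of components and [Psi] is given by local formulas, so that even the tensor
    property of its values would require the transformation laws of the structure functions. This is
    avoided by keeping only the values on linear and basic functions: they involve no chart, and
    they determine the components, the transformation law and the smoothness. The price is that the
    algebroid and the conditions (C1), (C2) only know global sections and functions, so every local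
    frame and coordinate has to be replaced by global objects with the same germ. For rank 0 all
    linear functions vanish, (C1) and (C2) are empty, and any nonzero vector field on the base
    gives, with zero bivector, a Jacobi structure missed by [Psi]; hence the assumption [0 < n],
    which provides a fibre coordinate to divide by. On the zero set of that coordinate a derivative
    along the fibre replaces the division. *)

Section Euclidean.
Context {R : realType} {d : nat}.
Implicit Types (O : set 'rV[R]_d) (f g h : 'rV[R]_d -> R) (x v : 'rV[R]_d).

(** The differential of [f] at [x] also serves for [g]: the difference [g - f] vanishes near [x],
    hence is negligible against the displacement. *)
Lemma near_eq_differentiable f g x :
  {near x, f =1 g} -> differentiable f x -> differentiable g x.
Proof.
move=> fg df; apply/diffP.
apply: (@getPex _ (fun dg : {linear 'rV[R]_d -> R} => continuous dg /\
  forall y, g y = g (lim (nbhs x)) + dg (y - lim (nbhs x))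
                  +o_(y \near x) (y - lim (nbhs x)))).
exists ('d f x); split; first exact: diff_continuous.
apply: eqaddoEx => z; rewrite lim_id//.
have fgx := nbhs_singleton fg.
pose D := g - f.
have -> : g z = f z + D z by rewrite /D /= addrC subrK.
have Do : D =o_x (center x).
  apply/eqoP => e e0; near=> w; rewrite /D.
  have -> : (g - f) w = g w - f w by [].
  rewrite -(near fg w)// subrr normr0 mulr_ge0// ltW//.
rewrite Do {1}(diffE df z) lim_id// fgx -addrA.
by rewrite addox.
Unshelve. all: by end_near. Qed.

Lemma partialE f x v : differentiable f x ->
  'D_v f x = \sum_l v 0 l * partial f l x.
Proof.
move=> df; rewrite deriveE// {1}(row_sum_delta v) linear_sum/=.
by apply: eq_bigr => l _; rewrite linearZ/= /partial deriveE.
Qed.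

Lemma near_eq_partial f g l x : {near x,
  f =1 g} -> partial f l x = partial g l x.
Proof. by move=> fg; apply: near_eq_derive. Qed.

Lemma partialD f g l x : differentiable f x -> differentiable g x ->
  partial (fun y => f y + g y) l x = partial f l x + partial g l x.
Proof. by move=> df dg; apply: deriveD; apply: diff_derivable. Qed.

Lemma partialM f g l x : differentiable f x -> differentiable g x ->
  partial (fun y => f y * g y) l x = f x * partial g l x + g x * partial f l x.
Proof. by move=> df dg; apply: deriveM; apply: diff_derivable. Qed.

Lemma partial_cst (a : R) l x : partial (fun=> a) l x = 0.
Proof. exact: derive_cst. Qed.

Lemma diff_coord k x v : 'd (fun y : 'rV[R]_d => y 0 k : R) x v = v 0 k.
Proof.
have @c : {linear 'rV[R]_d -> R}.
  by exists (fun N : 'rV[R]_d => N 0 k); do 2![eexists]; do ?[constructor];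
     rewrite ?mxE// => ? *; rewrite ?mxE//; move=> ?; rewrite !mxE.
rewrite (_ : (fun y : 'rV[R]_d => y 0 k : R) = c)// diff_lin//.
exact: coord_continuous.
Qed.

Lemma partial_coord k l x : partial (fun y : 'rV[R]_d => y 0 k)
  l x = (l == k)%:R.
Proof.
rewrite /partial deriveE; last exact: differentiable_coord.
by rewrite diff_coord mxE eqxx eq_sym.
Qed.

Lemma differentiable_mul f g x : differentiable f x -> differentiable g x ->
  differentiable (fun y => f y * g y) x.
Proof. exact: differentiableM. Qed.

Lemma differentiable_add f g x : differentiable f x -> differentiable g x ->
  differentiable (fun y => f y + g y) x.
Proof. exact: differentiableD. Qed.

Lemma differentiable_bigsum (I : Type) (r : seq I) (P : pred I)
    (F : I -> 'rV[R]_d -> R) x :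
  (forall i, P i -> differentiable (F i) x) ->
  differentiable (fun y => \sum_(i <- r | P i) F i y) x.
Proof.
move=> dF; elim: r => [|i r IH].
  rewrite (_ : (fun y => _) = fun=> 0); last by apply/funext => y;
    rewrite big_nil.
  exact: differentiable_cst.
rewrite (_ : (fun y => _) = fun y => (if P i then F i y else 0) +
    \sum_(j <- r | P j) F j y); last first.
  by apply/funext => y; rewrite big_cons; case: (P i); rewrite ?add0r.
apply: differentiable_add => //; case: (boolP (P i)) => [/dF//|_].
exact: differentiable_cst.
Qed.

Lemma partial_sum (I : Type) (r : seq I) (P : pred I)
    (F : I -> 'rV[R]_d -> R) l x :
  (forall i, P i -> differentiable (F i) x) ->
  partial (fun y => \sum_(i <- r | P i) F i y) l x =
  \sum_(i <- r | P i) partial (F i) l x.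
Proof.
move=> dF; elim: r => [|i r IH].
  rewrite (_ : (fun y => _) = fun=> 0) ?partial_cst ?big_nil//.
  by apply/funext => y; rewrite big_nil.
rewrite (_ : (fun y => _) = fun y => (if P i then F i y else 0) +
    \sum_(j <- r | P j) F j y); last first.
  by apply/funext => y; rewrite big_cons; case: (P i); rewrite ?add0r.
rewrite big_cons partialD ?IH; last exact: differentiable_bigsum.
  by case: ifPn => // _; rewrite partial_cst add0r.
by case: (boolP (P i)) => [/dF//|_]; exact: differentiable_cst.
Qed.

(* [f] has [k + 1] derivatives on [O]; the recursion peels off the innermost
   derivative, which is what the product and chain rules need. *)
Fixpoint diff_on (k : nat) O f : Prop :=
  (forall x, O x -> differentiable f x) /\
  if k is k'.+1 then forall l, diff_on k' O (partial f l) else True.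

(** In the [foldr] of [smooth_on] the head of the list is the outermost derivative; [diff_on] peels
    off the innermost one, which is the last element, hence [rcons]. *)
Lemma smooth_onP O f : smooth_on O f <-> forall k, diff_on k O f.
Proof.
split=> [+ k|+ s].
  elim: k f => [|k IH] f sf; split=> //; first by move=> x Ox; apply: (sf [::]).
  - by move=> x Ox; apply: (sf [::]).
  - by move=> l; apply: IH => s x Ox; move: (sf (rcons s l) x Ox);
    rewrite foldr_rcons.
elim/last_ind: s f => [|s l IH] f sf x Ox /=; first by case: (sf 0%N) => + _;
  apply.
by rewrite foldr_rcons; apply: IH => // k; case: (sf k.+1) => _; apply.
Qed.

Lemma smooth_on_diff O f x : smooth_on O f -> O x -> differentiable f x.
Proof. by move=> sf; apply: (sf [::]). Qed.

Lemma smooth_on_partial O f l : smooth_on O f -> smooth_on O (partial f l).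
Proof.
by move=> /smooth_onP sf; apply/smooth_onP => k; case: (sf k.+1) => _; apply.
Qed.

Lemma smooth_on_sub O O' f : O `<=` O' -> smooth_on O' f -> smooth_on O f.
Proof. by move=> OO' sf s x /OO'; apply: sf. Qed.

(** Openness of [O] turns equality on [O] into equality near each of its points, which is all that
    derivatives depend on. *)
Lemma diff_on_ext k O f g : open O -> (forall x, O x -> f x = g x) ->
  diff_on k O f -> diff_on k O g.
Proof.
move=> oO; have nearO x : O x -> \forall y \near x, O y by move=> Ox;
  apply: open_nbhs_nbhs.
have nfg f' g' : (forall x, O x -> f' x = g' x) -> forall x, O x -> {near x,
  f' =1 g'}.
  by move=> e x /nearO; apply: filterS.
elim: k f g => [|k IH] f g fg [df pf]; split=> //=.
- by move=> x Ox; apply: near_eq_differentiable (df x Ox); apply: nfg.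
- by move=> x Ox; apply: near_eq_differentiable (df x Ox); apply: nfg.
- move=> l; apply: IH (pf l) => x Ox; apply: near_eq_partial; exact: nfg.
Qed.

Lemma smooth_on_ext O f g : open O -> (forall x, O x -> f x = g x) ->
  smooth_on O f -> smooth_on O g.
Proof.
by move=> oO fg /smooth_onP sf; apply/smooth_onP => k;
  apply: diff_on_ext (sf k).
Qed.

Lemma smooth_on_local O f :
  (forall x, O x -> exists2 O', O' x & smooth_on O' f) -> smooth_on O f.
Proof. by move=> h s x Ox; have [U' Ux sf] := h x Ox; apply: sf. Qed.

Lemma diff_on_cst k O (a : R) : diff_on k O (fun=> a).
Proof.
elim: k a => [|k IH] a; split=> //=; try by move=> x _;
  apply: differentiable_cst.
by move=> l; rewrite (_ : partial _ _ = fun=> 0) //; apply/funext => x;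
  exact: partial_cst.
Qed.

Lemma smooth_on_cst O (a : R) : smooth_on O (fun=> a).
Proof. by apply/smooth_onP => k; apply: diff_on_cst. Qed.

Lemma smooth_on_coord O k : smooth_on O (fun x => x 0 k).
Proof.
apply/smooth_onP => -[|j]; split=> //=;
  try by move=> x _; apply: (@differentiable_coord R 1 d).
move=> l; rewrite (_ : partial _ _ = fun=> (l == k)%:R);
  first exact: diff_on_cst.
by apply/funext => x; exact: partial_coord.
Qed.

Lemma diff_on_le k O f : diff_on k.+1 O f -> diff_on k O f.
Proof.
elim: k f => [|k IH] f [df pf]; split=> // l; apply: IH; exact: pf.
Qed.

Lemma diff_onD k O f g : open O -> diff_on k O f -> diff_on k O g ->
  diff_on k O (fun x => f x + g x).
Proof.
move=> oO; elim: k f g => [|k IH] f g [df pf] [dg pg]; split=> //=.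
- by move=> x Ox; apply: differentiable_add; [apply: df|apply: dg].
- by move=> x Ox; apply: differentiable_add; [apply: df|apply: dg].
- move=> l; apply: (@diff_on_ext _ _ (fun x => partial f l x + partial g l x))
  => //.
    by move=> x Ox; rewrite partialD; [|exact: df|exact: dg].
  by apply: IH; [apply: pf|apply: pg].
Qed.

Lemma smooth_onD O f g : open O -> smooth_on O f -> smooth_on O g ->
  smooth_on O (fun x => f x + g x).
Proof.
move=> oO /smooth_onP sf /smooth_onP sg; apply/smooth_onP => k.
exact: diff_onD.
Qed.

Lemma diff_onM k O f g : open O -> diff_on k O f -> diff_on k O g ->
  diff_on k O (fun x => f x * g x).
Proof.
move=> oO; elim: k f g => [|k IH] f g hf hg.
  case: hf hg => df _ [dg _]; split=> // x Ox.
  by apply: differentiable_mul; [apply: df|apply: dg].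
have [hf' hg'] := (diff_on_le hf, diff_on_le hg).
case: hf hg => df pf [dg pg]; split=> [x Ox|l].
  by apply: differentiable_mul; [apply: df|apply: dg].
apply: (@diff_on_ext _ _ (fun x => f x * partial g l x + g x * partial f l x))
  => //.
  by move=> x Ox; rewrite partialM; [|exact: df|exact: dg].
by apply: diff_onD => //; apply: IH => //; [apply: pg|apply: pf].
Qed.

Lemma smooth_onM O f g : open O -> smooth_on O f -> smooth_on O g ->
  smooth_on O (fun x => f x * g x).
Proof.
move=> oO /smooth_onP sf /smooth_onP sg; apply/smooth_onP => k.
exact: diff_onM.
Qed.

Lemma smooth_on_sum O (I : Type) (r : seq I) (P : pred I)
    (F : I -> 'rV[R]_d -> R) : open O ->
  (forall i, P i -> smooth_on O (F i)) ->
  smooth_on O (fun y => \sum_(i <- r | P i) F i y).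
Proof.
move=> oO sF; elim: r => [|i r IH].
  rewrite (_ : (fun y => _) = fun=> 0); last by apply/funext => y;
    rewrite big_nil.
  exact: smooth_on_cst.
rewrite (_ : (fun y => _) = fun y => (if P i then F i y else 0) +
    \sum_(j <- r | P j) F j y); last first.
  by apply/funext => y; rewrite big_cons; case: (P i); rewrite ?add0r.
apply: smooth_onD => //; case: (boolP (P i)) => [/sF//|_].
exact: smooth_on_cst.
Qed.

Lemma smooth_on_prod O (I : Type) (r : seq I) (P : pred I)
    (F : I -> 'rV[R]_d -> R) : open O ->
  (forall i, P i -> smooth_on O (F i)) ->
  smooth_on O (fun y => \prod_(i <- r | P i) F i y).
Proof.
move=> oO sF; elim: r => [|i r IH].
  rewrite (_ : (fun y => _) = fun=> 1); last by apply/funext => y;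
    rewrite big_nil.
  exact: smooth_on_cst.
rewrite (_ : (fun y => _) = fun y => (if P i then F i y else 1) *
    \prod_(j <- r | P j) F j y); last first.
  by apply/funext => y; rewrite big_cons; case: (P i); rewrite ?mul1r.
apply: smooth_onM => //; case: (boolP (P i)) => [/sF//|_].
exact: smooth_on_cst.
Qed.

Lemma smooth_onV O f : open O -> (forall x, O x -> f x != 0) -> smooth_on O f ->
  smooth_on O (fun x => (f x)^-1).
Proof.
move=> oO f0 sf.
have df x : O x -> differentiable (fun x => (f x)^-1) x.
  by move=> Ox; apply: differentiableV; [exact: smooth_on_diff Ox|exact: f0].
apply/smooth_onP; elim=> [|k IH]; split=> //= l.
(* The derivative of [1/f] is, up to sign, a derivative of [f] times two factors [1/f], so the
   induction hypothesis about [1/f] itself closes the step. *)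
apply: (@diff_on_ext _ _ (fun x => -1 * ((f x)^-1 * (f x)^-1)
  * partial f l x)) => //.
  move=> x Ox; rewrite [RHS]deriveV ?f0//; last first.
    by apply: diff_derivable; exact: smooth_on_diff Ox.
  by rewrite /GRing.scale/= mulN1r -invfM -expr2.
apply: diff_onM => //; last first.
  by have /smooth_onP sf' := sf; case: (sf' k.+1) => _; apply.
by apply: diff_onM => //; [exact: diff_on_cst|apply: diff_onM].
Qed.

End Euclidean.

(** * The chain rule and composition of smooth maps *)

Section Composition.
Context {R : realType} {d e : nat}.

Lemma differentiable_row (G : 'rV[R]_d -> 'rV[R]_e) x :
  (forall k, differentiable (fun y => G y 0 k) x) -> differentiable G x.
Proof.
move=> dG; have -> : G = \sum_k (fun y => G y 0 k *: delta_mx 0 k).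
  by apply/funext => y; rewrite fct_sumE; exact: row_sum_delta.
by apply: differentiable_sum => k; apply: differentiableZl.
Qed.

Lemma partial_comp (f : 'rV[R]_e -> R) (G : 'rV[R]_d -> 'rV[R]_e) l x :
  differentiable f (G x) -> (forall k, differentiable (fun y => G y 0 k) x) ->
  partial (f \o G) l x = \sum_k partial (fun y => G y 0 k)
    l x * partial f k (G x).
Proof.
move=> df dG; have dGx := differentiable_row dG.
have [/= dfG] := is_diff_comp (differentiableP dGx) (differentiableP df).
rewrite /partial (deriveE _ dfG) => ->/=.
rewrite -deriveE// (partialE _ df); apply: eq_bigr => k _; congr (_ * _).
rewrite /partial deriveE//.
have dc : differentiable (fun y : 'rV[R]_e => y 0 k : R) (G x).
  exact: (@differentiable_coord R 1 e).
have [_ dcG] := is_diff_comp (differentiableP dGx) (differentiableP dc).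
have -> : (fun y => G y 0 k) = (fun y : 'rV[R]_e => y 0 k) \o G by [].
by rewrite dcG /= diff_coord.
Qed.

Lemma smooth_on_comp (O : set 'rV[R]_d) (O' : set 'rV[R]_e)
    (f : 'rV[R]_e -> R) (G : 'rV[R]_d -> 'rV[R]_e) :
  open O -> (forall x, O x -> O' (G x)) ->
  (forall k, smooth_on O (fun x => G x 0 k)) ->
  smooth_on O' f -> smooth_on O (f \o G).
Proof.
move=> oO OG sG sf.
have dG x : O x -> forall k, differentiable (fun x => G x 0 k) x.
  by move=> Ox k; exact: smooth_on_diff Ox.
have dfG h x : smooth_on O' h -> O x -> differentiable (h \o G) x.
  move=> sh Ox; apply: differentiable_comp;
    last exact: smooth_on_diff (OG _ Ox).
  exact: differentiable_row (dG _ Ox).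
apply/smooth_onP => n; elim: n f sf => [|n IH] f sf; split=> //;
  first by move=> x; exact: dfG.
  by move=> x; exact: dfG.
(* By the chain rule; the induction hypothesis covers all smooth outer functions, so it applies to
   each [partial f k]. *)
move=> l; apply: (@diff_on_ext _ _ _ _ (fun x =>
    \sum_k partial (fun y => G y 0 k) l x * (partial f k \o G) x)) => //.
  by move=> x Ox; rewrite partial_comp//;
    [exact: smooth_on_diff (OG _ Ox)|exact: dG].
suff : forall k, diff_on n O (fun x => partial (fun y => G y 0 k)
  l x * (partial f k \o G) x).
  elim: (index_enum _) => [_|k r IHr h].
    rewrite (_ : (fun y => _) = fun=> 0); first exact: diff_on_cst.
    by apply/funext => y; rewrite big_nil.
  rewrite (_ : (fun y => _) = fun y => partial (fun y => G y 0 k)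
    l y * (partial f k \o G) y +
    \sum_(j <- r) partial (fun y => G y 0 j) l y * (partial f j \o G) y);
      last first.
    by apply/funext => y; rewrite big_cons.
  by apply: diff_onD => //; exact: IHr.
move=> k; apply: diff_onM => //; last by apply: IH; exact: smooth_on_partial.
have /smooth_onP := smooth_on_partial l (sG k); exact.
Qed.

End Composition.

Section OneVariable.
Context {R : realType} {d : nat}.

(** [H] lists the successive derivatives of the outer function, and the induction on the order
    treats all its members at once. *)
Lemma smooth_on_comp1 (H : nat -> R -> R) (O : set 'rV[R]_d) u : open O ->
  (forall n (t : R), is_derive t (1 : R) (H n) (H n.+1 t)) ->
  smooth_on O u -> smooth_on O (H 0%N \o u).
Proof.
move=> oO dH su.
have dHt n t : differentiable (H n) t by apply/derivable1_diffP; case: (dH n t).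
have dHu n x : O x -> differentiable (H n \o u) x.
  by move=> Ox; apply: differentiable_comp => //; exact: smooth_on_diff Ox.
have pHu n x l : O x -> partial (H n \o u) l x = (H n.+1 \o u)
  x * partial u l x.
  move=> Ox; have dux := smooth_on_diff su Ox.
  have [/= _] := is_diff_comp (differentiableP dux)
    (differentiableP (dHt n (u x))).
  rewrite /partial (deriveE _ (dHu n x Ox)) => ->/=.
  rewrite -(deriveE _ dux) diff1E// derive1E; have [_ ->] := dH n (u x).
  by rewrite /GRing.scale/= mulrC.
suff h k n : diff_on k O (H n \o u) by apply/smooth_onP => k; exact: h.
elim: k n => [|k IH] n; split=> //; try by move=> x; exact: dHu.
move=> l; apply: (@diff_on_ext _ _ _ _ (fun x => (H n.+1 \o u)
  x * partial u l x)) => //.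
  by move=> x Ox; rewrite pHu.
apply: diff_onM => //; by have /smooth_onP := smooth_on_partial l su; exact.
Qed.

End OneVariable.

Section FirstOrder.
Context {R : realType} {d : nat}.
Implicit Types (f g : 'rV[R]_d -> R) (x v w : 'rV[R]_d).

Lemma is_derive_line f a v (t : R) : derivable f (a + t *: v) v ->
  is_derive t (1 : R) (fun s : R => f (a + s *: v)) ('D_v f (a + t *: v)).
Proof.
have E : (fun h : R => h^-1 *: (f (a + (h *: (1:R) + t) *: v)
  - f (a + t *: v))) =
    (fun h : R => h^-1 *: (f (h *: v + (a + t *: v)) - f (a + t *: v))).
  apply/funext => h; congr (_ *: (f _ - _)).
  by rewrite /GRing.scale/= mulr1 -/(GRing.scale _ _) scalerDl addrCA.
move=> dv; apply: DeriveDef; last by rewrite /derive /= E.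
by rewrite /derivable /= E.
Qed.

Lemma diff_approx g x : differentiable g x -> forall e : R, 0 < e ->
  exists2 r : R, 0 < r &
    forall h, `|h| < r -> `|g (x + h) - g x - 'D_h g x| <= e * `|h|.
Proof.
move=> dg e e0; have /diff_locallyP[_ /eqaddoP/(_ _ e0)] := dg.
move=> /nbhs_normP[r r0 gr]; exists r => // h hr.
have := gr h; rewrite /= sub0r normrN => /(_ hr).
by rewrite deriveE// !fctE /= opprD addrA (addrC h x).
Qed.

End FirstOrder.

(** * Symmetry of second partial derivatives *)

Section SymmetricPartials.
Context {R : realType} {d : nat}.
Implicit Types (f g : 'rV[R]_d -> R) (x v w : 'rV[R]_d) (O : set 'rV[R]_d).

(* Mean value theorem along [v] for the increment in [w], then the first-order
   expansion of ['D_v f] at [x]. *)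
Lemma second_difference O f x v w : open O -> O x ->
  (forall y, O y -> differentiable f y) -> differentiable (fun y => 'D_v f y)
    x ->
  forall e : R, 0 < e -> exists2 r : R, 0 < r & forall t : R, 0 < t -> t < r ->
    `|f (x + t *: w + t *: v) - f (x + t *: v) - f (x + t *: w) + f x
      - t ^+ 2 * 'D_w (fun y => 'D_v f y) x| <= e * t ^+ 2.
Proof.
move=> oO Ox df dg e e0; set g := fun y => 'D_v f y in dg *.
have nv0 := normr_ge0 v; have nw0 := normr_ge0 w.
(* Displacements [t *: w + c *: v] with [0 <= c <= t] have norm at most [t * K]; the [+ 1] keeps [K]
   positive. Each of the two first-order expansions of [g] then costs
   [e / (2 * K) * (t * K) = e * t / 2]. *)
pose K := `|v| + `|w| + 1; have K0 : 0 < K by rewrite /K; lra.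
have e'0 : 0 < e / (2 * K) by rewrite divr_gt0// mulr_gt0.
have [r r0 gr] := diff_approx dg e'0.
have /nbhs_normP[r' r'0 Or] : nbhs x O by exact: open_nbhs_nbhs.
exists (Num.min r r' / K) => [|t t0 tr]; first by rewrite divr_gt0// lt_min r0.
have {tr} : t * K < Num.min r r' by rewrite -ltr_pdivlMr.
rewrite lt_min => /andP[tr tr'].
have bnd c : 0 <= c <= t -> `|c *: v| <= t * K /\ `|t *: w + c *: v| <= t * K.
  move=> /andP[c0 ct].
  have h1 : `|c *: v| <= t * `|v| by rewrite normrZ ger0_norm// ler_wpM2r.
  have h2 : `|t *: w| = t * `|w| by rewrite normrZ gtr0_norm.
  have h3 := ler_normD (t *: w) (c *: v).
  by rewrite /K; split; nra.
have Ox' h : `|h| <= t * K -> O (x + h).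
  move=> hK; apply: Or => /=.
  by rewrite opprD addrA subrr sub0r normrN (le_lt_trans hK).
pose phi (s : R) := f (x + t *: w + s *: v) - f (x + s *: v).
have dphi c : 0 <= c <= t ->
    is_derive c (1 : R) phi (g (x + t *: w + c *: v) - g (x + c *: v)).
  move=> /bnd[b1 b2]; apply: is_deriveB; apply: is_derive_line;
    apply: diff_derivable; apply: df; rewrite -?addrA; exact: Ox'.
have [||c] := @MVT R phi (fun c => g (x + t *: w + c *: v) - g (x + c *: v))
  0 t t0.
- by move=> c; rewrite in_itv/= => /andP[c0 ct]; apply: dphi; rewrite !ltW.
- apply: derivable_within_continuous => c; rewrite in_itv/= => /dphi dc.
  by case: dc.
rewrite in_itv/= => /andP[/ltW c0 /ltW ct]; rewrite subr0 => phiE.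
have [b1 b2] : _ /\ _ := bnd c (introT andP (conj c0 ct)).
have -> : f (x + t *: w + t *: v) - f (x + t *: v) - f (x + t *: w) + f x =
    phi t - phi 0 by rewrite /phi !scale0r !addr0; ring.
have g1 := gr _ (le_lt_trans b1 tr).
have g2 := gr _ (le_lt_trans b2 tr).
have eK : e / (2 * K) * (t * K) = e * t / 2 by field; rewrite gt_eqF.
have {}g1 := le_trans g1 (ler_wpM2l (ltW e'0) b1).
have {}g2 := le_trans g2 (ler_wpM2l (ltW e'0) b2).
have DE : 'D_(t *: w + c *: v) g x = t * 'D_w g x + 'D_(c *: v) g x.
  by rewrite !deriveE// linearD linearZ.
rewrite phiE; move: g1 g2; rewrite DE addrA eK.
set P := g (x + c *: v); set Q := g (x + t *: w + c *: v).
set D := 'D_w g x; set D' := 'D_(c *: v) g x.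
move=> g1 g2.
have -> : (Q - P) * t - t ^+ 2 * D =
    t * ((Q - g x - (t * D + D')) - (P - g x - D')) by ring.
rewrite normrM gtr0_norm// expr2 mulrA mulrC ler_wpM2r ?(ltW t0)//.
apply: (le_trans (ler_normB _ _)); move: g1 g2.
by move: `|_| `|_| => y z; clear; lra.
Qed.

Lemma dist_le_of_approx (D a b t e : R) : 0 < t ->
  `|D - t ^+ 2 * a| <= e * t ^+ 2 -> `|D - t ^+ 2 * b| <= e * t ^+ 2 ->
  `|a - b| <= 2 * e.
Proof.
move=> t0 h1 h2; have t20 : 0 < t ^+ 2 by rewrite exprn_gt0.
rewrite -(ler_pM2l t20) -{1}(gtr0_norm t20) -normrM.
have -> : t ^+ 2 * (a - b) = (D - t ^+ 2 * b) - (D - t ^+ 2 * a) by ring.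
have -> : t ^+ 2 * (2 * e) = e * t ^+ 2 + e * t ^+ 2 by ring.
by apply: (le_trans (ler_normB _ _)); exact: lerD.
Qed.

(** The second difference is symmetric in its two directions, so [t ^+ 2] times either mixed
    derivative approximates it up to [e * t ^+ 2]. The mixed derivatives are then at distance at
    most [2 * e], which is absurd for [e] a quarter of that distance. *)
Lemma schwarz O f x k l : open O -> O x ->
  (forall y, O y -> differentiable f y) ->
  differentiable (partial f k) x -> differentiable (partial f l) x ->
  partial (partial f k) l x = partial (partial f l) k x.
Proof.
move=> oO Ox df dk dl; apply/eqP/negP => /negP ne.
set a := partial (partial f k) l x in ne;
  set b := partial (partial f l) k x in ne.
pose e := `|a - b| / 4.
have e0 : 0 < e by rewrite divr_gt0// normr_gt0 subr_eq0.
have [r r0 h1] := @second_difference O f x (delta_mx 0 k) (delta_mx 0 l)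
  oO Ox df dk e e0.
have [r' r'0 h2] := @second_difference O f x (delta_mx 0 l) (delta_mx 0 k)
  oO Ox df dl e e0.
have m0 : 0 < Num.min r r' by rewrite lt_min r0.
pose t := Num.min r r' / 2.
have t0 : 0 < t by rewrite divr_gt0.
have : t < Num.min r r' by rewrite /t; lra.
rewrite lt_min => /andP[tr tr'].
pose v : 'rV[R]_d := t *: delta_mx 0 k; pose w : 'rV[R]_d := t *: delta_mx 0 l.
have {}h1 : `|f (x + w + v) - f (x + v) - f (x + w)
  + f x - t ^+ 2 * a| <= e * t ^+ 2.
  exact: h1 t t0 tr.
have {}h2 : `|f (x + w + v) - f (x + v) - f (x + w)
  + f x - t ^+ 2 * b| <= e * t ^+ 2.
  by have := h2 t t0 tr'; rewrite -/v -/w (addrAC x v w)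
    (addrAC (f (x + w + v))).
have := dist_le_of_approx t0 h1 h2.
by move: `|a - b| @e e0 {h1 h2} => y e; rewrite /e; clear; lra.
Qed.

Lemma smooth_on_schwarz O f x k l : open O -> O x -> smooth_on O f ->
  partial (partial f k) l x = partial (partial f l) k x.
Proof.
move=> oO Ox sf; apply: (schwarz oO Ox) => [y Oy||].
- exact: (smooth_on_diff sf Oy).
- exact: (smooth_on_diff (smooth_on_partial k sf) Ox).
- exact: (smooth_on_diff (smooth_on_partial l sf) Ox).
Qed.
End SymmetricPartials.

(** * Bump functions on Euclidean spaces *)

Section FlatFunction.
Context {R : realType}.
Implicit Types (P Q : {poly R}) (t x : R).

(* These functions form a class stable under derivation, see
   [is_derive_flat_exp]; [P = 1] gives the usual flat function. *)
Definition flat_exp P t : R := if 0 < t then P.[t^-1] * expR (- t^-1) else 0.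

(** For [x >= 1] each monomial of [Q] is at most [x ^+ (size Q).+1], a power which the exponential
    dominates up to a factorial. *)
Lemma horner_expR_bound Q : exists C : R, forall x,
  1 <= x -> `|Q.[x]| * expR (- x) <= C.
Proof.
pose S := \sum_(i < size Q) `|Q`_i|.
exists (S * (size Q).+1`!%:R) => x x1; have x0 : 0 <= x by lra.
rewrite expRN ler_pdivrMr ?expR_gt0//.
have S0 : 0 <= S by exact: sumr_ge0.
apply: (@le_trans _ _ (S * x ^+ (size Q).+1)).
  rewrite horner_coef mulr_suml (le_trans (ler_norm_sum _ _ _))// ler_sum//
    => i _.
  rewrite normrM ler_wpM2l// ger0_norm ?exprn_ge0// ler_weXn2l//.
  exact/ltnW/ltnW/ltn_ord.
rewrite -mulrA ler_wpM2l// mulrC -ler_pdivrMr ?ltr0n ?fact_gt0//.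
by have := expR_ge1Dxn (size Q) x0; lra.
Qed.

(** A bound quadratic in [t] makes the difference quotient at [0] tend to [0]. It is the preceding
    bound for [P * 'X^2] at [t^-1]. *)
Lemma flat_exp_bound P : exists2 C : R, 0 < C & forall t,
  `|t| <= 1 -> `|flat_exp P t| <= C * t ^+ 2.
Proof.
have [C HC] := horner_expR_bound (P * 'X^2).
have C0 : 0 <= C by apply: le_trans (HC 1 (lexx _));
  rewrite mulr_ge0// expR_ge0.
exists (C + 1); first by lra.
move=> t /(le_trans (ler_norm _)) t1; rewrite /flat_exp; case: ifPn => [t0|_];
  last first.
  by rewrite normr0 mulr_ge0 ?sqr_ge0//; lra.
have := HC t^-1; rewrite invf_ge1// => /(_ t1).
rewrite hornerM hornerXn normrM [`|t^-1 ^+ 2|]ger0_norm ?sqr_ge0//.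
rewrite normrM [`|expR _|]gtr0_norm ?expR_gt0//.
rewrite -mulrA mulrCA exprVn ler_pdivrMl ?exprn_gt0// => /le_trans; apply.
by rewrite mulrC ler_wpM2r ?sqr_ge0//; lra.
Qed.

(** For [t > 0] the derivative of [P(1/t) exp(-1/t)] is [(P - P')(1/t) exp(-1/t) / t^2], which has
    the same form; at [0] the quadratic bound applies. *)
Lemma is_derive_flat_exp P t :
  is_derive t (1 : R) (flat_exp P) (flat_exp ('X^2 * (P - P^`())) t).
Proof.
have [t0|t0|->] := ltgtP t 0.
- have : {near t, cst (0:R) =1 flat_exp P}.
    near=> s; rewrite /flat_exp ifF//; apply/negbTE; rewrite -leNgt ltW//.
    by near: s; exact: lt_nbhsl.
  move=> /near_eq_is_derive h; rewrite {2}/flat_exp ifF; last first.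
    by apply/negbTE; rewrite -leNgt ltW.
  by apply: h; exact: is_derive_cst.
- have : {near t, (fun s => P.[s^-1] * expR (- s^-1)) =1 flat_exp P}.
    by near=> s; rewrite /flat_exp ifT//; near: s; exact: lt_nbhsr.
  move=> /near_eq_is_derive; apply; rewrite /flat_exp t0.
  have dV : is_derive t (1 : R) (fun s : R => s^-1) (- t ^- 2 *: 1).
    by apply: is_deriveV; exact: lt0r_neq0.
  have dP := is_derive1_comp (is_derive_poly P t^-1) dV.
  have dN : is_derive t (1 : R) (fun s : R => - s^-1) _ := is_deriveN dV.
  have dE := @is_derive1_comp _ expR (fun s : R => - s^-1)
    t _ _ (is_derive_expR _) dN.
  apply: is_derive_eq (is_deriveM dP dE) _.
  have sE (a b : R) : a *: (b : R) = a * b by [].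
  rewrite !sE !(hornerM, hornerX, hornerD, hornerN) !mulr1 /=.
  by field; exact: lt0r_neq0.
- rewrite {2}/flat_exp ltxx.
  have [C C0 HC] := flat_exp_bound P.
  have cv : (fun h : R => h^-1 *: (flat_exp P (h *: (1:R) + 0)
    - flat_exp P 0)) h
      @[h --> 0^'] --> (0 : R).
    apply/cvgr0Pnorm_lt => e e0; near=> h.
    have h0 : h != 0 by near: h; exact: nbhs_dnbhs_neq.
    rewrite /flat_exp ltxx subr0 -/(flat_exp P _) addr0 /GRing.scale/= mulr1.
    rewrite normrM normfV ltr_pdivrMl ?normr_gt0//.
    have h1 : `|h| < Num.min 1 (e / C) by near: h; apply: dnbhs0_lt;
      rewrite lt_min ltr01 divr_gt0.
    move: h1; rewrite lt_min ltr_pdivlMr// => /andP[h1 h2].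
    apply: (le_lt_trans (HC h (ltW h1))).
    by rewrite -normr_gt0 in h0; rewrite -[h ^+ 2]real_normK ?num_real//
      expr2 mulrCA ltr_pM2l // mulrC.
  by apply: DeriveDef; [exact: cvgP cv|exact: cvg_lim cv].
Unshelve. all: by end_near. Qed.

End FlatFunction.

Section Bump.
Context {R : realType} {d : nat}.

Lemma smooth_on_flat_exp (O : set 'rV[R]_d) u : open O -> smooth_on O u ->
  smooth_on O (fun x => flat_exp 1 (u x)).
Proof.
move=> oO su; pose D (P : {poly R}) : {poly R} := 'X^2 * (P - P^`()).
apply: (@smooth_on_comp1 _ _ (fun n => flat_exp (iter n D 1))) => // n t.
exact: is_derive_flat_exp.
Qed.

Lemma flat_exp1_gt0 (t : R) : 0 < t -> 0 < flat_exp 1 t.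
Proof. by move=> t0; rewrite /flat_exp t0 hornerC mul1r expR_gt0. Qed.

Lemma flat_exp1_ge0 (t : R) : 0 <= flat_exp 1 t.
Proof. by rewrite /flat_exp; case: ifP => // _;
  rewrite hornerC mul1r expR_ge0. Qed.

Lemma flat_exp_eq0 (P : {poly R}) (t : R) : t <= 0 -> flat_exp P t = 0.
Proof. by rewrite /flat_exp leNgt; case: ifP. Qed.

(** A smooth cut-off: the numerator vanishes for [|t| >= 2], the second term of the denominator for
    [|t| <= 1], and the two never vanish together. *)
Definition plateau (t : R) : R :=
  flat_exp 1 (4 - t ^+ 2) * (flat_exp 1 (4 - t ^+ 2)
    + flat_exp 1 (t ^+ 2 - 1))^-1.

Lemma plateau_den_gt0 (t : R) : 0 < flat_exp 1 (4 - t ^+ 2)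
  + flat_exp 1 (t ^+ 2 - 1).
Proof.
have [t4|t4] := ltP (t ^+ 2) 4.
  by rewrite ltr_pwDl ?flat_exp1_ge0// flat_exp1_gt0; lra.
by rewrite ltr_wpDl ?flat_exp1_ge0// flat_exp1_gt0; lra.
Qed.

Lemma plateau1 (t : R) : `|t| <= 1 -> plateau t = 1.
Proof.
move=> t1; have t2 : t ^+ 2 <= 1.
  by rewrite -[t ^+ 2]real_normK ?num_real// expr_le1.
rewrite /plateau (@flat_exp_eq0 1 (t ^+ 2 - 1)) ?subr_le0// addr0 mulfV//.
by rewrite gt_eqF// flat_exp1_gt0; lra.
Qed.

Lemma plateau0 (t : R) : 2 <= `|t| -> plateau t = 0.
Proof.
move=> t2; rewrite /plateau flat_exp_eq0 ?mul0r//.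
by rewrite -[t ^+ 2]real_normK ?num_real//; nra.
Qed.

(** The norm of ['rV[R]_d] is the maximum norm, so a product of plateaus in the separate coordinates
    is adapted to its balls. *)
Lemma euclidean_bump (a : 'rV[R]_d) (r : R) : 0 < r ->
  exists u : 'rV[R]_d -> R, [/\ smooth_on setT u,
    forall x, `|x - a| <= r -> u x = 1 & forall x,
      u x != 0 -> `|x - a| <= 2 * r].
Proof.
move=> r0; pose u (x : 'rV[R]_d)
  := \prod_l plateau (r^-1 * (x 0 l + (- a 0 l))).
have coef (x : 'rV[R]_d) l : r^-1 * (x 0 l - a 0 l) = r^-1 * (x - a)
  0 l by rewrite !mxE.
exists u; split.
- apply: smooth_on_prod => [|l _]; first exact: openT.
  have oT : open [set: 'rV[R]_d] := openT.
  have sl : smooth_on setT (fun x : 'rV[R]_d => r^-1 * (x 0 l + - a 0 l)).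
    apply: smooth_onM => //; first exact: smooth_on_cst.
    by apply: smooth_onD => //; [exact: smooth_on_coord|exact: smooth_on_cst].
  have sl2 : smooth_on setT (fun x : 'rV[R]_d =>
    4 - (r^-1 * (x 0 l + - a 0 l)) ^+ 2).
    rewrite (_ : (fun _ => _) = (fun x : 'rV[R]_d => 4 + -1 *
      ((r^-1 * (x 0 l + - a 0 l)) * (r^-1 * (x 0 l + - a 0 l))))); last first.
      by apply/funext => x; rewrite mulN1r expr2.
    apply: smooth_onD => //; first exact: smooth_on_cst.
    by apply: smooth_onM => //; [exact: smooth_on_cst|exact: smooth_onM].
  have sl3 : smooth_on setT (fun x : 'rV[R]_d => (r^-1 * (x 0 l + - a 0 l))
    ^+ 2 - 1).
    rewrite (_ : (fun _ => _) = (fun x : 'rV[R]_d =>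
      ((r^-1 * (x 0 l + - a 0 l)) * (r^-1 * (x 0 l + - a 0 l))) + -1)) //.
    by apply: smooth_onD => //; [exact: smooth_onM|exact: smooth_on_cst].
  have s2 := smooth_on_flat_exp oT sl2; have s3 := smooth_on_flat_exp oT sl3.
  apply: smooth_onM => //; apply: smooth_onV => //; last exact: smooth_onD.
  by move=> x _; rewrite gt_eqF// plateau_den_gt0.
- move=> x xr; rewrite /u big1// => l _; apply: plateau1.
  rewrite coef normrM normfV (gtr0_norm r0) ler_pdivrMl// mulr1.
  apply: le_trans xr; rewrite [leRHS]mx_normrE.
  exact: (le_bigmax _ (fun i => `|(x - a) i.1 i.2|) (0, l)).
- move=> x ux; rewrite [leLHS]mx_normrE; apply: bigmax_le => [|[i l] _ /=].
    by rewrite mulr_ge0// ltW.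
  rewrite (ord1 i) leNgt; apply/negP => lx; move/negP: ux; apply.
  rewrite /u (bigD1 l)//= plateau0 ?mul0r//.
  by rewrite coef normrM normfV (gtr0_norm r0) ler_pdivlMl// mulrC ltW.
Qed.

End Bump.

(** * Calculus in charts *)

(* The part of [is_manifold] which is used for the calculus in charts; unlike
   the separation axioms, it is immediate for total spaces. *)
Record is_atlas (R : realType) (d : nat) (N : charted R d) : Prop := {
  atlas_at : forall p : N, cdom (chart_at p) p;
  atlasK : forall (c : chart_idx N) (p : N), cdom c p -> param c (coords c p)
    = p;
  atlas_open : forall c : chart_idx N, mopen N (cdom c);
  atlas_smooth : forall (c : chart_idx N) (l : 'I_d),
    smooth_fun_on (cdom c) (fun p : N => coords c p 0 l) }.

Arguments atlas_open {R d N} _ c.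
Arguments atlas_smooth {R d N} _ c l.
Arguments atlasK {R d N} _ {c p}.

Lemma manifold_atlas (R : realType) (d : nat) (N : charted R d) :
  is_manifold N -> is_atlas N.
Proof.
by case=> h1 h2 h3 h4 _ _; split=> // c; exact: h4.
Qed.

Section Atlas.
Context {R : realType} {d : nat} {N : charted R d}.
Hypothesis hN : is_atlas N.
Implicit Types (c : chart_idx N) (p q : N) (W D : set N) (f g : N -> R).

Lemma mopenT : mopen N setT.
Proof.
by move=> c; rewrite setIT; have := atlas_open hN c c; rewrite setIid.
Qed.

Lemma mopenI W D : mopen N W -> mopen N D -> mopen N (W `&` D).
Proof.
move=> oW oD c; rewrite (_ : _ @` _ = (coords c @` (cdom c `&` W)) `&`
    (coords c @` (cdom c `&` D))); first exact: openI.
apply/seteqP; split => x.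
  by case=> p [cp [Wp Dp] <-]; split; exists p.
case=> -[p [cp Wp] <-] [q [cq Dq] e]; exists p => //; split => //; split => //.
by have := congr1 (param c) e; rewrite !(atlasK hN)// => <-.
Qed.

Lemma near_chart W c p : mopen N W -> W p -> cdom c p ->
  \forall x \near coords c p, [/\ cdom c (param c x), W (param c x) &
    coords c (param c x) = x].
Proof.
move=> oW Wp cp; have : nbhs (coords c p) (coords c @` (cdom c `&` W)).
  by apply: open_nbhs_nbhs; split; [exact: oW|exists p].
by apply: filterS => _ [q [cq Wq] <-]; rewrite (atlasK hN).
Qed.

Lemma smooth_fun_on_sub W D f : W `<=` D -> smooth_fun_on D f -> smooth_fun_on
  W f.
Proof.
move=> WD sf c; apply: smooth_on_sub (sf c).
by move=> _ [p [cp /WD Dp] <-]; exists p.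
Qed.

Lemma smooth_fun_sub W f : smooth_fun f -> smooth_fun_on W f.
Proof. exact: smooth_fun_on_sub. Qed.

Lemma smooth_fun_on_local D f :
  (forall p, D p -> exists2 W, W p & smooth_fun_on W f) -> smooth_fun_on D f.
Proof.
move=> h c; apply: smooth_on_local => _ [p [cp Dp] <-].
have [W Wp sW] := h p Dp; exists (coords c @` (cdom c `&` W)) => //.
by exists p.
Qed.

Lemma smooth_fun_on_diff D f c p : smooth_fun_on D f -> D p -> cdom c p ->
  differentiable (f \o param c) (coords c p).
Proof. by move=> sf Dp cp; apply: smooth_on_diff (sf c) _; exists p. Qed.

(** In any other chart the function is precomposed with a smooth transition map, so testing in one
    chart suffices. *)
Lemma smooth_in_chart W c f : mopen N W -> W `<=` cdom c ->
  smooth_on (coords c @` W) (f \o param c) -> smooth_fun_on W f.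
Proof.
move=> oW Wc sf c'.
pose G x : 'rV[R]_d := coords c (param c' x).
apply: (@smooth_on_ext _ _ _ ((f \o param c) \o G)); first exact: oW.
  by move=> _ [p [cp Wp] <-]; rewrite /G /= !(atlasK hN)//; exact: Wc.
apply: (smooth_on_comp (O' := coords c @` W)) sf; first exact: oW.
  by move=> _ [p [cp Wp] <-]; rewrite /G !(atlasK hN)//; exists p.
move=> k; apply: smooth_on_sub (atlas_smooth hN c k c').
by move=> _ [p [cp Wp] <-]; exists p => //; split=> //; exact: Wc.
Qed.

Lemma smooth_fun_on_ext D f g : mopen N D -> (forall p, D p -> f p = g p) ->
  smooth_fun_on D f -> smooth_fun_on D g.
Proof.
move=> oD fg sf c; apply: smooth_on_ext (sf c); first exact: oD.
by move=> _ [p [cp Dp] <-] /=; rewrite (atlasK hN)// fg.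
Qed.

Lemma smooth_fun_on_cst D (a : R) : smooth_fun_on D (fun=> a).
Proof. by move=> c; exact: smooth_on_cst. Qed.

Lemma smooth_fun_onD D f g : mopen N D -> smooth_fun_on D f -> smooth_fun_on D
  g ->
  smooth_fun_on D (fun p => f p + g p).
Proof. by move=> oD sf sg c; apply: smooth_onD;
  [exact: oD|exact: sf|exact: sg]. Qed.

Lemma smooth_fun_onM D f g : mopen N D -> smooth_fun_on D f -> smooth_fun_on D
  g ->
  smooth_fun_on D (fun p => f p * g p).
Proof. by move=> oD sf sg c; apply: smooth_onM;
  [exact: oD|exact: sf|exact: sg]. Qed.

Lemma smooth_fun_onN D f : mopen N D -> smooth_fun_on D f ->
  smooth_fun_on D (fun p => - f p).
Proof.
move=> oD sf; apply: (@smooth_fun_on_ext _ (fun p => -1 * f p)) => //.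
  by move=> p _; rewrite mulN1r.
by apply: smooth_fun_onM => //; exact: smooth_fun_on_cst.
Qed.

Lemma smooth_fun_onB D f g : mopen N D -> smooth_fun_on D f -> smooth_fun_on D
  g ->
  smooth_fun_on D (fun p => f p - g p).
Proof. by move=> oD sf sg; apply: smooth_fun_onD => //; exact: smooth_fun_onN.
Qed.

Lemma smooth_fun_on_sum D (I : Type) (r : seq I) (P : pred I)
  (F : I -> N -> R) :
  mopen N D -> (forall i, P i -> smooth_fun_on D (F i)) ->
  smooth_fun_on D (fun p => \sum_(i <- r | P i) F i p).
Proof.
by move=> oD sF c; apply: smooth_on_sum => [|i Pi]; [exact: oD|exact: sF].
Qed.

Lemma cpartial_ext W c f g l p : mopen N W -> W p -> cdom c p ->
  (forall q, W q -> f q = g q) -> cpartial c f l p = cpartial c g l p.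
Proof.
move=> oW Wp cp fg; apply: near_eq_partial.
by apply: filterS (near_chart oW Wp cp) => x [_ Wx _] /=; exact: fg.
Qed.

Lemma cpartial_cst c (a : R) l p : cpartial c (fun=> a) l p = 0.
Proof. exact: partial_cst. Qed.

Lemma cpartialD W c f g l p : smooth_fun_on W f -> smooth_fun_on W g -> W p ->
  cdom c p ->
  cpartial c (fun q => f q + g q) l p = cpartial c f l p + cpartial c g l p.
Proof.
by move=> sf sg Wp cp; apply: partialD;
  [exact: smooth_fun_on_diff sf _ _|exact: smooth_fun_on_diff sg _ _].
Qed.

Lemma cpartialM W c f g l p : smooth_fun_on W f -> smooth_fun_on W g -> W p ->
  cdom c p ->
  cpartial c (fun q => f q * g q)
    l p = f p * cpartial c g l p + g p * cpartial c f l p.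
Proof.
move=> sf sg Wp cp; rewrite /cpartial -{2 4}(atlasK hN cp).
by apply: partialM; [exact: smooth_fun_on_diff sf _ _|exact: smooth_fun_on_diff
  sg _ _].
Qed.

Lemma cpartial_sum W c (I : Type) (r : seq I) (P : pred I) (F : I -> N -> R)
  l p :
  (forall i, P i -> smooth_fun_on W (F i)) -> W p -> cdom c p ->
  cpartial c (fun q => \sum_(i <- r | P i) F i q) l p =
  \sum_(i <- r | P i) cpartial c (F i) l p.
Proof.
move=> sF Wp cp; apply: (@partial_sum _ _ _ _ _ (fun i => F i \o param c)) =>
  i Pi.
exact: (smooth_fun_on_diff (sF i Pi)).
Qed.

Lemma cpartial_coord c k l p : cdom c p ->
  cpartial c (fun q => coords c q 0 k) l p = (l == k)%:R.
Proof.
move=> cp; rewrite -(partial_coord k l (coords c p)); apply: near_eq_partial.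
by apply: filterS (near_chart mopenT Logic.I cp) => x [_ _ /= ->].
Qed.

Lemma cpartial_change W c c' f k p : smooth_fun_on W f -> W p -> cdom c p ->
  cdom c' p ->
  cpartial c f k p = \sum_l Defs.jacobian c c' p k l * cpartial c' f l p.
Proof.
move=> sf Wp cp c'p.
pose G x : 'rV[R]_d := coords c' (param c x).
have Gp : G (coords c p) = coords c' p by rewrite /G (atlasK hN).
transitivity (partial ((f \o param c') \o G) k (coords c p)).
  rewrite /cpartial; apply: near_eq_partial.
  have := near_chart (atlas_open hN c') c'p cp.
  by apply: filterS => x [_ c'x _]; rewrite /G /= (atlasK hN).
rewrite partial_comp; first by apply: eq_bigr => l _; rewrite !mxE Gp.
- by rewrite Gp; exact: smooth_fun_on_diff sf _ _.
- by move=> l; apply: smooth_on_diff (atlas_smooth hN c' l c) _; exists p.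
Qed.

Lemma smooth_cpartial D c f l : mopen N D -> smooth_fun_on D f ->
  smooth_fun_on (cdom c `&` D) (cpartial c f l).
Proof.
move=> oD sf; apply: (@smooth_in_chart _ c).
- exact: mopenI (atlas_open hN c) oD.
- by move=> p [].
- apply: (@smooth_on_ext _ _ _ (partial (f \o param c) l)).
  + exact: oD.
  + by move=> _ [p [cp Dp] <-]; rewrite /= /cpartial (atlasK hN).
  + exact: smooth_on_partial (sf c).
Qed.

Lemma cpartial_schwarz D c f k l p : mopen N D -> smooth_fun_on D f -> D p ->
  cdom c p ->
  cpartial c (cpartial c f k) l p = cpartial c (cpartial c f l) k p.
Proof.
move=> oD sf Dp cp.
have E j i : cpartial c (cpartial c f j) i p = partial (partial (f \o param c)
  j) i (coords c p).
  apply: near_eq_partial; apply: filterS (near_chart oD Dp cp).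
  by move=> x [_ _ e]; rewrite /= /cpartial e.
rewrite !E; apply: smooth_on_schwarz (sf c); first exact: oD.
by exists p.
Qed.

End Atlas.

(** * The Jacobiator of a Jacobi bracket *)

(* The pointwise algebra behind the Jacobi identity: [L], [E] are the components
   of the tensors at a point and [dL r], [dE r] their derivatives along [x_r];
   a function enters through its value, its gradient and its Hessian. *)
Section JacobiatorAlgebra.
Context {R : realType} {d : nat}.
Variables (L : 'I_d -> 'I_d -> R) (dL : 'I_d -> 'I_d -> 'I_d -> R).
Variables (E : 'I_d -> R) (dE : 'I_d -> 'I_d -> R).
Implicit Types (f g h u v : 'I_d -> R) (A : 'I_d -> 'I_d -> R).
Hypothesis Lskew : forall k l, L k l = - L l k.

Definition dot u f := \sum_l u l * f l.
Definition bil f g := \sum_k \sum_l L k l * f k * g l.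
(** The vector [L(f, .)], with the covector in the first slot. *)
Definition sharp f : 'I_d -> R := fun l => \sum_k f k * L k l.
(** [dbil] and [ddot] differentiate [L] and [E] in the direction [u]; in [hess] the entry [A k r]
    stands for the derivative along [x_r] of component [k] of a gradient. *)
Definition dbil u f g := \sum_r u r * \sum_k \sum_l dL r k l * f k * g l.
Definition ddot u f := \sum_r u r * \sum_l dE r l * f l.
Definition hess A u v := \sum_r \sum_k u r * v k * A k r.

(** The differential of the Jacobi bracket of two functions with values [G], [H], gradients [g], [h]
    and Hessians [Ag], [Ah], by the product rule. *)
Definition bracket_grad (G H : R) g h Ag Ah : 'I_d -> R := fun r =>
  (\sum_k \sum_l dL r k l * g k * h l + \sum_k \sum_l L k l * Ag k r * h l
   + \sum_k \sum_l L k l * g k * Ah l r)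
  + (g r * dot E h + G * (\sum_l dE r l * h l + \sum_l E l * Ah l r))
  - (h r * dot E g + H * (\sum_l dE r l * g l + \sum_l E l * Ag l r)).

Lemma bil_skew f g : bil f g = - bil g f.
Proof.
rewrite /bil exchange_big -sumrN; apply: eq_bigr => k _; rewrite -sumrN.
by apply: eq_bigr => l _; rewrite Lskew; ring.
Qed.

Lemma dot_sharp f g : dot (sharp f) g = bil f g.
Proof.
rewrite /bil exchange_big; apply: eq_bigr => l _; rewrite /sharp mulr_suml.
by apply: eq_bigr => k _; ring.
Qed.

Lemma hess_sym A u v : (forall k l, A k l = A l k) -> hess A u v = hess A v u.
Proof.
move=> As; rewrite /hess exchange_big; apply: eq_bigr => k _.
by apply: eq_bigr => l _; rewrite (As k l); ring.
Qed.

Lemma dot_bracket_grad u G H g h Ag Ah :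
  dot u (bracket_grad G H g h Ag Ah) =
  dbil u g h - hess Ag u (sharp h) + hess Ah u (sharp g)
  + (dot u g * dot E h + G * (ddot u h + hess Ah u E))
  - (dot u h * dot E g + H * (ddot u g + hess Ag u E)).
Proof.
have e1 : hess Ag u (sharp h) = - \sum_r u r * \sum_k \sum_l L k l * Ag k r * h
  l.
  rewrite /hess -sumrN; apply: eq_bigr => r _; rewrite mulr_sumr -sumrN.
  apply: eq_bigr => k _; rewrite /sharp !mulr_sumr mulr_suml -sumrN.
  by apply: eq_bigr => l _; rewrite Lskew; ring.
have e2 : hess Ah u (sharp g) = \sum_r u r * \sum_k \sum_l L k l * g k * Ah l r.
  apply: eq_bigr => r _; rewrite [in RHS]exchange_big mulr_sumr.
  apply: eq_bigr => k _; rewrite /sharp !mulr_sumr mulr_suml.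
  by apply: eq_bigr => l _; ring.
have e3 A : hess A u E = \sum_r u r * \sum_l E l * A l r.
  apply: eq_bigr => r _; rewrite mulr_sumr.
  by apply: eq_bigr => k _; ring.
rewrite e1 e2 !e3 /dot /dbil /ddot opprK.
rewrite !mulr_suml -!big_split/= !mulr_sumr -!big_split/= -sumrB.
by apply: eq_bigr => r _; rewrite /bracket_grad /dot; ring.
Qed.

Definition bracket_at (F K : R) f k := bil f k + F * dot E k - K * dot E f.

(** Once the Hessians are symmetric, their contractions with [E] and with the vectors [sharp] cancel
    in pairs between the three cyclic summands; only first derivatives of [L] and [E] survive. *)
Lemma jacobiator_algebra F G H f g h Af Ag Ah :
  (forall k l, Af k l = Af l k) -> (forall k l, Ag k l = Ag l k) ->
  (forall k l, Ah k l = Ah l k) ->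
  bracket_at F (bracket_at G H g h) f (bracket_grad G H g h Ag Ah)
  + bracket_at G (bracket_at H F h f) g (bracket_grad H F h f Ah Af)
  + bracket_at H (bracket_at F G f g) h (bracket_grad F G f g Af Ag)
  = dbil (sharp f) g h + dbil (sharp g) h f + dbil (sharp h) f g
    + (dot E f * bil g h + dot E g * bil h f + dot E h * bil f g)
    + F * (dbil E g h + ddot (sharp h) g - ddot (sharp g) h)
    + G * (dbil E h f + ddot (sharp f) h - ddot (sharp h) f)
    + H * (dbil E f g + ddot (sharp g) f - ddot (sharp f) g).
Proof.
move=> sAf sAg sAh; rewrite /bracket_at -!dot_sharp !dot_bracket_grad
  !dot_sharp.
rewrite (bil_skew h g) (bil_skew f h) (bil_skew g f).
rewrite (hess_sym (sharp g) (sharp f) sAh) (hess_sym (sharp h) (sharp g) sAf).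
rewrite (hess_sym (sharp f) (sharp h) sAg).
rewrite (hess_sym E (sharp f) sAg) (hess_sym E (sharp h) sAg).
rewrite (hess_sym E (sharp g) sAh) (hess_sym E (sharp f) sAh).
rewrite (hess_sym E (sharp g) sAf) (hess_sym E (sharp h) sAf).
ring.
Qed.

(** The pointwise forms of one half of [schouten_LL], of [wedge_EL] and of [schouten_EL]. *)
Definition schouten2_at i j k :=
  \sum_l (L l i * dL l j k + L l j * dL l k i + L l k * dL l i j).
Definition wedge_at i j k := E i * L j k + E j * L k i + E k * L i j.
Definition lie_at i j := \sum_l (E l * dL l i j - L l j * dE l i - L i l * dE l
  j).

(** The sign arises because [schouten2_at] contracts [L] in its second index and [sharp] in its
    first. *)
Lemma sum_schouten f g h :
  \sum_i \sum_j \sum_k schouten2_at i j k * (f i * g j * h k) =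
  - (dbil (sharp f) g h + dbil (sharp g) h f + dbil (sharp h) f g).
Proof.
have e0 f' g' h' : - dbil (sharp f') g' h' =
    \sum_r \sum_i \sum_j \sum_k L r i * dL r j k * (f' i * g' j * h' k).
  rewrite -sumrN; apply: eq_bigr => r _; rewrite /sharp mulr_suml -sumrN.
  apply: eq_bigr => i _; rewrite mulr_sumr -sumrN; apply: eq_bigr => j _.
  by rewrite mulr_sumr -sumrN; apply: eq_bigr => k _; rewrite (Lskew i); ring.
(* The cyclic terms sum over rotated index triples; [rot] realigns them with [f], [g], [h]. *)
have rot (T : 'I_d -> 'I_d -> 'I_d -> R) :
    \sum_i \sum_j \sum_k T i j k = \sum_j \sum_k \sum_i T i j k.
  by rewrite exchange_big; apply: eq_bigr => j _; rewrite exchange_big.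
rewrite !opprD !e0.
transitivity (\sum_r \sum_i \sum_j \sum_k
    (L r i * dL r j k + L r j * dL r k i + L r k * dL r i j)
      * (f i * g j * h k)).
  rewrite [RHS]exchange_big; apply: eq_bigr => i _.
  rewrite [RHS]exchange_big; apply: eq_bigr => j _.
  by rewrite [RHS]exchange_big; apply: eq_bigr => k _; rewrite mulr_suml.
rewrite -!big_split; apply: eq_bigr => r _ /=.
rewrite -[X in _ = _ + X + _]rot -[X in _ = _ + X]rot -[X in _ = _ + X]rot.
rewrite -!big_split; apply: eq_bigr => i _ /=; rewrite -!big_split.
apply: eq_bigr => j _ /=; rewrite -!big_split; apply: eq_bigr => k _ /=; ring.
Qed.

Lemma sum_wedge f g h :
  \sum_i \sum_j \sum_k wedge_at i j k * (f i * g j * h k) =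
  dot E f * bil g h + dot E g * bil h f + dot E h * bil f g.
Proof.
have e0 f' g' h' : dot E f' * bil g' h' =
    \sum_i \sum_j \sum_k E i * L j k * (f' i * g' j * h' k).
  rewrite /dot mulr_suml; apply: eq_bigr => i _; rewrite mulr_sumr.
  by apply: eq_bigr => j _; rewrite mulr_sumr; apply: eq_bigr => k _; ring.
rewrite !e0 [X in _ + X + _](_ : _ = \sum_i \sum_j \sum_k
  E j * L k i * (g j * h k * f i)); last first.
  by rewrite [RHS]exchange_big; apply: eq_bigr => j _; rewrite exchange_big.
rewrite [X in _ + _ + X](_ : _ = \sum_i \sum_j \sum_k
  E k * L i j * (h k * f i * g j)); last first.
  rewrite exchange_big; apply: eq_bigr => i _; rewrite exchange_big.
  by apply: eq_bigr.
rewrite -!big_split; apply: eq_bigr => i _ /=; rewrite -!big_split.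
apply: eq_bigr => j _ /=; rewrite -!big_split; apply: eq_bigr => k _ /=.
by rewrite /wedge_at; ring.
Qed.

Lemma sum_lie g h :
  \sum_i \sum_j lie_at i j * (g i * h j) =
  dbil E g h + ddot (sharp h) g - ddot (sharp g) h.
Proof.
have e1 : dbil E g h = \sum_i \sum_j \sum_l E l * dL l i j * (g i * h j).
  under [RHS]eq_bigr => i _ do rewrite exchange_big.
  rewrite [RHS]exchange_big; apply: eq_bigr => l _; rewrite mulr_sumr.
  by apply: eq_bigr => i _; rewrite mulr_sumr; apply: eq_bigr => j _; ring.
have e2 : ddot (sharp h) g = - \sum_i \sum_j \sum_l L l j * dE l i * (g i * h
  j).
  under [in RHS]eq_bigr => i _ do rewrite exchange_big.
  rewrite [in RHS]exchange_big -sumrN; apply: eq_bigr => l _.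
  rewrite mulr_sumr -sumrN; apply: eq_bigr => i _;
    rewrite /sharp mulr_suml -sumrN.
  by apply: eq_bigr => j _; rewrite (Lskew j); ring.
have e3 : ddot (sharp g) h = \sum_i \sum_j \sum_l L i l * dE l j * (g i * h j).
  under [in RHS]eq_bigr => i _ do rewrite exchange_big.
  rewrite [in RHS]exchange_big; apply: eq_bigr => l _.
  rewrite /sharp mulr_suml; apply: eq_bigr => i _; rewrite mulr_sumr.
  by apply: eq_bigr => j _; ring.
rewrite e1 e2 e3 -!sumrB; apply: eq_bigr => i _; rewrite -!sumrB.
apply: eq_bigr => j _; rewrite -!sumrB /lie_at mulr_suml.
by apply: eq_bigr => l _; ring.
Qed.

End JacobiatorAlgebra.

(** * Tensors in a chart, and the Jacobiator in terms of Schouten-Nijenhuis brackets *)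

Section ChartTensors.
Context {R : realType} {d : nat} {N : charted R d}.
Hypothesis hN : is_atlas N.
Implicit Types (c : chart_idx N) (p : N) (W : set N) (F G H : N -> R).
Implicit Types (X E : vfield N) (L : bivfield N).

Definition grad c F p : 'I_d -> R := fun l => cpartial c F l p.

Definition vf_in c X F p : R := dot (X c p 0) (grad c F p).

Definition biv_in c L F G p : R := bil (L c p) (grad c F p) (grad c G p).

Lemma grad_ext W c F G p : mopen N W -> W p -> cdom c p ->
  (forall q, W q -> F q = G q) -> grad c F p = grad c G p.
Proof. by move=> oW Wp cp FG; apply/funext => l; apply: cpartial_ext FG. Qed.

Lemma grad_cst c (a : R) p : grad c (fun=> a) p = fun=> 0.
Proof. by apply/funext => l; exact: cpartial_cst. Qed.

Lemma gradD c F G p : smooth_fun F -> smooth_fun G -> cdom c p ->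
  grad c (fun q => F q + G q) p = fun l => grad c F p l + grad c G p l.
Proof. by move=> sF sG cp; apply/funext => l; apply: (cpartialD _ sF sG). Qed.

Lemma gradM c F G p : smooth_fun F -> smooth_fun G -> cdom c p ->
  grad c (fun q => F q * G q) p = fun l =>
    F p * grad c G p l + G p * grad c F p l.
Proof. by move=> sF sG cp; apply/funext => l; apply: (cpartialM hN _ sF sG).
Qed.

Lemma vf_in_cst c X (a : R) p : vf_in c X (fun=> a) p = 0.
Proof. by rewrite /vf_in grad_cst /dot big1// => l _; rewrite mulr0. Qed.

Lemma vf_inD c X F G p : smooth_fun F -> smooth_fun G -> cdom c p ->
  vf_in c X (fun q => F q + G q) p = vf_in c X F p + vf_in c X G p.
Proof.
move=> sF sG cp; rewrite /vf_in gradD// /dot -big_split;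
  apply: eq_bigr => l _ /=.
by ring.
Qed.

Lemma vf_inM c X F G p : smooth_fun F -> smooth_fun G -> cdom c p ->
  vf_in c X (fun q => F q * G q) p = F p * vf_in c X G p + G p * vf_in c X F p.
Proof.
move=> sF sG cp; rewrite /vf_in gradM// /dot !mulr_sumr -big_split.
by apply: eq_bigr => l _ /=; ring.
Qed.

Lemma biv_in_skew c L F G p : (L c p)^T = - L c p -> biv_in c L F G p = -
  biv_in c L G F p.
Proof.
by move=> Ls; apply: bil_skew => k l; have /matrixP/(_ l k) := Ls; rewrite !mxE.
Qed.

Lemma biv_in_cstr c L (a : R) F p : biv_in c L F (fun=> a) p = 0.
Proof.
rewrite /biv_in grad_cst /bil big1// => k _; rewrite big1// => l _.
by rewrite mulr0.
Qed.

Lemma biv_inMr c L F G H p : smooth_fun G -> smooth_fun H -> cdom c p ->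
  biv_in c L F (fun q => G q * H q)
    p = G p * biv_in c L F H p + H p * biv_in c L F G p.
Proof.
move=> sG sH cp; rewrite /biv_in gradM// /bil !mulr_sumr -big_split.
apply: eq_bigr => k _ /=; rewrite !mulr_sumr -big_split.
by apply: eq_bigr => l _ /=; ring.
Qed.

Lemma dot_change (J : 'M[R]_d) (u u' : 'rV[R]_d) (f f' : 'I_d -> R) :
  u' = u *m J -> (forall k, f k = \sum_l J k l * f' l) -> dot (u' 0)
    f' = dot (u 0) f.
Proof.
move=> -> fE; rewrite /dot.
under eq_bigr => l _ do rewrite mxE mulr_suml.
rewrite exchange_big; apply: eq_bigr => k _ /=; rewrite fE mulr_sumr.
by apply: eq_bigr => l _; rewrite mulrA.
Qed.

Lemma bil_change (J L L' : 'M[R]_d) (f f' g g' : 'I_d -> R) :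
  L' = J^T *m L *m J -> (forall k, f k = \sum_l J k l * f' l) ->
  (forall k, g k = \sum_l J k l * g' l) -> bil L' f' g' = bil L f g.
Proof.
move=> -> fE gE.
have E (A : 'M[R]_d) (u v : 'I_d -> R) : bil A u v =
    ((\row_k u k) *m A *m (\col_k v k)) 0 0.
  rewrite /bil exchange_big mxE; apply: eq_bigr => l _; rewrite !mxE mulr_suml.
  by apply: eq_bigr => k _; rewrite !mxE; ring.
have colE (u u' : 'I_d -> R) : (forall k, u k = \sum_l J k l * u' l) ->
    \col_k u k = J *m \col_k u' k.
  by move=> uE; apply/colP => k; rewrite !mxE uE; apply: eq_bigr => l _;
    rewrite mxE.
have rowE (u u' : 'I_d -> R) : (forall k, u k = \sum_l J k l * u' l) ->
    \row_k u k = (\row_k u' k) *m J^T.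
  move=> uE; apply/rowP => k; rewrite !mxE uE; apply: eq_bigr => l _.
  by rewrite !mxE mulrC.
by rewrite !E (colE _ _ gE) (rowE _ _ fE) !mulmxA.
Qed.

Lemma vf_in_change X F c c' p : is_tangent p (X^~ p) -> smooth_fun F ->
  cdom c p -> cdom c' p -> vf_in c' X F p = vf_in c X F p.
Proof.
move=> [_ tX] sF cp c'p; apply: dot_change (tX c c' cp c'p) _ => k.
exact: cpartial_change sF _ cp c'p.
Qed.

Lemma vf_applyE X F c p : is_tangent p (X^~ p) -> smooth_fun F -> cdom c p ->
  vf_apply X F p = vf_in c X F p.
Proof.
by move=> tX sF cp; rewrite (vf_in_change tX sF (atlas_at hN p) cp).
Qed.

Lemma biv_applyE L F G c p : is_bivfield L -> smooth_fun F -> smooth_fun G ->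
  cdom c p -> biv_apply L F G p = biv_in c L F G p.
Proof.
move=> bL sF sG cp; apply: bil_change (bivfield_change bL cp (atlas_at hN p))
  _ _ => k.
  exact: cpartial_change sF _ cp (atlas_at hN p).
exact: cpartial_change sG _ cp (atlas_at hN p).
Qed.

Lemma smooth_grad c F l : smooth_fun F -> smooth_fun_on (cdom c) (fun p =>
  grad c F p l).
Proof.
by move=> sF; have := @smooth_cpartial _ _ _ hN setT c F l (mopenT hN) sF;
  rewrite setIT.
Qed.

Lemma smooth_vf_apply X F : is_vfield X -> smooth_fun F -> smooth_fun (vf_apply
  X F).
Proof.
move=> vX sF; apply: smooth_fun_on_local => p _.
pose c := chart_at p; exists (cdom c); first exact: (atlas_at hN).
apply: (smooth_fun_on_ext hN (f := vf_in c X F)); first exact: (atlas_open hN).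
  by move=> q cq; rewrite (@vf_applyE X F c)//; exact: vfield_tangent vX q.
apply: smooth_fun_on_sum => [|l _]; first exact: (atlas_open hN).
apply: smooth_fun_onM; first exact: (atlas_open hN).
  exact: vfield_smooth.
exact: smooth_grad.
Qed.

Lemma smooth_biv_apply L F G : is_bivfield L -> smooth_fun F -> smooth_fun G ->
  smooth_fun (biv_apply L F G).
Proof.
move=> bL sF sG; apply: smooth_fun_on_local => p _.
pose c := chart_at p; exists (cdom c); first exact: (atlas_at hN).
have oc : mopen N (cdom c) by exact: (atlas_open hN).
apply: (smooth_fun_on_ext hN (f := biv_in c L F G)) => //.
  by move=> q cq; rewrite (@biv_applyE L F G c).
apply: smooth_fun_on_sum => [//|k _]; apply: smooth_fun_on_sum => [//|l _].
apply: smooth_fun_onM => //; last exact: smooth_grad.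
apply: smooth_fun_onM => //; last exact: smooth_grad.
exact: bivfield_smooth.
Qed.

Definition jacobiator L E F G H p : R :=
  jacobi_bracket L E F (jacobi_bracket L E G H) p
  + jacobi_bracket L E G (jacobi_bracket L E H F) p
  + jacobi_bracket L E H (jacobi_bracket L E F G) p.

Section Jacobiator.
Variables (L : bivfield N) (E : vfield N).
Hypotheses (bL : is_bivfield L) (vE : is_vfield E).

Lemma smooth_jacobi_bracket F G : smooth_fun F -> smooth_fun G ->
  smooth_fun (jacobi_bracket L E F G).
Proof.
move=> sF sG; have oT := mopenT hN.
have sL := smooth_biv_apply bL sF sG.
have sEF := smooth_vf_apply vE sF; have sEG := smooth_vf_apply vE sG.
by apply: smooth_fun_onB => //; [apply: smooth_fun_onD => //|];
  apply: smooth_fun_onM.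
Qed.

Lemma jacobi_bracketE F G c p : smooth_fun F -> smooth_fun G -> cdom c p ->
  jacobi_bracket L E F G p =
  bracket_at (L c p) (E c p 0) (F p) (G p) (grad c F p) (grad c G p).
Proof.
move=> sF sG cp; have tE := vfield_tangent vE p.
rewrite /jacobi_bracket (biv_applyE bL sF sG cp).
by rewrite (vf_applyE tE sF cp) (vf_applyE tE sG cp).
Qed.

Let dL c p r k l := cpartial c (fun q => L c q k l) r p.
Let dE c p r l := cpartial c (fun q => E c q 0 l) r p.
Let hessian c F p k r := cpartial c (fun q => grad c F q k) r p.

Lemma grad_jacobi_bracket F G c p : smooth_fun F -> smooth_fun G -> cdom c p ->
  grad c (jacobi_bracket L E F G) p =
  bracket_grad (L c p) (dL c p) (E c p 0) (dE c p) (F p) (G p)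
    (grad c F p) (grad c G p) (hessian c F p) (hessian c G p).
Proof.
move=> sF sG cp; have oc := atlas_open hN c.
(* [jacobi_bracket] may use a different chart at each point; before differentiating, it is replaced
   by its expression in the fixed chart [c]. *)
rewrite (@grad_ext (cdom c) c _ (fun p => biv_in c L F G p + F p * vf_in c E G p
  + (-1) * (G p * vf_in c E F p)))//; last first.
  move=> q cq; rewrite (@jacobi_bracketE F G c)// /bracket_at mulN1r//.
have sgF k := smooth_grad (c := c) k sF;
  have sgG k := smooth_grad (c := c) k sG.
have sL k l : smooth_fun_on (cdom c) (fun q => L c q k l)
  by exact: bivfield_smooth.
have sE l : smooth_fun_on (cdom c) (fun q => E c q 0 l) by exact: vfield_smooth.
have sFc := smooth_fun_sub (W := cdom c) sF;
  have sGc := smooth_fun_sub (W := cdom c) sG.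
have sLF k l := smooth_fun_onM oc (sL k l) (sgF k).
have sLFG k l := smooth_fun_onM oc (sLF k l) (sgG l).
have sLFGk k := smooth_fun_on_sum (index_enum 'I_d) (P := xpredT)
  oc (fun l _ => sLFG k l).
have sb := smooth_fun_on_sum (index_enum 'I_d) (P := xpredT) oc (fun k _ =>
  sLFGk k).
have sEG l := smooth_fun_onM oc (sE l) (sgG l).
have sEF l := smooth_fun_onM oc (sE l) (sgF l).
have sEGs := smooth_fun_on_sum (index_enum 'I_d) (P := xpredT) oc (fun l _ =>
  sEG l).
have sEFs := smooth_fun_on_sum (index_enum 'I_d) (P := xpredT) oc (fun l _ =>
  sEF l).
have sFEG := smooth_fun_onM oc sFc sEGs;
  have sGEF := smooth_fun_onM oc sGc sEFs.
have s1 : smooth_fun_on (cdom c) (fun _ : N => (-1 : R))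
  by exact: smooth_fun_on_cst.
apply/funext => r; rewrite /grad.
rewrite (cpartialD _ (smooth_fun_onD oc sb sFEG) (smooth_fun_onM oc s1 sGEF))//.
rewrite (cpartialD _ sb sFEG)// (cpartialM hN _ s1 sGEF)// cpartial_cst.
rewrite (cpartialM hN _ sFc sEGs)// (cpartialM hN _ sGc sEFs)//.
rewrite (cpartial_sum _ _ (fun l _ => sEG l))// (cpartial_sum _ _ (fun l _ =>
  sEF l))//.
rewrite (cpartial_sum _ _ (fun k _ => sLFGk k))//.
under eq_bigr => k _ do rewrite (cpartial_sum _ _ (fun l _ => sLFG k l))//.
under eq_bigr => k _ do under eq_bigr => l _ do
  rewrite (cpartialM hN _ (sLF k l) (sgG l))// (cpartialM hN _ (sL k l)
    (sgF k))//.
under [X in _ + (_ * X + _) + _]eq_bigr =>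
  l _ do rewrite (cpartialM hN _ (sE l) (sgG l))//.
under [X in _ + (-1 * (_ * X + _) + _)]eq_bigr =>
  l _ do rewrite (cpartialM hN _ (sE l) (sgF l))//.
have split2 (u v v' w : 'I_d -> R) : \sum_l (u l * v l + v' l * w l) =
    \sum_l w l * v' l + \sum_l u l * v l.
  by rewrite -big_split; apply: eq_bigr => l _ /=; rewrite addrC (mulrC (w l)).
rewrite /bracket_grad -/(grad c F p) -/(grad c G p) !split2 -/(dot _ _).
rewrite -/(dot (E c p 0) (grad c F p)) -/(dot (E c p 0) (grad c G p)).
congr (_ + _ + _); last 2 first.
- by rewrite /grad/=; ring.
- by rewrite /grad/=; ring.
rewrite -!big_split; apply: eq_bigr => k _ /=; rewrite -!big_split.
apply: eq_bigr => l _ /=; rewrite /dL /hessian -/(grad c F p k)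
  -/(grad c G p l).
by move: (cpartial _ _ _ _) (cpartial _ _ _ _) (cpartial _ _ _ _)
  (grad _ _ _ _) (grad _ _ _ _) (L _ _ _ _) => *; ring.
Qed.

Lemma hessian_sym F c p k r : smooth_fun F -> cdom c p ->
  hessian c F p k r = hessian c F p r k.
Proof. by move=> sF cp; apply: (cpartial_schwarz hN _ _ (mopenT hN) sF). Qed.

Lemma bivfield_entry_skew c p k l : cdom c p -> L c p k l = - L c p l k.
Proof. by move=> /(bivfield_skew bL)/matrixP/(_ l k); rewrite !mxE. Qed.

(** The Jacobiator is doubled because [schouten_LL] carries a factor [2]. *)
Lemma jacobiatorE F G H c p : smooth_fun F -> smooth_fun G -> smooth_fun H ->
  cdom c p ->
  let f := grad c F p in let g := grad c G p in let h := grad c H p in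
  2 * jacobiator L E F G H p =
    - \sum_i \sum_j \sum_k (schouten_LL L c p i j k - 2 * wedge_EL E L c p i j
      k)
                           * (f i * g j * h k)
    + 2 * (F p * \sum_i \sum_j schouten_EL E L c p i j * (g i * h j)
         + G p * \sum_i \sum_j schouten_EL E L c p i j * (h i * f j)
         + H p * \sum_i \sum_j schouten_EL E L c p i j * (f i * g j)).
Proof.
move=> sF sG sH cp f g h.
have Ls k l : L c p k l = - L c p l k by exact: bivfield_entry_skew.
rewrite /jacobiator.
rewrite (jacobi_bracketE sF (smooth_jacobi_bracket sG sH) cp).
rewrite (jacobi_bracketE sG (smooth_jacobi_bracket sH sF) cp).
rewrite (jacobi_bracketE sH (smooth_jacobi_bracket sF sG) cp).
rewrite (jacobi_bracketE sG sH cp) (jacobi_bracketE sH sF cp)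
  (jacobi_bracketE sF sG cp).
rewrite (grad_jacobi_bracket sG sH cp) (grad_jacobi_bracket sH sF cp).
rewrite (grad_jacobi_bracket sF sG cp).
rewrite (jacobiator_algebra _ _ _ Ls); try by move=> *; exact: hessian_sym.
rewrite -!(sum_lie _ _ _ Ls) -(sum_wedge (L c p)).
rewrite -[X in X + _ + _ + _ + _]opprK -(sum_schouten _ Ls).
have -> : \sum_i \sum_j \sum_k (schouten_LL L c p i j k - 2 * wedge_EL E L c p
  i j k)
      * (f i * g j * h k) =
    2 * \sum_i \sum_j \sum_k schouten2_at (L c p) (dL c p)
      i j k * (f i * g j * h k)
    - 2 * \sum_i \sum_j \sum_k wedge_at (L c p) (E c p 0)
      i j k * (f i * g j * h k).
  rewrite -mulrBr -sumrB mulr_sumr; apply: eq_bigr => i _;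
    rewrite -sumrB mulr_sumr.
  apply: eq_bigr => j _; rewrite -sumrB mulr_sumr; apply: eq_bigr => k _.
  rewrite /schouten_LL /wedge_EL -/(schouten2_at (L c p) (dL c p) i j k).
  by rewrite -/(wedge_at (L c p) (E c p 0) i j k); ring.
rewrite /f /g /h; ring.
Qed.

Lemma jacobi_jacobiator F G H p : is_jacobi L E ->
  smooth_fun F -> smooth_fun G -> smooth_fun H -> jacobiator L E F G H p = 0.
Proof.
move=> [_ _ LL EL] sF sG sH; have cp := atlas_at hN p.
have S0 u v : \sum_i \sum_j schouten_EL E L (chart_at p) p i j * (u i * v j)
  = 0.
  by rewrite big1// => i _; rewrite big1// => j _; rewrite EL// mul0r.
have := jacobiatorE sF sG sH cp; rewrite /= !S0 !mulr0 !addr0 mulr0 addr0.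
rewrite big1 ?oppr0 => [|i _]; last first.
  by rewrite big1// => j _; rewrite big1// => k _; rewrite LL// subrr mul0r.
by move/eqP; rewrite mulf_eq0 pnatr_eq0/= => /eqP.
Qed.

(** With the constant [1] as first argument only one [[E, L]] term survives, and [T i], [T j]
    isolate one of its components. Once [[E, L]] vanishes at [p], three functions [T] isolate one
    component of the remaining trivector. *)
Lemma jacobiator_jacobi c p (T : 'I_d -> N -> R) : cdom c p ->
  (forall k, smooth_fun (T k)) -> (forall k l, grad c (T k) p l = (l == k)%:R)
    ->
  (forall i j k, jacobiator L E (T i) (T j) (T k) p = 0) ->
  (forall i j, jacobiator L E (fun=> 1) (T i) (T j) p = 0) ->
  (forall i j k, schouten_LL L c p i j k = 2 * wedge_EL E L c p i j k) /\
  (forall i j, schouten_EL E L c p i j = 0).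
Proof.
move=> cp sT gT J3 J2.
have s1 : smooth_fun (fun _ : N => (1 : R)) by exact: smooth_fun_on_cst.
have sum1 (a : 'I_d -> R) i : \sum_l a l * (l == i)%:R = a i.
  rewrite (bigD1 i)//= eqxx mulr1 big1 ?addr0// => l /negbTE ->.
  by rewrite mulr0.
have sum2 (a : 'I_d -> 'I_d -> R) i j :
    \sum_k \sum_l a k l * ((k == i)%:R * (l == j)%:R) = a i j.
  under eq_bigr => k _ do under eq_bigr => l _ do rewrite mulrA.
  under eq_bigr => k _ do rewrite (sum1 (fun l => a k l * (k == i)%:R)).
  by rewrite (sum1 (a^~ j)).
have EL i j : schouten_EL E L c p i j = 0.
  have := jacobiatorE s1 (sT i) (sT j) cp; rewrite /= J2 mulr0 grad_cst.
  rewrite big1 => [|a _]; last first.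
    by rewrite big1// => b _; rewrite big1// => k _; rewrite mul0r mul0r mulr0.
  rewrite [X in _ + _ * X + _](_ : _ = 0); last first.
    by rewrite big1// => a _; rewrite big1// => b _; rewrite mulr0 mulr0.
  rewrite [X in _ + _ * X](_ : _ = 0); last first.
    by rewrite big1// => a _; rewrite big1// => b _; rewrite mul0r mulr0.
  under eq_bigr => a _ do under eq_bigr => b _ do rewrite !gT.
  rewrite sum2 !mulr0 !addr0 mul1r oppr0 add0r => /esym/eqP.
  by rewrite mulf_eq0 pnatr_eq0/= => /eqP.
split=> // i j k; have := jacobiatorE (sT i) (sT j) (sT k) cp.
rewrite /= J3 mulr0.
have S0 u v : \sum_a \sum_b schouten_EL E L c p a b * (u a * v b) = 0.
  by rewrite big1// => a _; rewrite big1// => b _; rewrite EL// mul0r.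
rewrite !S0 !mulr0 !addr0 mulr0 addr0 => /esym/eqP; rewrite oppr_eq0.
under eq_bigr => a _ do under eq_bigr => b _ do under eq_bigr => e _ do
  rewrite !gT mulrA.
under eq_bigr => a _ do under eq_bigr => b _ do rewrite sum1.
by rewrite sum2 subr_eq0 => /eqP.
Qed.

End Jacobiator.
End ChartTensors.

(** * Bump functions on manifolds *)

Lemma two_thirds_lt (R : realType) (r : R) : 0 < r -> 2 * (r / 3) < r.
Proof. lra. Qed.

Section ManifoldBump.
Context {R : realType} {d : nat} {M : charted R d}.
Hypothesis hM : is_manifold M.
Let hMa : is_atlas M := manifold_atlas hM.
Implicit Types (p q : M) (W V : set M).

Lemma mopen_chart_preimage (c : chart_idx M) (U : set 'rV[R]_d) : open U ->
  mopen M [set q | cdom c q /\ U (coords c q)].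
Proof.
move=> oU c'; rewrite openE => _ [q [c'q [cq Uq]] <-]; rewrite /interior.
pose G x : 'rV[R]_d := coords c (param c' x).
have dG : differentiable G (coords c' q).
  apply: differentiable_row => l.
  by apply: smooth_on_diff (atlas_smooth hMa c l c') _; exists q.
have Gq : G (coords c' q) = coords c q by rewrite /G (atlasK hMa).
have nU : nbhs (G (coords c' q)) U by rewrite Gq; exact: open_nbhs_nbhs.
have nGU : \forall x \near coords c' q, U (G x).
  exact: differentiable_continuous dG _ nU.
have nc := near_chart hMa (atlas_open hMa c) cq c'q.
move: nGU nc; apply: filterS2 => x UGx [c'x cx e].
by exists (param c' x).
Qed.

(** Here the Hausdorff axiom enters: a closed ball of a chart is compact, hence closed in the
    manifold, so that a bump function extended by zero stays smooth. *)
Lemma chart_ball_separated (c : chart_idx M) (x0 : 'rV[R]_d) (r : R) q :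
  (forall x, `|x - x0| <= r -> (coords c @` cdom c) x) ->
  (forall p, cdom c p -> `|coords c p - x0| <= r -> p <> q) ->
  exists V, [/\ mopen M V, V q &
    forall p, V p -> cdom c p -> ~ (`|coords c p - x0| <= r)].
Proof.
move=> Bc qB; pose B := [set x | `|x - x0| <= r].
have cB : compact B.
  apply: bounded_closed_compact.
    exists (`|x0| + r); split; first exact: num_real.
    move=> m lm x Bx; apply: le_trans (ltW lm).
    by rewrite -[x](subrKC x0) (le_trans (ler_normD _ _))// lerD2l.
  rewrite (_ : B = closed_ball_ Num.norm x0 r);
    first exact: closed_closed_ball_.
  by apply/seteqP; split => x; rewrite /B /closed_ball_ /= distrC.
(* Compactness of the ball, applied to the filter of neighbourhoods of [q]. *)
pose F : set_system M := fun D => exists V, [/\ mopen M V, V q & V `<=` D].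
have FF : Filter F.
  split.
  - by exists setT; split=> //; exact: mopenT.
  - move=> D D' [V [oV Vq VD]] [V' [oV' V'q VD']]; exists (V `&` V');
    split => //.
      exact: mopenI.
    by move=> p [/VD ? /VD' ?].
  - by move=> D D' DD' [V [oV Vq VD]]; exists V; split => // p /VD/DD'.
have /compact_near_coveringP/(_ M F (fun p x => param c x <> p) FF) := cB.
case.
  move=> x Bx; have [p cp px] := Bc x Bx.
  have [W [W' [oW oW' Wp W'q WW']]] := manifold_hausdorff hM (qB p cp (eq_ind_r
    (fun x => `|x - x0| <= r) Bx px)).
  exists ([set x' | W (param c x')], W'); rewrite /=.
    split; last by exists W'; split.
    by rewrite -px; apply: filterS (near_chart hMa oW Wp cp) => x' [].
  move=> [x' p'] /= [Wx' W'p'] e; have : (W `&` W') (param c x').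
    by split=> //; rewrite e.
  by rewrite WW'.
move=> V [oV Vq VB]; exists V; split => // p Vp cp Bp.
by apply: (VB p Vp _ Bp); rewrite (atlasK hMa).
Qed.

(** The last clause asks that [u] vanish near, not only at, each point outside [W]: this makes the
    product of [u] with a function or section smooth only on [W] extend smoothly by zero. *)
Lemma manifold_bump p W : mopen M W -> W p -> exists (u : M -> R) V,
  [/\ smooth_fun u, mopen M V /\ V p, V `<=` W, forall q, V q -> u q = 1 &
      forall q, ~ W q -> exists V', [/\ mopen M V', V' q & forall q',
        V' q' -> u q' = 0]].
Proof.
move=> oW Wp; pose c := chart_at p; have cp : cdom c p := atlas_at hMa p.
have oc := atlas_open hMa c; have ocW := mopenI hMa oc oW.
pose x0 := coords c p.
have : nbhs x0 (coords c @` (cdom c `&` W)).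
  by apply: open_nbhs_nbhs; split; [exact: oW|exists p].
move=> /nbhs_normP[rho /= rho0 ballW].
(* The Euclidean bump can be nonzero up to radius [2 * r], which has to stay below [rho]. *)
pose r := rho / 3; have r0 : 0 < r by rewrite divr_gt0.
have Brho x : `|x - x0| <= 2 * r -> (coords c @` (cdom c `&` W)) x.
  move=> xr; apply: ballW => /=; rewrite distrC (le_lt_trans xr)//.
  exact: two_thirds_lt.
have [u0 [su0 u01 u00]] := euclidean_bump x0 r0.
pose u q := if `[< cdom c q /\ W q >] then u0 (coords c q) else 0.
have BW q : cdom c q -> `|coords c q - x0| <= 2 * r -> W q.
  move=> cq /Brho[q' [cq' Wq'] e]; rewrite -(atlasK hMa cq) -e.
  by rewrite (atlasK hMa).
have uE q : cdom c q -> u q = u0 (coords c q).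
  move=> cq; rewrite /u; case: asboolP => // nW; apply/esym/eqP;
    apply/negPn/negP.
  by move=> /u00/(BW q cq) Wq; apply: nW.
have outside q : ~ (cdom c q /\ W q) -> exists V', [/\ mopen M V', V' q &
    forall q', V' q' -> u q' = 0].
  move=> nq; have [||V [oV Vq VB]] := @chart_ball_separated c x0 (2 * r) q.
  - by move=> x /Brho[q' [cq' _] <-]; exists q'.
  - by move=> q' cq' Bq' e; apply: nq; rewrite -e; split => //; exact: BW.
  exists V; split => // q' Vq'; rewrite /u; case: asboolP => // -[cq' _].
  by apply/eqP; apply/negPn/negP => /u00; exact: VB.
pose V := [set q | cdom c q /\ ball x0 r (coords c q)].
exists u, V; split.
- apply: smooth_fun_on_local => q _.
  have [[cq Wq]|nq] := pselect (cdom c q /\ W q).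
    exists (cdom c) => //; apply: (smooth_fun_on_ext hMa (f := u0 \o coords c))
      => //.
      by move=> q' cq'; rewrite uE.
    apply: (smooth_in_chart hMa oc (c := c)) => //.
    have oc' : open (coords c @` cdom c) by have := oc c; rewrite setIid.
    apply: (@smooth_on_ext _ _ _ u0) => //; last exact: smooth_on_sub su0.
    by move=> _ [q' cq' <-] /=; rewrite (atlasK hMa).
  have [V' [oV' V'q u0']] := outside q nq; exists V' => //.
  apply: (smooth_fun_on_ext hMa (f := fun=> 0)) => //;
    last exact: smooth_fun_on_cst.
  by move=> q' V'q'; rewrite u0'.
- split; first exact: (@mopen_chart_preimage c (ball x0 r) (ball_open x0 r)).
  by split => //; exact: ballxx.
- move=> q [cq]; rewrite -ball_normE /= distrC => /ltW qr; apply: (BW _ cq).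
  by apply: (le_trans qr); rewrite ler_peMl ?ler1n// ltW.
- move=> q [cq]; rewrite -ball_normE /= distrC => /ltW qr.
  by rewrite (uE q cq) u01.
- by move=> q nWq; apply: outside => -[].
Qed.

Lemma smooth_fun_germ p W f : mopen M W -> W p -> smooth_fun_on W f ->
  exists (g : M -> R) V, [/\ smooth_fun g, mopen M V, V p, V `<=` W &
    forall q, V q -> g q = f q].
Proof.
move=> oW Wp sf; have [u [V [su [oV Vp] VW u1 u0]]] := manifold_bump oW Wp.
exists (fun q => u q * (if `[< W q >] then f q else 0)), V; split => //;
  last first.
  by move=> q Vq; rewrite u1// mul1r; case: asboolP => // /(_ (VW _ Vq)).
apply: smooth_fun_on_local => q _;
  have [Wq|/u0[V' [oV' V'q u0']]] := pselect (W q).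
  exists W => //; apply: smooth_fun_onM => //; first exact: smooth_fun_sub.
  by apply: (smooth_fun_on_ext hMa (f := f)) => // q' Wq'; case: asboolP.
exists V' => //; apply: (smooth_fun_on_ext hMa (f := fun=> 0)) => //.
  by move=> q' V'q'; rewrite u0'// mul0r.
exact: smooth_fun_on_cst.
Qed.

Lemma smooth_coord_germ (c : chart_idx M) l p : cdom c p ->
  exists (g : M -> R) V, [/\ smooth_fun g, mopen M V, V p, V `<=` cdom c &
    forall q, V q -> g q = coords c q 0 l].
Proof.
by move=> cp; exact: (smooth_fun_germ (atlas_open hMa c)
  cp (atlas_smooth hMa c l)).
Qed.

End ManifoldBump.

(** * Vector bundles and their total spaces *)

Local Arguments tdom_open {R m n M A} _ i.
Local Arguments bundle_transition_smooth {R m n M A} _ i i' j k.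

Section Bundle.
Context {R : realType} {m n : nat} {M : charted R m} {B : vbundle M n}.
Hypotheses (hM : is_manifold M) (hB : is_vbundle B).
Let hMa : is_atlas M := manifold_atlas hM.
Implicit Types (i : triv_idx B) (p q : M) (W V : set M) (f g : M -> R)
  (s t : section B).

Lemma trivD i p (u v : B p) : tdom i p -> triv i (u + v) = triv i u + triv i v.
Proof. by move=> ip; have := triv_linear hB ip 1 u v; rewrite !scale1r. Qed.

Lemma triv0 i p : tdom i p -> triv i (0 : B p) = 0.
Proof.
by move=> ip; have := trivD (0 : B p) 0 ip; rewrite addr0 => /eqP;
  rewrite -subr_eq subrr eq_sym => /eqP.
Qed.

Lemma trivZ i p (a : R) (u : B p) : tdom i p -> triv i (a *: u) = a *: triv i u.
Proof.
by move=> ip; have := triv_linear hB ip a u 0; rewrite addr0 triv0// addr0.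
Qed.

Lemma triv_sum i p (I : Type) (r : seq I) (P : pred I) (F : I -> B p)
  : tdom i p ->
  triv i (\sum_(j <- r | P j) F j) = \sum_(j <- r | P j) triv i (F j).
Proof.
move=> ip; elim/big_rec2: _ => [|j y x _ <-]; first exact: triv0.
exact: trivD.
Qed.

Lemma triv_inj i p (u v : B p) : tdom i p -> triv i u = triv i v -> u = v.
Proof. by move=> ip; apply: (can_inj (trivK hB ip)). Qed.

Lemma untrivE i p (y : 'rV[R]_n) : tdom i p ->
  untriv i p y = \sum_j y 0 j *: frame i j p.
Proof.
move=> ip; apply: (triv_inj ip);
  rewrite (untrivK hB ip) triv_sum// {1}[y]row_sum_delta.
by apply: eq_bigr => j _; rewrite trivZ// /frame (untrivK hB ip).
Qed.

Lemma frame_expansion i p (v : B p) : tdom i p ->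
  v = \sum_j triv i v 0 j *: frame i j p.
Proof. by move=> ip; rewrite -untrivE// (trivK hB ip). Qed.

Lemma triv_frame i j k p : tdom i p -> triv i (frame i j p) 0 k = (k == j)%:R.
Proof. by move=> ip; rewrite /frame (untrivK hB ip) mxE eqxx. Qed.

Lemma triv_change i i' p (v : B p) k : tdom i p -> tdom i' p ->
  triv i' v 0 k = \sum_j triv i v 0 j * triv i' (frame i j p) 0 k.
Proof.
move=> ip i'p; rewrite {1}(frame_expansion v ip) triv_sum// summxE.
by apply: eq_bigr => j _; rewrite trivZ// mxE.
Qed.

Lemma smooth_triv_change (e : forall p, B p) i W : mopen M W -> W `<=` tdom i ->
  (forall k, smooth_fun_on W (fun q => triv i (e q) 0 k)) ->
  forall i' k, smooth_fun_on (W `&` tdom i') (fun q => triv i' (e q) 0 k).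
Proof.
move=> oW Wi se i' k; have oWi' := mopenI hMa oW (tdom_open hB i').
apply: (smooth_fun_on_ext hMa (f := fun q => \sum_j triv i (e q)
  0 j * triv i' (frame i j q) 0 k)) => //.
  by move=> q [/Wi iq i'q]; rewrite (triv_change _ _ iq).
apply: smooth_fun_on_sum => // j _; apply: smooth_fun_onM => //.
  by apply: smooth_fun_on_sub (se j) => q [].
by apply: smooth_fun_on_sub (bundle_transition_smooth hB i i' j k) => q [/Wi].
Qed.

Lemma section_exists (e : forall p, B p) :
  (forall p, exists i W, [/\ mopen M W, W p, W `<=` tdom i &
     forall k, smooth_fun_on W (fun q => triv i (e q) 0 k)]) ->
  exists s : section B, forall p, s p = e p.
Proof.
move=> h; suff se i k : smooth_fun_on (tdom i) (fun q => triv i (e q) 0 k).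
  by exists (Section se).
apply: smooth_fun_on_local => p ip; have [i0 [W [oW Wp Wi0 sW]]] := h p.
by exists (W `&` tdom i) => //;
  exact: (@smooth_triv_change e i0 W oW Wi0 sW i k).
Qed.

Lemma smooth_section_comb f g s t i k : smooth_fun f -> smooth_fun g ->
  smooth_fun_on (tdom i) (fun q => triv i (f q *: s q + g q *: t q) 0 k).
Proof.
move=> sf sg; have oi := tdom_open hB i.
apply: (smooth_fun_on_ext hMa (f := fun q => f q * triv i (s q)
  0 k + g q * triv i (t q) 0 k)) => //.
  by move=> q iq; rewrite trivD// !trivZ// !mxE.
have ss (v : section B) : smooth_fun_on (tdom i) (fun q => triv i (v q) 0 k).
  exact: section_smooth.
by apply: smooth_fun_onD => //; apply: smooth_fun_onM => //;
  apply: smooth_fun_sub.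
Qed.

Lemma section_comb_exists f g s t : smooth_fun f -> smooth_fun g ->
  exists u : section B, forall p, u p = f p *: s p + g p *: t p.
Proof.
by move=> sf sg; exists (Section (fun i k =>
  @smooth_section_comb f g s t i k sf sg)).
Qed.

Lemma section_scale_exists f s : smooth_fun f ->
  exists u : section B, forall p, u p = f p *: s p.
Proof.
move=> sf; have s0 : smooth_fun (fun _ : M => (0 : R))
  by exact: smooth_fun_on_cst.
have [u uE] := section_comb_exists s s sf s0.
by exists u => p; rewrite uE scale0r addr0.
Qed.

Lemma section_of_local i W (y : M -> 'rV[R]_n)
  p : mopen M W -> W p -> W `<=` tdom i ->
  (forall k, smooth_fun_on W (fun q => y q 0 k)) ->
  exists (s : section B) V, [/\ mopen M V, V p, V `<=` W &
    forall q, V q -> s q = untriv i q (y q)].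
Proof.
move=> oW Wp Wi sy; have [u [V [su [oV Vp] VW u1 u0]]] := manifold_bump hM oW
  Wp.
pose e q := (if `[< W q >] then u q else 0) *: untriv i q (y q) : B q.
have [|s sE] := @section_exists e.
  move=> q; have [Wq|/u0[V' [oV' V'q u0']]] := pselect (W q).
    exists i, W; split => // k.
    apply: (smooth_fun_on_ext hMa (f := fun q => u q * y q 0 k)) => //.
      move=> q' Wq'; rewrite /e; case: asboolP => // _.
      by rewrite trivZ ?(untrivK hB (Wi _ Wq')) ?mxE//; exact: Wi.
    by apply: smooth_fun_onM => //; exact: smooth_fun_sub.
  have iq := triv_at_dom hB q.
  exists (triv_at B q), (V' `&` tdom (triv_at B q)); split => //.
    exact: mopenI (tdom_open hB _).
  move=> k; apply: (smooth_fun_on_ext hMa (f := fun=> 0)).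
  - exact: mopenI (tdom_open hB _).
  - move=> q' [V'q' iq']; rewrite /e u0'// if_same scale0r triv0// mxE//.
  - exact: smooth_fun_on_cst.
exists s, V; split => // q Vq; rewrite sE /e u1//.
case: asboolP => [_|nW]; first by rewrite scale1r.
by case: (nW (VW _ Vq)).
Qed.

Lemma section_frame_exists i j p : tdom i p -> exists (s : section B) V,
  [/\ mopen M V, V p, V `<=` tdom i & forall q, V q -> s q = frame i j q].
Proof.
move=> ip; apply: (@section_of_local i (tdom i) (fun=> delta_mx 0 j)) => //.
  exact: tdom_open.
by move=> k; exact: smooth_fun_on_cst.
Qed.

Lemma section_value_exists p (v : B p) : exists s : section B, s p = v.
Proof.
have ip := triv_at_dom hB p.
have [||||s [V [_ Vp _ sE]]] := @section_of_local (triv_at B p)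
  (tdom (triv_at B p))
  (fun=> triv (triv_at B p) v) p.
- exact: tdom_open.
- by [].
- by [].
- by move=> k; exact: smooth_fun_on_cst.
- by exists s; rewrite sE// (trivK hB ip).
Qed.

End Bundle.

Section TotalSpace.
Context {R : realType} {m n : nat} {M : charted R m} {B : vbundle M n}.
Hypotheses (hM : is_manifold M) (hB : is_vbundle B).
Let hMa : is_atlas M := manifold_atlas hM.
Local Notation N := (total_space B).
Implicit Types (i : triv_idx B) (W : set M) (f : M -> R) (c : chart_idx N)
  (a : N).

Definition above W : set N := [set a | W (projT1 a)].

(** Fibres are whole vector spaces, so the image is a cylinder; openness and smoothness over [W]
    thereby reduce to the base. *)
Lemma over_image c W : coords c @` (cdom c `&` above W) =
  lsubmx @^-1` (coords c.1 @` (cdom c.1 `&` (tdom c.2 `&` W))).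
Proof.
apply/seteqP; split => x.
  move=> [[p v]] [[/= cp ip] Wp] <-; exists p => //.
  by rewrite /= row_mxKl.
move=> [p [cp [ip Wp]] px]; exists (existT _ p (untriv c.2 p (rsubmx x))) =>
  //=.
by rewrite (untrivK hB ip) px hsubmxK.
Qed.

Lemma mopen_over W : mopen M W -> mopen N (above W).
Proof.
move=> oW c; rewrite over_image; apply: open_comp.
  by move=> x _; apply: differentiable_continuous; exact: differentiable_lsubmx.
exact: (mopenI hMa (tdom_open hB _) oW).
Qed.

Lemma cdom_total c : cdom c = above (cdom c.1 `&` tdom c.2).
Proof. by apply/seteqP; split => -[p v]. Qed.

Lemma param_coords_total c a : cdom c a -> param c (coords c a) = a.
Proof.
case: a => p v [/= cp ip]; rewrite row_mxKl row_mxKr (atlasK hMa cp).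
by rewrite (trivK hB ip).
Qed.

Lemma smooth_lsubmx (O : set 'rV[R]_(m + n)) k : smooth_on O (fun x =>
  lsubmx x 0 k).
Proof.
rewrite (_ : (fun _ => _) = (fun x : 'rV[R]_(m + n) => x 0 (lshift n k))).
  exact: smooth_on_coord.
by apply/funext => x; rewrite mxE.
Qed.

Lemma smooth_rsubmx (O : set 'rV[R]_(m + n)) k : smooth_on O (fun x =>
  rsubmx x 0 k).
Proof.
rewrite (_ : (fun _ => _) = (fun x : 'rV[R]_(m + n) => x 0 (rshift m k))).
  exact: smooth_on_coord.
by apply/funext => x; rewrite mxE.
Qed.

Lemma smooth_over W f : mopen M W -> smooth_fun_on W f ->
  smooth_fun_on (above W) (fun a : N => f (projT1 a)).
Proof.
move=> oW sf c; have oN := mopen_over oW.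
apply: (smooth_on_comp (O' := coords c.1 @` (cdom c.1 `&` W))
  (f := f \o param c.1)
   (G := fun x : 'rV[R]_(m + n) => lsubmx x)).
- exact: oN.
- move=> x; rewrite over_image => -[p [cp [ip Wp]] e]; exists p => //.
- by move=> k; exact: smooth_lsubmx.
- exact: sf.
Qed.

Lemma smooth_triv_coord i j :
  smooth_fun_on (above (tdom i)) (fun a : N => triv i (projT2 a) 0 j).
Proof.
move=> c; have oN := mopen_over (tdom_open hB i) (c := c).
pose f k := fun p => triv i (frame c.2 k p) 0 j.
apply: (@smooth_on_ext _ _ _ (fun x : 'rV[R]_(m + n) => \sum_k rsubmx x 0 k *
   ((f k \o param c.1) \o (fun x : 'rV[R]_(m + n) => lsubmx x)) x)) => //.
  move=> _ [[p v] [[/= cp ip] i'p] <-] /=;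
    rewrite row_mxKl row_mxKr (atlasK hMa cp).
  rewrite (trivK hB ip) (triv_change hB v j ip i'p).
  by apply: eq_bigr.
apply: smooth_on_sum => // k _; apply: smooth_onM => //;
  first exact: smooth_rsubmx.
apply: (smooth_on_comp (O' := coords c.1 @` (cdom c.1 `&` (tdom c.2 `&` tdom
  i)))) => //.
- by move=> x; rewrite over_image.
- by move=> k'; exact: smooth_lsubmx.
- exact: (bundle_transition_smooth hB c.2 i k j).
Qed.

Lemma total_space_atlas : is_atlas N.
Proof.
split.
- by move=> [p v]; split; [exact: (atlas_at hMa)|exact: (triv_at_dom hB)].
- by move=> c a; exact: param_coords_total.
- move=> c; rewrite cdom_total; apply: mopen_over.
  exact: (mopenI hMa (atlas_open hMa _) (tdom_open hB _)).
- move=> c l; have oc := atlas_open hMa c.1; have oi := tdom_open hB c.2.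
  have oci := mopenI hMa oc oi.
  have [k|j] := split_ordP l => ->.
    have sk : smooth_fun_on (cdom c) (fun a : N => coords c.1 (projT1 a) 0 k).
      rewrite cdom_total; apply: (smooth_over oci (f := fun p =>
        coords c.1 p 0 k)).
      by apply: smooth_fun_on_sub (atlas_smooth hMa c.1 k) => p [].
    rewrite (_ : (fun _ => _) = (fun a : N => coords c.1 (projT1 a) 0 k))//.
    by apply/funext => a; rewrite /= row_mxEl.
  have sj : smooth_fun_on (cdom c) (fun a : N => triv c.2 (projT2 a) 0 j).
    by apply: (smooth_fun_on_sub _ (@smooth_triv_coord c.2 j)) => a [].
  rewrite (_ : (fun _ => _) = (fun a : N => triv c.2 (projT2 a) 0 j))//.
  by apply/funext => a; rewrite /= row_mxEr.
Qed.

Lemma smooth_basic f : smooth_fun f -> smooth_fun (fun a : N => f (projT1 a)).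
Proof. exact: (smooth_over (mopenT hMa)). Qed.

Lemma grad_over_l W f c a l : mopen M W -> smooth_fun_on W f -> W (projT1 a)
  -> cdom c a ->
  grad c (fun a : N => f (projT1 a)) a (lshift n l)
    = cpartial c.1 f l (projT1 a).
Proof.
case: a => p v /= oW sf Wp [/= cp ip]; rewrite /grad /cpartial.
rewrite (_ : _ \o _ = (f \o param c.1) \o (fun x : 'rV[R]_(m + n) =>
  lsubmx x))//.
have cE : lsubmx (coords c (existT _ p v : N))
  = coords c.1 p by rewrite row_mxKl.
rewrite partial_comp; first last.
- by move=> k; apply: smooth_on_diff (smooth_lsubmx (O := setT) k) _.
- by rewrite cE; apply: (smooth_fun_on_diff sf).
rewrite cE (bigD1 l)//= big1 ?addr0 => [|k kl]; last first.
  rewrite (_ : (fun y => _) = (fun x : 'rV[R]_(m + n) => x 0 (lshift n k)));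
    last first.
    by apply/funext => x; rewrite mxE.
  by rewrite partial_coord eq_lshift eq_sym (negbTE kl) mul0r.
rewrite (_ : (fun y => _) = (fun x : 'rV[R]_(m + n) => x 0 (lshift n l)));
  last first.
  by apply/funext => x; rewrite mxE.
by rewrite partial_coord eqxx mul1r.
Qed.

Lemma grad_over_r W f c a j : mopen M W -> smooth_fun_on W f -> W (projT1 a)
  -> cdom c a ->
  grad c (fun a : N => f (projT1 a)) a (rshift m j) = 0.
Proof.
case: a => p v /= oW sf Wp [/= cp ip]; rewrite /grad /cpartial.
rewrite (_ : _ \o _ = (f \o param c.1) \o (fun x : 'rV[R]_(m + n) =>
  lsubmx x))//.
have cE : lsubmx (coords c (existT _ p v : N))
  = coords c.1 p by rewrite row_mxKl.
rewrite partial_comp; first last.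
- by move=> k; apply: smooth_on_diff (smooth_lsubmx (O := setT) k) _.
- by rewrite cE; apply: (smooth_fun_on_diff sf).
rewrite big1// => k _.
rewrite (_ : (fun y => _) = (fun x : 'rV[R]_(m + n) => x 0 (lshift n k)));
  last first.
  by apply/funext => x; rewrite mxE.
by rewrite partial_coord eq_rlshift mul0r.
Qed.

Lemma grad_triv_coord c a j k : cdom c a ->
  grad c (fun a : N => triv c.2 (projT2 a) 0 j) a k = (k == rshift m j)%:R.
Proof.
move=> ca; rewrite -(cpartial_coord total_space_atlas (rshift m j) k ca).
rewrite /grad; congr (cpartial c _ k a).
by apply/funext => b; rewrite /= row_mxEr.
Qed.

End TotalSpace.

(** * The dual bundle, its linear and basic functions, and global test functions *)

Section Dual.
Context {R : realType} {m n : nat} {M : charted R m} {A : vbundle M n}.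
Hypotheses (hM : is_manifold M) (hA : is_vbundle A).
Let hMa : is_atlas M := manifold_atlas hM.

(** [linfun] reproduces a map once it is linear, and linearity of [triv i] is available over its
    domain. *)
Lemma dual_untrivE (i : triv_idx A) p (y : 'rV[R]_n) (v : A p) : tdom i p ->
  (untriv (v := dual A) i p y : 'Hom(A p, R^o)) v = \sum_j y 0 j * triv i v 0 j.
Proof.
move=> ip; rewrite /=.
have lin : linear (fun v : A p => (\sum_j y 0 j * triv i v 0 j : R^o)).
  move=> b u w; rewrite -[X in _ = X + _]/(b * _) mulr_sumr -big_split;
    apply: eq_bigr => j _ /=.
  by rewrite (triv_linear hA ip) !mxE; ring.
pose g : {linear A p -> R^o} := HB.pack (fun v : A p =>
  (\sum_j y 0 j * triv i v 0 j : R^o))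
  (GRing.isLinear.Build _ _ _ _ _ lin).
exact: (lfunE g v).
Qed.

Lemma dual_vbundle : is_vbundle (dual A).
Proof.
split.
- exact: (triv_at_dom hA).
- exact: (tdom_open hA).
- move=> i p ip b u v; apply/rowP => j; rewrite !mxE.
  by rewrite add_lfunE scale_lfunE.
- move=> i p ip alpha; apply/lfunP => v.
  rewrite (dual_untrivE _ _ ip) [in RHS](frame_expansion hA v ip) linear_sum.
  by apply: eq_bigr => j _; rewrite linearZ /= mxE mulrC.
- move=> i p ip y; apply/rowP => j; rewrite mxE (dual_untrivE _ _ ip).
  rewrite (bigD1 j)//= (triv_frame hA _ _ ip) eqxx mulr1 big1 ?addr0// => k kj.
  by rewrite (triv_frame hA _ _ ip) (negbTE kj) mulr0.
(* The transition matrix of the dual from [i] to [i'] is the transpose of that of [A] from [i'] to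
   [i]. *)
- move=> i i' j k; have oii := mopenI hMa (tdom_open hA i) (tdom_open hA i').
  apply: (smooth_fun_on_ext hMa (f := fun p => triv (v := A) i (frame (A := A)
    i' k p) 0 j)) => //.
    move=> p [ip i'p]; rewrite mxE; apply/esym.
    apply: (etrans (dual_untrivE (delta_mx 0 j) (frame (A := A) i' k p) ip)).
    rewrite (bigD1 j)//= mxE !eqxx mul1r big1 ?addr0// => l lj.
    by rewrite mxE (negbTE lj) andbF mul0r.
  by apply: smooth_fun_on_sub (bundle_transition_smooth hA i' i k j) => p [].
Qed.

Local Notation Astar := (total_space (dual A)).
Implicit Types (s t : section A) (a b : Astar) (c : chart_idx Astar)
  (f : M -> R).

(* The coordinate mu_j of the trivialization [i]. *)
Definition fibre_coord (i : triv_idx A) a (j : 'I_n) : R := triv (v := dual A)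
  i (projT2 a) 0 j.

Lemma dual_atlas : is_atlas Astar.
Proof. exact: total_space_atlas hM dual_vbundle. Qed.

Lemma linear_funE i s a : tdom i (projT1 a) ->
  linear_fun s a = \sum_j fibre_coord i a j * triv i (s (projT1 a)) 0 j.
Proof.
case: a => p alpha /= ip; rewrite /linear_fun /= {1}(frame_expansion hA (s p)
  ip).
rewrite linear_sum; apply: eq_bigr => j _.
by rewrite linearZ /= /fibre_coord mxE mulrC.
Qed.

Lemma smooth_fibre_coord i j : smooth_fun_on (above (tdom i))
  (fun a : Astar => fibre_coord i a j).
Proof. exact: (@smooth_triv_coord _ _ _ _ (dual A) hM dual_vbundle i j). Qed.

Lemma smooth_component i k s : smooth_fun_on (tdom i) (fun p => triv i (s p)
  0 k).
Proof. exact: section_smooth. Qed.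

Lemma mopen_over_dual (W : set M) : mopen M W -> mopen Astar (above W).
Proof. exact: (mopen_over hM dual_vbundle). Qed.

Lemma smooth_over_dual (W : set M) f : mopen M W -> smooth_fun_on W f ->
  smooth_fun_on (above W) (fun a : Astar => f (projT1 a)).
Proof. exact: (smooth_over hM dual_vbundle). Qed.

Lemma smooth_basic_fun f : smooth_fun f -> smooth_fun (basic_fun f : Astar ->
  R).
Proof. exact: (smooth_basic hM dual_vbundle). Qed.

Lemma smooth_linear_fun s : smooth_fun (linear_fun s).
Proof.
apply: smooth_fun_on_local => -[p alpha] _; set i := triv_at A p.
have ip : tdom i p := triv_at_dom hA p.
have oi : mopen Astar (above (tdom i)) := mopen_over_dual (tdom_open hA i).
exists (above (tdom i)) => //; apply: (smooth_fun_on_ext dual_atlas (f := fun a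
  =>
  \sum_j fibre_coord i a j * triv i (s (projT1 a)) 0 j)) => //.
  by move=> a ia; rewrite -linear_funE.
apply: smooth_fun_on_sum => // j _; apply: smooth_fun_onM => //;
  first exact: smooth_fibre_coord.
exact: (smooth_over_dual (tdom_open hA i) (@smooth_component i j s)).
Qed.

Lemma grad_basic_l f c a l : smooth_fun f -> cdom c a ->
  grad c (basic_fun f) a (lshift n l) = cpartial c.1 f l (projT1 a).
Proof. by move=> sf ca; apply: (grad_over_l l (mopenT hMa) sf). Qed.

Lemma grad_basic_r f c a j : smooth_fun f -> cdom c a ->
  grad c (basic_fun f) a (rshift m j) = 0.
Proof. by move=> sf ca; apply: (grad_over_r j (mopenT hMa) sf). Qed.

Lemma grad_linear s c a k : cdom c a -> grad c (linear_fun s) a k =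
  \sum_j (fibre_coord c.2 a j * grad c (fun b : Astar => triv (v := A)
    c.2 (s (projT1 b)) 0 j) a k
          + triv (v := A) c.2 (s (projT1 a)) 0 j * (k == rshift m j)%:R).
Proof.
move=> ca; have [cp ip] := ca; have oi := tdom_open hA c.2.
have sj j : smooth_fun_on (above (tdom (c.2 : triv_idx A)))
    (fun b : Astar => triv (v := A) c.2 (s (projT1 b)) 0 j).
  exact: (smooth_over_dual oi (@smooth_component c.2 j s)).
have sfj j := smooth_fun_onM (mopen_over_dual oi) (@smooth_fibre_coord c.2 j)
  (sj j).
rewrite (grad_ext dual_atlas (mopen_over_dual oi) ip ca (G := fun b =>
   \sum_j fibre_coord c.2 b j * triv (v := A) c.2 (s (projT1 b)) 0 j));
     last first.
  by move=> b ib; rewrite -linear_funE.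
rewrite /grad (cpartial_sum _ _ (fun j _ => sfj j) ip ca).
apply: eq_bigr => j _; rewrite (cpartialM dual_atlas _ (@smooth_fibre_coord c.2
  j) (sj j) ip ca).
congr (_ + _ * _).
exact: (@grad_triv_coord _ _ _ _ (dual A) hM dual_vbundle c a j k ca).
Qed.

Lemma grad_linear_l s c a l : cdom c a -> grad c (linear_fun s) a (lshift n l) =
  \sum_j fibre_coord c.2 a j * cpartial c.1 (fun p => triv (v := A) c.2 (s p)
    0 j) l (projT1 a).
Proof.
move=> ca; have [cp ip] := ca; rewrite grad_linear//; apply: eq_bigr => j _.
rewrite eq_lrshift mulr0 addr0; congr (_ * _).
exact: (grad_over_l l (tdom_open hA c.2) (@smooth_component c.2 j s)).
Qed.

Lemma grad_linear_r s c a j : cdom c a ->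
  grad c (linear_fun s) a (rshift m j) = triv (v := A) c.2 (s (projT1 a)) 0 j.
Proof.
move=> ca; have [cp ip] := ca; rewrite grad_linear// (bigD1 j)//= big1 ?addr0;
  last first.
  move=> k kj; rewrite eq_rshift eq_sym (negbTE kj) mulr0 addr0.
  rewrite (_ : grad _ _ _ _ = 0) ?mulr0//.
  exact: (grad_over_r j (tdom_open hA c.2) (@smooth_component c.2 k s)).
rewrite eqxx mulr1 (_ : grad _ _ _ _ = 0) ?mulr0 ?add0r//.
exact: (grad_over_r j (tdom_open hA c.2) (@smooth_component c.2 j s)).
Qed.

Lemma mopen_forall (k : nat) (V : 'I_k -> set M) : (forall j, mopen M (V j)) ->
  mopen M [set q | forall j, V j q].
Proof.
move=> oV; rewrite (_ : [set q | _] = [set q | forall j,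
  j \in enum 'I_k -> V j q]); last first.
  by apply/seteqP; split => q /= h j => [_|]; [exact: h|apply: h;
    rewrite mem_enum].
elim: (enum 'I_k) => [|j r IH].
  by rewrite (_ : [set _ | _] = setT); [exact: mopenT|apply/seteqP; split].
rewrite (_ : [set q | _] = V j `&` [set q | forall j', j' \in r -> V j' q]).
  exact: mopenI.
apply/seteqP; split => q /=.
  by move=> h; split => [|j' j'r]; apply: h; rewrite inE ?eqxx ?j'r ?orbT.
by move=> [Vjq h] j'; rewrite inE => /predU1P[->|/h].
Qed.

(** Brackets take global sections, so coordinates and frames are replaced by global objects with the
    same germs, on one common neighbourhood. *)
Lemma local_coordinates (c1 : chart_idx M) (i : triv_idx A)
  p : cdom c1 p -> tdom i p ->
  exists (s : 'I_n -> section A) (f : 'I_m -> M -> R) (V : set M),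
  [/\ [/\ mopen M V, V p & V `<=` cdom c1 `&` tdom i], forall l,
    smooth_fun (f l),
      forall l q, V q -> f l q = coords c1 q 0 l &
      forall j q, V q -> s j q = frame i j q].
Proof.
move=> cp ip.
have fj l : exists fV : (M -> R) * set M, [/\ smooth_fun fV.1, mopen M fV.2,
  fV.2 p,
    fV.2 `<=` cdom c1 & forall q, fV.2 q -> fV.1 q = coords c1 q 0 l].
  by have [g [V h]] := smooth_coord_germ hM l cp; exists (g, V).
have sj j : exists sV : section A * set M, [/\ mopen M sV.2, sV.2 p,
    sV.2 `<=` tdom i & forall q, sV.2 q -> sV.1 q = frame i j q].
  by have [s [V h]] := section_frame_exists hM hA j ip; exists (s, V).
have [f hf] := choice fj; have [s hs] := choice sj.
have oVf : mopen M [set q | forall l, (f l).2 q] by apply: mopen_forall => l;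
  case: (hf l).
have oVs : mopen M [set q | forall j, (s j).2 q] by apply: mopen_forall => j;
  case: (hs j).
have oci := mopenI hMa (atlas_open hMa c1) (tdom_open hA i).
exists (fun j => (s j).1), (fun l => (f l).1),
  (([set q | forall l, (f l).2 q] `&` [set q | forall j, (s j).2 q])
    `&` (cdom c1 `&` tdom i)).
split.
- split; first by apply: mopenI => //; exact: mopenI.
    by split => //; split => k /=; [case: (hf k)|case: (hs k)].
  by move=> q [].
- by move=> l; case: (hf l).
- by move=> l q [[fq _] _]; case: (hf l) => _ _ _ _; apply.
- by move=> j q [[_ sq] _]; case: (hs j) => _ _ _; apply.
Qed.

(** For [s] and [f] as in [local_coordinates], these have the germs of the coordinates of the total
    space: basic functions for the [x], linear ones for the [mu]. *)
Definition test_fun (s : 'I_n -> section A) (f : 'I_m -> M -> R)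
  (k : 'I_(m + n)) : Astar -> R :=
  match fintype.split k with inl l => basic_fun (f l) | inr j =>
    linear_fun (s j) end.

Lemma grad_test_fun (c : chart_idx Astar) V (s : 'I_n -> section A)
    (f : 'I_m -> M -> R) a : mopen M V -> V (projT1 a) ->
  V `<=` cdom c.1 `&` tdom (c.2 : triv_idx A) ->
  (forall l q, V q -> f l q = coords c.1 q 0 l) ->
  (forall j q, V q -> s j q = frame (A := A) c.2 j q) ->
  forall k l, grad c (test_fun s f k) a l = (l == k)%:R.
Proof.
move=> oV Va Vc fE sE k l; have ca : cdom c a by exact: Vc Va.
rewrite -(cpartial_coord dual_atlas k l ca).
apply: (cpartial_ext dual_atlas l (mopen_over_dual oV) Va ca) => b Vb.
have [cb ib] := Vc _ Vb.
rewrite /test_fun -{2}(splitK k); case: (fintype.split k) => [l'|j] /=.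
  by rewrite row_mxEl /basic_fun fE.
rewrite row_mxEr (linear_funE _ ib) (bigD1 j)//= sE// (triv_frame hA _ _ ib)
  eqxx mulr1.
rewrite big1 ?addr0// => j' jj'.
by rewrite (triv_frame hA _ _ ib) (negbTE jj') mulr0.
Qed.

End Dual.

(** * Tensors with prescribed values on linear and basic functions *)

Section Compatibility.
Context {R : realType} {m n : nat} {M : charted R m} {A : vbundle M n}.
Hypotheses (hM : is_manifold M) (hA : is_vbundle A).
Let hMa : is_atlas M := manifold_atlas hM.
Local Notation Astar := (total_space (dual A)).
Let hN : is_atlas Astar := dual_atlas hM hA.
Implicit Types (s t : section A) (a b : Astar) (c : chart_idx Astar)
  (f g : M -> R).
Implicit Types (br : @bracket_type _ _ _ _ A) (rho : @anchor_type _ _ _ _ A).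
Implicit Types (phi : section (dual A)) (L : bivfield Astar) (E : vfield Astar).

Definition pairing phi s : M -> R := fun p => (phi p : 'Hom(A p, R^o)) (s p).

Lemma pairing_linear_fun phi s p : pairing phi s p = linear_fun s (existT _ p
  (phi p) : Astar).
Proof. by []. Qed.

Lemma pairingE (i : triv_idx A) phi s p : tdom i p ->
  pairing phi s p = \sum_j triv (v := dual A) i (phi p) 0 j * triv i (s p) 0 j.
Proof. by move=> ip; rewrite pairing_linear_fun (linear_funE hA s (i := i)).
Qed.

Lemma smooth_pairing phi s : smooth_fun (pairing phi s).
Proof.
apply: smooth_fun_on_local => p _; have ip := triv_at_dom hA p.
have oi : mopen M (tdom (triv_at A p)) by exact: (tdom_open hA).
exists (tdom (triv_at A p)) => //.
apply: (smooth_fun_on_ext hMa (f := fun p' => \sum_j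
  triv (v := dual A) (triv_at A p) (phi p') 0 j * triv (triv_at A p) (s p')
    0 j)) => //.
  by move=> q iq; rewrite -pairingE.
apply: smooth_fun_on_sum => // j _; apply: smooth_fun_onM => //.
  exact: (@section_smooth _ _ _ _ (dual A) phi (triv_at A p) j).
exact: section_smooth.
Qed.

Section Anchor.
Variable rho : @anchor_type _ _ _ _ A.
Arguments rho : clear implicits.
Hypothesis hrho : is_anchor rho.

Lemma anchor0 p (c : chart_idx M) : rho p 0 c = 0.
Proof.
have := anchor_linear hrho 1 (0 : A p) 0 c; rewrite !scale1r addr0 => /eqP.
by rewrite -subr_eq subrr eq_sym => /eqP.
Qed.

Lemma anchor_sum p (c : chart_idx M) (I : Type) (r : seq I) (a : I -> R)
  (v : I -> A p) :
  rho p (\sum_(j <- r) a j *: v j) c = \sum_(j <- r) a j *: rho p (v j) c.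
Proof.
elim: r => [|j r IH]; first by rewrite !big_nil anchor0.
by rewrite !big_cons (anchor_linear hrho) IH.
Qed.

Lemma anchor_frameE (i : triv_idx A) s p (c : chart_idx M) l : tdom i p ->
  anchor_vf rho s c p 0 l = \sum_j triv i (s p) 0 j * rho p (frame i j p) c 0 l.
Proof.
move=> ip; rewrite /anchor_vf {1}(frame_expansion hA (s p) ip)
  anchor_sum summxE.
by apply: eq_bigr => j _; rewrite mxE.
Qed.

Lemma anchor_vfield s : is_vfield (anchor_vf rho s).
Proof.
split=> [p|c l]; first exact: anchor_tangent.
apply: smooth_fun_on_local => p cp; have ip := triv_at_dom hA p.
pose i := triv_at A p.
have oi : mopen M (tdom i) by exact: (tdom_open hA).
have oic := mopenI hMa oi (atlas_open hMa c).
exists (tdom i `&` cdom c) => //.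
apply: (smooth_fun_on_ext hMa (f := fun q => \sum_j triv i (s q)
  0 j * rho q (frame i j q) c 0 l)) => //.
  by move=> q [iq cq]; rewrite -(anchor_frameE s _ _ iq).
apply: smooth_fun_on_sum => // j _; apply: smooth_fun_onM => //.
  have si : smooth_fun_on (tdom i) (fun q => triv i (s q) 0 j)
    by exact: section_smooth.
  by apply: smooth_fun_on_sub si => q [].
exact: (anchor_smooth hrho).
Qed.

Lemma smooth_anchor_apply s f : smooth_fun f -> smooth_fun (vf_apply (anchor_vf
  rho s) f).
Proof. by move=> sf; apply: (smooth_vf_apply hMa) => //; exact: anchor_vfield.
Qed.

End Anchor.

(* [L] and [E] take on linear and basic functions the values that the Jacobi
   structure of [(br, rho, phi)] should have. This is stated chart by chart, so
   that it makes sense before [L] and [E] are known to be tensors. *)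
Record compatible br rho phi L E : Prop := {
  compat_skew : forall c a, cdom c a -> (L c a)^T = - L c a;
  compat_linlin : forall c a s t, cdom c a ->
    biv_in c L (linear_fun s) (linear_fun t) a =
    linear_fun (br s t) a + linear_fun s a * pairing phi t (projT1 a)
                          - linear_fun t a * pairing phi s (projT1 a);
  compat_linbas : forall c a s f, cdom c a -> smooth_fun f ->
    biv_in c L (linear_fun s) (basic_fun f) a = vf_apply (anchor_vf rho s)
      f (projT1 a);
  compat_basbas : forall c a f g, cdom c a -> smooth_fun f -> smooth_fun g ->
    biv_in c L (basic_fun f) (basic_fun g) a = 0;
  compat_lin : forall c a s, cdom c a ->
    vf_in c E (linear_fun s) a = - pairing phi s (projT1 a);
  compat_bas : forall c a f, cdom c a -> smooth_fun f ->
    vf_in c E (basic_fun f) a = 0 }.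

Lemma bil_delta (d : nat) (X : 'I_d -> 'I_d -> R) (u v : 'I_d -> R) k l :
  (forall j, u j = (j == k)%:R) -> (forall j, v j = (j == l)%:R)
    -> bil X u v = X k l.
Proof.
move=> uE vE; rewrite /bil (bigD1 k)//= [X in _ + X]big1 => [|j jk]; last first.
  by rewrite big1// => j' _; rewrite uE (negbTE jk) mulr0 mul0r.
rewrite addr0 (bigD1 l)//= big1 => [|j jl];
  last by rewrite vE (negbTE jl) mulr0.
by rewrite uE vE !eqxx !mulr1 addr0.
Qed.

Lemma dot_delta (d : nat) (X u : 'I_d -> R) k :
  (forall j, u j = (j == k)%:R) -> dot X u = X k.
Proof.
move=> uE; rewrite /dot (bigD1 k)//= big1 => [|j jk];
  last by rewrite uE (negbTE jk) mulr0.
by rewrite uE eqxx mulr1 addr0.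
Qed.

(** On test functions adapted to a chart this is the component of any compatible bivector field
    there. It mentions neither the field nor a chart, whence uniqueness, the transformation law and
    smoothness. *)
Definition test_biv br rho phi (s : 'I_n -> section A) (f : 'I_m -> M -> R)
    (k l : 'I_(m + n)) a : R :=
  match fintype.split k, fintype.split l with
  | inl _, inl _ => 0
  | inr i, inl l => vf_apply (anchor_vf rho (s i)) (f l) (projT1 a)
  | inl k, inr j => - vf_apply (anchor_vf rho (s j)) (f k) (projT1 a)
  | inr i, inr j => linear_fun (br (s i) (s j)) a
      + linear_fun (s i) a * pairing phi (s j) (projT1 a)
      - linear_fun (s j) a * pairing phi (s i) (projT1 a)
  end.

Definition test_vf phi (s : 'I_n -> section A) (k : 'I_(m + n)) a : R :=
  match fintype.split k with inl _ => 0 | inr i => - pairing phi (s i)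
    (projT1 a) end.

Lemma smooth_test_fun (s : 'I_n -> section A) (f : 'I_m -> M -> R) k :
  (forall l, smooth_fun (f l)) -> smooth_fun (test_fun s f k).
Proof.
move=> sf; rewrite /test_fun; case: (fintype.split k) => j.
  exact: (smooth_basic_fun hM hA).
exact: (smooth_linear_fun hM hA).
Qed.

Section Compatible.
Variables (br : @bracket_type _ _ _ _ A) (rho : @anchor_type _ _ _ _ A).
Variables (phi : section (dual A)) (L : bivfield Astar) (E : vfield Astar).
Hypothesis hc : compatible br rho phi L E.

Lemma compat_baslin c a s f : cdom c a -> smooth_fun f ->
  biv_in c L (basic_fun f) (linear_fun s) a = - vf_apply (anchor_vf rho s)
    f (projT1 a).
Proof.
by move=> ca sf; rewrite biv_in_skew ?(compat_skew hc)// (compat_linbas hc).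
Qed.

Lemma compat_test_biv (s : 'I_n -> section A) (f : 'I_m -> M -> R) c a k l :
  (forall l, smooth_fun (f l)) -> cdom c a ->
  biv_in c L (test_fun s f k) (test_fun s f l)
    a = test_biv br rho phi s f k l a.
Proof.
move=> sf ca; rewrite /test_fun /test_biv.
case: (fintype.split k) => i; case: (fintype.split l) => j.
- exact: (compat_basbas hc).
- exact: compat_baslin.
- exact: (compat_linbas hc).
- exact: (compat_linlin hc).
Qed.

Lemma compat_test_vf (s : 'I_n -> section A) (f : 'I_m -> M -> R) c a k :
  (forall l, smooth_fun (f l)) -> cdom c a ->
  vf_in c E (test_fun s f k) a = test_vf phi s k a.
Proof.
move=> sf ca; rewrite /test_fun /test_vf; case: (fintype.split k) => i.
  exact: (compat_bas hc).
exact: (compat_lin hc).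
Qed.

End Compatible.

Lemma compatible_unique br rho phi L E L' E' :
  compatible br rho phi L E -> compatible br rho phi L' E' ->
  forall c a, cdom c a -> L c a = L' c a /\ E c a = E' c a.
Proof.
move=> hc hc' c a ca; have [cp ip] := ca.
have [s [f [V [[oV Vp Vc] sf fE sE]]]] := local_coordinates hM hA cp ip.
have g := grad_test_fun hM hA oV Vp Vc fE sE.
split; first apply/matrixP => k l; last first.
  apply/rowP => k; rewrite -(dot_delta (E c a 0) (g k)) -(dot_delta (E' c a 0)
    (g k)).
  by rewrite -!/(vf_in _ _ _ _) (compat_test_vf hc)// (compat_test_vf hc').
rewrite -(bil_delta (L c a) (g k) (g l)) -(bil_delta (L' c a) (g k) (g l)).
by rewrite -!/(biv_in _ _ _ _ _) (compat_test_biv hc)// (compat_test_biv hc').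
Qed.

Section Tensors.
Variables (br : @bracket_type _ _ _ _ A) (rho : @anchor_type _ _ _ _ A).
Variables (phi : section (dual A)) (L : bivfield Astar) (E : vfield Astar).
Hypotheses (hrho : is_anchor rho) (hc : compatible br rho phi L E).

(** The value on test functions adapted to [c'] is the component in [c'], and compatibility gives
    the same value in [c]; the transformation law follows without any formula for the change of
    structure functions. *)
Lemma compatible_bivfield : (forall c a, ~ cdom c a -> L c a = 0)
  -> is_bivfield L.
Proof.
move=> L0; split => //; first exact: (compat_skew hc).
- move=> c c' a ca c'a; have [cp ip] := c'a.
  have [s [f [V [[oV Vp Vc] sf fE sE]]]] := local_coordinates hM hA cp ip.
  have g := grad_test_fun hM hA oV Vp Vc fE sE.
  apply/matrixP => k l; rewrite -(bil_delta (L c' a) (g k) (g l)).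
  rewrite -/(biv_in _ _ _ _ _) (compat_test_biv hc)//
    -(compat_test_biv hc _ _ _ _ ca)//.
  rewrite /biv_in -(@bil_change _ _ (Defs.jacobian c c' a) (L c a) _ _
    (grad c' (test_fun s f k) a) _ (grad c' (test_fun s f l) a) (erefl _)).
  + by rewrite (bil_delta _ (g k) (g l)).
  + move=> j; have st := smooth_test_fun s k sf.
    exact: (cpartial_change hN j st Logic.I ca c'a).
  + move=> j; have st := smooth_test_fun s l sf.
    exact: (cpartial_change hN j st Logic.I ca c'a).
- move=> c k l; apply: smooth_fun_on_local => a ca; have [cp ip] := ca.
  have [s [f [V [[oV Vp Vc] sf fE sE]]]] := local_coordinates hM hA cp ip.
  have oV' := mopen_over_dual hM hA oV; exists (above V) => //.
  apply: (smooth_fun_on_ext hN (f := test_biv br rho phi s f k l)) => //.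
    move=> b Vb; have cb : cdom c b := Vc _ Vb.
    have g := grad_test_fun hM hA oV Vb Vc fE sE.
    rewrite -(bil_delta (L c b) (g k) (g l)).
    by rewrite -/(biv_in _ _ _ _ _) (compat_test_biv hc).
  have sr i j : smooth_fun_on (above V) (fun b : Astar =>
    vf_apply (anchor_vf rho (s i)) (f j) (projT1 b)).
    apply: smooth_fun_on_sub (smooth_basic_fun hM hA (smooth_anchor_apply hrho
      (s i) (sf j))).
    by [].
  have sl t : smooth_fun_on (above V) (linear_fun t).
    by apply: smooth_fun_on_sub (smooth_linear_fun hM hA t).
  have sp t : smooth_fun_on (above V) (fun b : Astar =>
    pairing phi t (projT1 b)).
    by apply: smooth_fun_on_sub (smooth_basic_fun hM hA (smooth_pairing phi t)).
  rewrite /test_biv; case: (fintype.split k) => i; case: (fintype.split l) => j.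
  + exact: smooth_fun_on_cst.
  + exact: smooth_fun_onN.
  + exact: sr.
  + by apply: smooth_fun_onB => //; [apply: smooth_fun_onD => //|];
    apply: smooth_fun_onM.
Qed.

Lemma compatible_vfield : (forall c a, ~ cdom c a -> E c a = 0) -> is_vfield E.
Proof.
move=> E0; split.
- move=> a; split => [c|c c' ca c'a]; first exact: E0.
  have [cp ip] := c'a.
  have [s [f [V [[oV Vp Vc] sf fE sE]]]] := local_coordinates hM hA cp ip.
  have g := grad_test_fun hM hA oV Vp Vc fE sE.
  apply/rowP => k; rewrite -(dot_delta (E c' a 0) (g k)).
  rewrite -/(vf_in _ _ _ _) (compat_test_vf hc)//
    -(compat_test_vf hc s k sf ca).
  rewrite /vf_in -(@dot_change _ _ (Defs.jacobian c c' a) (E c a) _ _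
    (grad c' (test_fun s f k) a) (erefl _)).
    by rewrite (dot_delta _ (g k)).
  move=> j; have st := smooth_test_fun s k sf.
  exact: (cpartial_change hN j st Logic.I ca c'a).
- move=> c k; apply: smooth_fun_on_local => a ca; have [cp ip] := ca.
  have [s [f [V [[oV Vp Vc] sf fE sE]]]] := local_coordinates hM hA cp ip.
  have oV' := mopen_over_dual hM hA oV; exists (above V) => //.
  apply: (smooth_fun_on_ext hN (f := test_vf phi s k)) => //.
    move=> b Vb; have cb : cdom c b := Vc _ Vb.
    have g := grad_test_fun hM hA oV Vb Vc fE sE.
    rewrite -(dot_delta (E c b 0) (g k)).
    by rewrite -/(vf_in _ _ _ _) (compat_test_vf hc).
  rewrite /test_vf; case: (fintype.split k) => i;
    first exact: smooth_fun_on_cst.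
  apply: smooth_fun_onN => //.
  by apply: smooth_fun_on_sub (smooth_basic_fun hM hA (smooth_pairing phi (s
    i))).
Qed.

End Tensors.

End Compatibility.

(** * The image of a Lie algebroid with a cocycle *)

Section BracketLocality.
Context {R : realType} {m n : nat} {M : charted R m} {A : vbundle M n}.
Hypotheses (hM : is_manifold M) (hA : is_vbundle A).
Let hMa : is_atlas M := manifold_atlas hM.
Implicit Types (s t : section A) (p q : M).
Variables (br : @bracket_type _ _ _ _ A) (rho : @anchor_type _ _ _ _ A).
Hypothesis hbr : is_lie_algebroid br rho.

(* With [f = 1 - u] for a bump function [u] at [p], [s = f s] and the Leibniz
   rule gives the value [0] at [p]. *)
Lemma bracket_vanish (W : set M) s t p : mopen M W -> W p ->
  (forall q, W q -> s q = 0) -> br s t p = 0.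
Proof.
move=> oW Wp s0; have [u [V [su [oV Vp] VW u1 u0]]] := manifold_bump hM oW Wp.
have sf : smooth_fun (fun q => 1 - u q).
  by apply: smooth_fun_onB => //; [exact: mopenT|exact: smooth_fun_on_cst].
have sE q : s q = (1 - u q) *: s q.
  have [/s0->|/u0[V' [_ V'q u0']]] := pselect (W q); first by rewrite scaler0.
  by rewrite u0'// subr0 scale1r.
rewrite (bracket_skew hbr) (bracket_leibniz hbr t sf sE) u1//
  subrr scale0r s0//.
by rewrite scaler0 addr0 oppr0.
Qed.

Lemma bracket_eql (W : set M) s s' t p : mopen M W -> W p ->
  (forall q, W q -> s q = s' q) -> br s t p = br s' t p.
Proof.
move=> oW Wp ss'.
have [d dE] := section_comb_exists hM hA s s' (smooth_fun_on_cst (D := setT) 1)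
  (smooth_fun_on_cst (D := setT) (-1)).
have sE q : s q = 1 *: d q + s' q by rewrite dE scaleN1r !scale1r subrK.
rewrite (bracket_linear hbr t sE) scale1r (@bracket_vanish W)// ?add0r// =>
  q Wq.
by rewrite dE scaleN1r scale1r ss'// subrr.
Qed.

Lemma bracket_local (W : set M) s s' t t' p : mopen M W -> W p ->
  (forall q, W q -> s q = s' q) -> (forall q, W q -> t q = t' q) ->
  br s t p = br s' t' p.
Proof.
move=> oW Wp ss' tt'; rewrite (bracket_eql t oW Wp ss').
by rewrite (bracket_skew hbr) (bracket_eql s' oW Wp tt') -(bracket_skew hbr).
Qed.

(** The type of sections carries no addition, so a sum is produced as some section with the right
    values, together with additivity of the bracket on it. *)
Lemma bracket_sum (I : Type) (r : seq I) (u : I -> section A) t :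
  exists2 S : section A, (forall q, S q = \sum_(j <- r) u j q) &
    forall p, br S t p = \sum_(j <- r) br (u j) t p.
Proof.
elim: r => [|j r [S SE brS]].
  have [z zE] := section_scale_exists hM hA t (smooth_fun_on_cst (D := setT) 0).
  exists z => q; first by rewrite zE scale0r big_nil.
  rewrite big_nil; apply: (@bracket_vanish setT) => //; first exact: mopenT.
  by move=> q' _; rewrite zE scale0r.
have s1 : smooth_fun (fun _ : M => (1 : R)) by exact: smooth_fun_on_cst.
have [T TE] := section_comb_exists hM hA (u j) S s1 s1.
exists T => q; first by rewrite TE !scale1r SE big_cons.
rewrite big_cons -brS -[X in X + _]scale1r; apply: (bracket_linear hbr) => q'.
by rewrite TE !scale1r.
Qed.

(** Near [p], [t] coincides with the global combination of the [e j] with coefficients [tau j];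
    locality and the Leibniz rule then apply. *)
Lemma bracket_frame_expansion (i : triv_idx A) (V : set M)
  (e : 'I_n -> section A)
    (tau : 'I_n -> M -> R) s t p :
  mopen M V -> V p -> V `<=` tdom i ->
  (forall j q, V q -> e j q = frame i j q) -> (forall j, smooth_fun (tau j)) ->
  (forall j q, V q -> tau j q = triv i (t q) 0 j) ->
  br s t p = \sum_j (tau j p *: br s (e j) p
                     + vf_apply (anchor_vf rho s) (tau j) p *: e j p).
Proof.
move=> oV Vp Vi eE stau tauE.
have [u uE] := choice (fun j => section_scale_exists hM hA (e j) (stau j)).
have [S SE brS] := bracket_sum (index_enum 'I_n) u s.
have tS q : V q -> t q = S q.
  move=> Vq; rewrite SE {1}(frame_expansion hA (t q) (Vi _ Vq)).
  by apply: eq_bigr => j _; rewrite uE tauE// eE.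
rewrite (bracket_skew hbr) (bracket_eql s oV Vp tS) brS -sumrN.
apply: eq_bigr => j _; rewrite -(bracket_skew hbr).
exact: (bracket_leibniz hbr s (stau j) (uE j)).
Qed.

(** [local_bracket] picks some global sections with the germs of the frame; by locality the choice
    is immaterial. *)
Lemma structure_funE (i : triv_idx A) (V : set M) (e : 'I_n -> section A)
  p j k l :
  mopen M V -> V p -> (forall j q, V q -> e j q = frame i j q) ->
  structure_fun br i j k l p = triv i (br (e j) (e k) p) 0 l.
Proof.
move=> oV Vp eE; rewrite /structure_fun /local_bracket.
set P := [set v | _]; have Pe : P (br (e j) (e k) p).
  by exists (e j), (e k); split => //; exists V; split => // q Vq; rewrite eE.
have [s [t [[W [oW Wp sE]] [W' [oW' Wp' tE]] ->]]] := xgetPex 0 (ex_intro P _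
  Pe).
congr (triv i _ 0 l); apply: (@bracket_local ((W `&` W') `&` V)) => //.
- exact: (mopenI hMa (mopenI hMa oW oW')).
- by move=> q [[Wq _] Vq]; rewrite sE// eE.
- by move=> q [[_ W'q] Vq]; rewrite tE// eE.
Qed.

End BracketLocality.

(** * The values of the image of [Psi] on linear and basic functions *)

Section PsiCompatible.
Context {R : realType}.

Lemma bilD (d : nat) (X Y : 'M[R]_d) u v : bil (X + Y)
  u v = bil X u v + bil Y u v.
Proof.
rewrite /bil -big_split; apply: eq_bigr => k _ /=; rewrite -big_split.
by apply: eq_bigr => l _ /=; rewrite mxE; ring.
Qed.

Lemma bilZ (d : nat) (b : R) (X : 'M[R]_d) u v : bil (b *: X)
  u v = b * bil X u v.
Proof.
rewrite /bil mulr_sumr; apply: eq_bigr => k _ /=; rewrite mulr_sumr.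
by apply: eq_bigr => l _ /=; rewrite mxE; ring.
Qed.

Lemma bil0 (d : nat) u v : bil (0 : 'M[R]_d) u v = 0.
Proof.
by rewrite /bil big1// => k _; rewrite big1// => l _; rewrite mxE !mul0r.
Qed.

Lemma bil_sum (d : nat) (I : Type) (r : seq I) (P : pred I) (X : I -> 'M[R]_d)
  u v :
  bil (\sum_(i <- r | P i) X i) u v = \sum_(i <- r | P i) bil (X i) u v.
Proof. by elim/big_rec2: _ => [|i y x _ <-]; [exact: bil0|exact: bilD]. Qed.

Lemma bil_wedge (d : nat) (x y : 'rV[R]_d) u v :
  bil (wedge x y) u v = dot (x 0) u * dot (y 0) v - dot (y 0) u * dot (x 0) v.
Proof.
rewrite /bil /dot !mulr_suml -sumrB; apply: eq_bigr => k _.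
rewrite !mulr_sumr -sumrB; apply: eq_bigr => l _.
by rewrite !mxE !big_ord1 !mxE; ring.
Qed.

Lemma dot_delta_mx (d : nat) k (u : 'I_d -> R)
  : dot ((delta_mx 0 k : 'rV[R]_d) 0) u = u k.
Proof.
rewrite /dot (bigD1 k)//= mxE !eqxx mul1r big1 ?addr0// => j jk.
by rewrite mxE (negbTE jk) andbF mul0r.
Qed.

(** Passes from the sum over [i < j] in [Lambda_dual] to a full double sum, whose diagonal is zero
    by skewness. *)
Lemma sum_skew (k : nat) (C x : 'I_k -> 'I_k -> R) : (forall i j,
  C i j = - C j i) ->
  \sum_(i < k) \sum_(j < k | (i < j)%N) C i j * (x i j - x j i)
    = \sum_i \sum_j C i j * x i j.
Proof.
move=> Cs; have C0 i : C i i = 0 by have := Cs i i; lra.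
have lower : \sum_(i < k) \sum_(j < k | (j < i)%N) C i j * x i j =
    - \sum_(i < k) \sum_(j < k | (i < j)%N) C i j * x j i.
  rewrite (exchange_big_dep xpredT)//= -sumrN; apply: eq_bigr => j _;
    rewrite -sumrN.
  by apply: eq_bigr => i _; rewrite (Cs i j) mulNr.
transitivity (\sum_(i < k) \sum_(j < k | (i < j)%N) C i j * x i j
    + \sum_(i < k) \sum_(j < k | (j < i)%N) C i j * x i j).
  rewrite lower -sumrB; apply: eq_bigr => i _; rewrite -sumrB.
  by apply: eq_bigr => j _; rewrite mulrBr.
rewrite -big_split; apply: eq_bigr => i _ /=.
rewrite [RHS](bigD1 i)//= C0 mul0r add0r [RHS](bigID (fun j : 'I_k =>
  (i < j)%N))/=.
congr (_ + _); apply: eq_bigl => j; rewrite -val_eqE /=; first by case: ltngtP.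
by case: ltngtP.
Qed.

Context {m n : nat} {M : charted R m} {A : vbundle M n}.
Hypotheses (hM : is_manifold M) (hA : is_vbundle A).
Let hMa : is_atlas M := manifold_atlas hM.
Local Notation Astar := (total_space (dual A)).
Let hN : is_atlas Astar := dual_atlas hM hA.
Implicit Types (s t : section A) (a : Astar) (c : chart_idx Astar)
  (f g : M -> R).
Variables (br : @bracket_type _ _ _ _ A) (rho : @anchor_type _ _ _ _ A).
Arguments rho : clear implicits.
Variable phi : section (dual A).
Hypothesis hbr : is_lie_algebroid br rho.
Let hrho : is_anchor rho := algebroid_anchor hbr.

Lemma bil_Lambda_dual c a (u v : 'I_(m + n) -> R) : cdom c a ->
  bil (Lambda_dual br rho c a) u v =
  \sum_(i < n) \sum_(j < n | (i < j)%N)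
    (\sum_k structure_fun br c.2 i j k (projT1 a) * fibre_coord (A := A)
    c.2 a k)
     * (u (rshift m i) * v (rshift m j) - u (rshift m j) * v (rshift m i))
  + \sum_i \sum_l rho (projT1 a) (frame (A := A) c.2 i (projT1 a)) c.1 0 l
     * (u (rshift m i) * v (lshift n l) - u (lshift n l) * v (rshift m i)).
Proof.
move=> ca; rewrite /Lambda_dual asboolT// bilD !bil_sum; congr (_ + _).
  apply: eq_bigr => i _; rewrite bil_sum; apply: eq_bigr => j _.
  rewrite bil_sum mulr_suml; apply: eq_bigr => k _.
  by rewrite bilZ bil_wedge !dot_delta_mx.
apply: eq_bigr => i _; rewrite bil_sum; apply: eq_bigr => l _.
by rewrite bilZ bil_wedge !dot_delta_mx.
Qed.

Lemma dot_sum_delta (d k : nat) (b : 'I_k -> R) (x : 'I_k -> 'I_d)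
  (u : 'I_d -> R) :
  dot ((\sum_i b i *: delta_mx 0 (x i) : 'rV[R]_d) 0) u = \sum_i b i * u (x i).
Proof.
rewrite /dot; under eq_bigr => l _ do rewrite summxE mulr_suml.
rewrite exchange_big; apply: eq_bigr => i _ /=;
  rewrite -(dot_delta_mx (x i)) /dot mulr_sumr.
by apply: eq_bigr => l _; rewrite mxE mulrA.
Qed.

Lemma dot_liouville c a u : cdom c a ->
  dot (liouville c a 0) u = \sum_i fibre_coord (A := A)
    c.2 a i * u (rshift m i).
Proof. by move=> ca; rewrite /liouville asboolT// dot_sum_delta. Qed.

Lemma dot_vertical_lift c a u : cdom c a ->
  dot (vertical_lift phi c a 0) u =
  \sum_i triv (v := dual A) c.2 (phi (projT1 a)) 0 i * u (rshift m i).
Proof.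
move=> ca; rewrite /vertical_lift asboolT// dot_sum_delta.
by apply: eq_bigr => i _; rewrite mxE.
Qed.

Lemma liouville_linear c a s : cdom c a ->
  dot (liouville c a 0) (grad c (linear_fun s) a) = linear_fun s a.
Proof.
move=> ca; have [_ ip] := ca; rewrite dot_liouville// (linear_funE hA s ip).
by apply: eq_bigr => i _; rewrite (grad_linear_r hM hA).
Qed.

Lemma vertical_lift_linear c a s : cdom c a ->
  dot (vertical_lift phi c a 0) (grad c (linear_fun s) a)
    = pairing phi s (projT1 a).
Proof.
move=> ca; have [_ ip] := ca; rewrite dot_vertical_lift//
  (pairingE hA phi s ip).
by apply: eq_bigr => i _; rewrite (grad_linear_r hM hA).
Qed.

Lemma vertical_basic c a f (b : 'I_n -> R) : smooth_fun f -> cdom c a ->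
  \sum_i b i * grad c (basic_fun f) a (rshift m i) = 0.
Proof.
by move=> sf ca; rewrite big1// => i _;
  rewrite (grad_basic_r hM i sf ca) ?mulr0.
Qed.

Lemma liouville_basic c a f : smooth_fun f -> cdom c a ->
  dot (liouville c a 0) (grad c (basic_fun f) a) = 0.
Proof. by move=> sf ca; rewrite dot_liouville// vertical_basic. Qed.

Lemma vertical_lift_basic c a f : smooth_fun f -> cdom c a ->
  dot (vertical_lift phi c a 0) (grad c (basic_fun f) a) = 0.
Proof. by move=> sf ca; rewrite dot_vertical_lift// vertical_basic. Qed.

Lemma component_germs (i : triv_idx A) s p : tdom i p ->
  exists (tau : 'I_n -> M -> R) (V : set M),
  [/\ mopen M V, V p, V `<=` tdom i, forall j, smooth_fun (tau j) &
      forall j q, V q -> tau j q = triv i (s q) 0 j].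
Proof.
move=> ip; have oi : mopen M (tdom i) by exact: (tdom_open hA).
have gj j : exists gV : (M -> R) * set M, [/\ smooth_fun gV.1, mopen M gV.2,
  gV.2 p,
    gV.2 `<=` tdom i & forall q, gV.2 q -> gV.1 q = triv i (s q) 0 j].
  have [g [V h]] := smooth_fun_germ hM oi ip (@smooth_component _ _ _ _ _ i j
    s).
  by exists (g, V).
have [g hg] := choice gj.
exists (fun j => (g j).1), ([set q | forall j, (g j).2 q] `&` tdom i); split.
- by apply: (mopenI hMa) => //; apply: (mopen_forall hM) => j; case: (hg j).
- by split => // j /=; case: (hg j).
- by move=> q [].
- by move=> j; case: (hg j).
- by move=> j q [gq _]; case: (hg j) => _ _ _ _; apply.
Qed.

Lemma anchor_applyE (c1 : chart_idx M) (i : triv_idx A) s f p :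
  cdom c1 p -> tdom i p -> smooth_fun f ->
  vf_apply (anchor_vf rho s) f p =
  \sum_j \sum_l triv i (s p) 0 j * rho p (frame i j p)
    c1 0 l * cpartial c1 f l p.
Proof.
move=> cp ip sf; rewrite (vf_applyE hMa _ sf cp); last exact: anchor_tangent.
rewrite /vf_in /dot exchange_big; apply: eq_bigr => l _ /=.
by rewrite (anchor_frameE hA hrho _ _ _ ip) mulr_suml.
Qed.

(** Both sides are expanded at one point in the structure functions, the anchor components and the
    first derivatives of the components of [s] and [t]; the Leibniz rule in each argument accounts
    for the derivative terms. *)
Lemma linear_fun_bracket c a s t : cdom c a ->
  let u := grad c (linear_fun s) a in let v := grad c (linear_fun t) a in
  bil (Lambda_dual br rho c a) u v = linear_fun (br s t) a.
Proof.
move=> ca u v; have [cp ip] := ca; set p := projT1 a in cp ip *.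
have [e [f [V [[oV Vp Vc] _ _ eE]]]] := local_coordinates hM hA cp ip.
have Vi : V `<=` tdom (c.2 : triv_idx A) by move=> q /Vc[].
have [sig [Vs [oVs Vsp Vsi ssig sigE]]] := component_germs s ip.
have [tau [Vt [oVt Vtp Vti stau tauE]]] := component_germs t ip.
pose alpha (w : A p) : R := (projT2 a : 'Hom(A p, R^o)) w.
have alphaD w w' : alpha (w + w')
  = alpha w + alpha w' by rewrite /alpha linearD.
have alphaN w : alpha (- w) = - alpha w by rewrite /alpha linearN.
have alphaZ (b : R) w : alpha (b *: w) = b * alpha w by rewrite /alpha linearZ.
have alpha_sum (F : 'I_n -> A p) : alpha (\sum_j F j) = \sum_j alpha (F j).
  by rewrite /alpha linear_sum.
have mu j : alpha (e j p) = fibre_coord (A := A) c.2 a j by rewrite eE//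
  /fibre_coord mxE.
pose C i j := \sum_k structure_fun br c.2 i j k p * fibre_coord (A := A)
  c.2 a k.
have CE i j : C i j = alpha (br (e i) (e j) p).
  rewrite [in RHS](frame_expansion hA (br (e i) (e j) p) ip) alpha_sum.
  apply: eq_bigr => k _; rewrite alphaZ -eE// mu.
  by rewrite (structure_funE hM hA hbr i j k oV Vp eE).
have Cskew i j : C i j = - C j i by rewrite !CE (bracket_skew hbr) alphaN.
pose rh i l := rho p (frame (A := A) c.2 i p) c.1 0 l.
pose S i := triv (v := A) c.2 (s p) 0 i;
  pose T i := triv (v := A) c.2 (t p) 0 i.
pose dS l i := cpartial c.1 (fun q => triv (v := A) c.2 (s q) 0 i) l p.
pose dT l i := cpartial c.1 (fun q => triv (v := A) c.2 (t q) 0 i) l p.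
have dsig j l : cpartial c.1 (sig j) l p = dS l j.
  by apply: (cpartial_ext hMa l oVs Vsp cp) => q; exact: sigE.
have dtau j l : cpartial c.1 (tau j) l p = dT l j.
  by apply: (cpartial_ext hMa l oVt Vtp cp) => q; exact: tauE.
have rs j : vf_apply (anchor_vf rho s) (tau j)
  p = \sum_i \sum_l S i * rh i l * dT l j.
  rewrite (anchor_applyE _ cp ip (stau j)); apply: eq_bigr => i _.
  by apply: eq_bigr => l _; rewrite dtau.
have re k j : vf_apply (anchor_vf rho (e k)) (sig j) p = \sum_l rh k l * dS l j.
  rewrite (anchor_applyE _ cp ip (ssig j))
    (bigD1 k)//= [X in _ + X]big1 ?addr0 => [|i ik].
    apply: eq_bigr => l _; rewrite dsig eE// (triv_frame hA _ _ ip) eqxx mul1r.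
    by [].
  rewrite big1// => l _; rewrite eE// (triv_frame hA _ _ ip) (negbTE ik) !mul0r.
  by [].
have oVVs := mopenI hMa oV oVs; have oVVt := mopenI hMa oV oVt.
(* The Leibniz rule acts on the second argument, so [s] is expanded after exchanging the arguments;
   hence the minus sign before its derivatives. *)
have bse j : alpha (br s (e j) p)
  = \sum_i (S i * C i j - (\sum_l rh j l * dS l i) * fibre_coord (A := A)
  c.2 a i).
  rewrite (bracket_skew hbr) (@bracket_frame_expansion _ _ _ _ _ hM hA _ _ hbr
    c.2
    (V `&` Vs) e sig _ _ _ oVVs) //; last first.
  - by move=> k q [_ Vsq]; exact: sigE.
  - by move=> k q [Vq _]; exact: eE.
  - by move=> q [/Vi].
  rewrite -sumrN alpha_sum; apply: eq_bigr => i _.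
  by rewrite alphaN alphaD !alphaZ mu re -CE (Cskew j) sigE// /S; ring.
rewrite [RHS]/linear_fun -[RHS]/(alpha _)
  (@bracket_frame_expansion _ _ _ _ _ hM hA _ _ hbr c.2
    (V `&` Vt) e tau _ _ _ oVVt) //; last first.
- by move=> k q [_ Vtq]; exact: tauE.
- by move=> k q [Vq _]; exact: eE.
- by move=> q [/Vi].
rewrite alpha_sum bil_Lambda_dual// -/p.
have uE i : u (rshift m i) = S i by exact: (grad_linear_r hM hA).
have vE i : v (rshift m i) = T i by exact: (grad_linear_r hM hA).
have ulE l : u (lshift n l) = \sum_j fibre_coord (A := A) c.2 a j * dS l j.
  exact: (grad_linear_l hM hA).
have vlE l : v (lshift n l) = \sum_j fibre_coord (A := A) c.2 a j * dT l j.
  exact: (grad_linear_l hM hA).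
under eq_bigr => i _ do under eq_bigr => j _ do rewrite !uE !vE.
under [X in _ + X]eq_bigr => i _ do under eq_bigr =>
  l _ do rewrite uE vE ulE vlE.
rewrite (sum_skew (fun i j => S i * T j) Cskew).
pose F j := fibre_coord (A := A) c.2 a j.
transitivity (\sum_i \sum_j (C i j * (S i * T j)
    + (\sum_l rh i l * (S i * (F j * dT l j))
      - \sum_l rh i l * (F j * dS l j * T i)))).
  rewrite -big_split; apply: eq_bigr => i _ /=; rewrite big_split/=;
    congr (_ + _).
  under [RHS]eq_bigr => j _ do rewrite -sumrB.
  rewrite [RHS]exchange_big; apply: eq_bigr => l _ /=.
  rewrite mulr_sumr mulr_suml -sumrB mulr_sumr; apply: eq_bigr => j _.
  by rewrite -/(rh i l) -/(F j) mulrBr.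
have aE j : alpha (tau j p *: br s (e j) p + vf_apply (anchor_vf rho s)
  (tau j) p *: e j p) =
    \sum_i (C i j * (S i * T j) + \sum_l rh i l * (S i * (F j * dT l j)))
    - \sum_i \sum_l rh j l * (F i * dS l i * T j).
  rewrite alphaD !alphaZ bse rs mu tauE// -/(T j) -/(F j) mulr_sumr mulr_suml.
  rewrite -big_split -sumrB; apply: eq_bigr => i _ /=; rewrite -/(F i) mulrBr.
  rewrite [X in X - _](_ : _ = C i j * (S i * T j)); last by ring.
  rewrite addrAC; congr (_ + _ - _).
    by rewrite mulr_suml; apply: eq_bigr => l _; ring.
  by rewrite mulr_suml mulr_sumr; apply: eq_bigr => l _; ring.
under [RHS]eq_bigr => j _ do rewrite aE.
rewrite [RHS]sumrB [in RHS]exchange_big -sumrB; apply: eq_bigr => i _.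
by rewrite -sumrB; apply: eq_bigr => j _; rewrite addrA.
Qed.

Lemma Psi_compatible : compatible br rho phi (Psi A (br, rho,
  phi)).1 (Psi A (br, rho, phi)).2.
Proof.
split.
- move=> c a ca; set X := (Psi A (br, rho, phi)).1 c a.
  apply/matrixP => k l; rewrite mxE [RHS]mxE.
  (* An entry of the matrix is its value on two standard covectors, where the formula for
     [Lambda_dual] as a bilinear form applies. *)
  have dE (j i : 'I_(m + n)) : (fun i => (i == j)%:R : R) i = (i == j)%:R by [].
  rewrite -(bil_delta X (dE k) (dE l)) -(bil_delta X (dE l) (dE k)) /X /=.
  rewrite [in LHS]bilD [in RHS]bilD !bil_wedge !bil_Lambda_dual// !opprD;
    congr (_ + _ + _).
  + rewrite -sumrN; apply: eq_bigr => i _; rewrite -sumrN;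
    apply: eq_bigr => j _; ring.
  + rewrite -sumrN; apply: eq_bigr => i _; rewrite -sumrN;
    apply: eq_bigr => j _; ring.
  + by move: (dot _ _) (dot _ _) (dot _ _) (dot _ _) => *; ring.
- move=> c a s t ca; rewrite /biv_in /= bilD bil_wedge linear_fun_bracket//.
  rewrite !liouville_linear// !vertical_lift_linear// addrA.
  by rewrite (mulrC (pairing phi s _)).
- move=> c a s f ca sf; have [cp ip] := ca.
  rewrite /biv_in /= bilD bil_wedge liouville_basic// vertical_lift_basic//.
  rewrite !mulr0 subrr addr0 bil_Lambda_dual// big1 ?add0r => [|i _];
    last first.
    rewrite big1// => j _; rewrite (grad_basic_r hM i sf ca)
      (grad_basic_r hM j sf ca).
    by move: (\sum_k _) (grad _ _ _ _) (grad _ _ _ _) => *;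
      rewrite !mulr0 subrr mulr0.
  rewrite (anchor_applyE _ cp ip sf); apply: eq_bigr => i _;
    apply: eq_bigr => l _.
  rewrite (grad_basic_r hM i sf ca) (grad_basic_l hM l sf ca)
    (grad_linear_r hM hA)//.
  by rewrite mulr0 subr0; ring.
- move=> c a f g ca sf sg.
  rewrite /biv_in /= bilD bil_wedge !liouville_basic// !mul0r mulr0 subrr addr0.
  rewrite bil_Lambda_dual// !big1 ?addr0// => i _; rewrite big1// => j _.
    by rewrite (grad_basic_r hM i sf ca) (grad_basic_r hM i sg ca)
      mul0r mulr0 subrr mulr0.
  by rewrite (grad_basic_r hM i sf ca) (grad_basic_r hM j sf ca)
    !mul0r subrr mulr0.
- move=> c a s ca; rewrite -(@vertical_lift_linear c a s ca) /vf_in /dot -sumrN.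
  by apply: eq_bigr => l _; rewrite mxE mulNr.
- move=> c a f ca sf; rewrite -[RHS]oppr0 -(vertical_lift_basic sf ca)
  /vf_in /dot -sumrN.
  by apply: eq_bigr => l _; rewrite mxE mulNr.
Qed.

Lemma Psi_outside c a : ~ cdom c a ->
  (Psi A (br, rho, phi)).1 c a = 0 /\ (Psi A (br, rho, phi)).2 c a = 0.
Proof.
move=> nca; rewrite /= /Lambda_dual /liouville /vertical_lift asboolF//.
by rewrite /wedge trmx0 !mul0mx subrr addr0 oppr0.
Qed.

End PsiCompatible.

(** * Integrability *)

Section Commutator.
Context {R : realType} {d : nat} {N : charted R d}.
Hypothesis hN : is_atlas N.
Implicit Types (X Y : vfield N) (F G H : N -> R) (c : chart_idx N) (p : N).

(** The second derivatives of [F] cancel by symmetry, leaving the components of the Lie bracket. *)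
Lemma vf_apply_comm X Y F c p : is_vfield X -> is_vfield Y -> smooth_fun F ->
  cdom c p ->
  vf_apply X (vf_apply Y F) p - vf_apply Y (vf_apply X F) p =
  dot (lie_bracket X Y c p 0) (grad c F p).
Proof.
move=> vX vY sF cp; have oc := atlas_open hN c.
have half Z W : is_vfield Z -> is_vfield W -> vf_apply Z (vf_apply W F) p =
    \sum_k \sum_l (Z c p 0 k * cpartial c (fun q => W c q 0 l)
      k p * grad c F p l
      + Z c p 0 k * W c p 0 l * cpartial c (fun q => grad c F q l) k p).
  move=> vZ vW; have tW q := vfield_tangent vW q.
  rewrite (vf_applyE hN (vfield_tangent vZ p) (smooth_vf_apply hN vW sF) cp).
  apply: eq_bigr => k _; rewrite /grad.
  rewrite (cpartial_ext hN (W := cdom c) k oc cp cp (g := vf_in c W F));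
    last first.
    by move=> q cq; exact: vf_applyE.
  have sW l : smooth_fun_on (cdom c) (fun q => W c q 0 l)
    by exact: vfield_smooth.
  have sg l := smooth_grad hN (c := c) l sF.
  have sWg l := smooth_fun_onM oc (sW l) (sg l).
  rewrite (cpartial_sum _ _ (fun l _ => sWg l) cp cp) mulr_sumr.
  apply: eq_bigr => l _; rewrite (cpartialM hN _ (sW l) (sg l) cp cp)
    -/(grad c F p l).
  by move: (cpartial _ _ _ _) (cpartial _ _ _ _) (grad _ _ _ _) (Z _ _ _ _)
    (W _ _ _ _) => *; ring.
have S_sym : \sum_k \sum_l Y c p 0 k * X c p 0 l * cpartial c (fun q =>
  grad c F q l) k p =
    \sum_k \sum_l X c p 0 k * Y c p 0 l * cpartial c (fun q => grad c F q l)
      k p.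
  rewrite exchange_big; apply: eq_bigr => k _; apply: eq_bigr => l _ /=.
  by rewrite (hessian_sym hN l k sF cp) (mulrC (Y c p 0 l)).
rewrite !half//; under eq_bigr => k _ do rewrite big_split.
under [X in _ - X]eq_bigr => k _ do rewrite big_split.
rewrite !big_split /= S_sym opprD addrACA subrr addr0 exchange_big.
rewrite [X in _ - X]exchange_big -sumrB; apply: eq_bigr => l _ /=.
by rewrite -sumrB mxE mulr_suml; apply: eq_bigr => k _; rewrite mulrBl.
Qed.

Lemma vf_applyM X F G p : is_vfield X -> smooth_fun F -> smooth_fun G ->
  vf_apply X (fun q => F q * G q)
    p = F p * vf_apply X G p + G p * vf_apply X F p.
Proof. move=> vX sF sG; exact: (vf_inM hN _ sF sG (atlas_at hN p)). Qed.

Lemma vf_applyD X F G p : smooth_fun F -> smooth_fun G ->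
  vf_apply X (fun q => F q + G q) p = vf_apply X F p + vf_apply X G p.
Proof. move=> sF sG; exact: (vf_inD _ sF sG (atlas_at hN p)). Qed.

Lemma vf_apply_cst X (b : R) p : vf_apply X (fun=> b) p = 0.
Proof. exact: vf_in_cst. Qed.

Lemma vf_applyN X F p : is_vfield X -> smooth_fun F ->
  vf_apply X (fun q => - F q) p = - vf_apply X F p.
Proof.
move=> vX sF; have s1 : smooth_fun (fun _ : N => (-1 : R))
  by exact: smooth_fun_on_cst.
rewrite (_ : (fun q => - F q) = fun q => -1 * F q); last by apply/funext => q;
  rewrite mulN1r.
by rewrite (vf_applyM p vX s1 sF) vf_apply_cst mulr0 addr0 mulN1r.
Qed.

Lemma biv_inDr (L : bivfield N)
  c F G H p : smooth_fun G -> smooth_fun H -> cdom c p ->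
  biv_in c L F (fun q => G q + H q) p = biv_in c L F G p + biv_in c L F H p.
Proof.
move=> sG sH cp; rewrite /biv_in gradD// /bil -big_split;
  apply: eq_bigr => k _ /=.
by rewrite -big_split; apply: eq_bigr => l _ /=; rewrite mulrDr.
Qed.

End Commutator.

Section Integrability.
Context {R : realType} {m n : nat} {M : charted R m} {A : vbundle M n}.
Hypotheses (hM : is_manifold M) (hA : is_vbundle A).
Let hMa : is_atlas M := manifold_atlas hM.
Local Notation Astar := (total_space (dual A)).
Let hN : is_atlas Astar := dual_atlas hM hA.
Implicit Types (s t u : section A) (a : Astar) (c : chart_idx Astar)
  (f g : M -> R).

(** Used to turn identities between linear functions on the dual bundle into identities between
    sections. *)
Lemma dual_separates p (v : A p) :
  (forall alpha : 'Hom(A p, R^o), alpha v = 0) -> v = 0.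
Proof.
move=> v0; have ip := triv_at_dom hA p.
apply: (triv_inj hA ip); rewrite (triv0 hA ip); apply/rowP => j; rewrite !mxE.
rewrite -(v0 (untriv (v := dual A) (triv_at A p) p (delta_mx 0 j))).
rewrite (dual_untrivE hA _ _ ip) (bigD1 j)//= mxE !eqxx mul1r big1 ?addr0//
  => k kj.
by rewrite mxE (negbTE kj) andbF mul0r.
Qed.

Lemma linear_fun_inj p (s t : section A) :
  (forall alpha : 'Hom(A p, R^o), linear_fun s (existT _ p alpha : Astar) =
     linear_fun t (existT _ p alpha : Astar)) -> s p = t p.
Proof.
move=> st; apply/eqP; rewrite -subr_eq0; apply/eqP;
  apply: dual_separates => alpha.
by rewrite linearB; apply/eqP; rewrite subr_eq0; apply/eqP; exact: st.
Qed.

Variables (br : @bracket_type _ _ _ _ A) (rho : @anchor_type _ _ _ _ A).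
Arguments rho : clear implicits.
Variables (phi : section (dual A)) (L : bivfield Astar) (E : vfield Astar).
Hypotheses (hrho : is_anchor rho) (hc : compatible br rho phi L E).

Let sl s : smooth_fun (linear_fun s) := smooth_linear_fun hM hA s.
Let sb f (sf : smooth_fun f) : smooth_fun (basic_fun f : Astar -> R) :=
  smooth_basic_fun hM hA sf.
Let vr s : is_vfield (anchor_vf rho s) := anchor_vfield hM hA hrho s.
Let sr s f (sf : smooth_fun f) : smooth_fun (vf_apply (anchor_vf rho s) f) :=
  smooth_anchor_apply hM hA hrho s sf.
Let sp s : smooth_fun (pairing phi s) := smooth_pairing hM hA phi s.

(* The representation of the sections on functions given by the cocycle. *)
Definition twisted s f : M -> R := fun p =>
  vf_apply (anchor_vf rho s) f p + f p * pairing phi s p.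

Lemma smooth_twisted s f : smooth_fun f -> smooth_fun (twisted s f).
Proof.
move=> sf; have oT := mopenT hMa.
apply: smooth_fun_onD => //; first exact: sr.
by apply: smooth_fun_onM => //; exact: sp.
Qed.

Lemma jacobi_bracket_linlin s t :
  jacobi_bracket L E (linear_fun s) (linear_fun t) = linear_fun (br s t).
Proof.
apply/funext => a; have ca := atlas_at hN a.
rewrite /jacobi_bracket -[biv_apply _ _ _ _]/(biv_in (chart_at a) _ _ _ _).
rewrite -![vf_apply _ _ _]/(vf_in (chart_at a) _ _ _).
by rewrite (compat_linlin hc s t ca) !(compat_lin hc _ ca); ring.
Qed.

Lemma jacobi_bracket_linbas s f : smooth_fun f ->
  jacobi_bracket L E (linear_fun s) (basic_fun f) = basic_fun (twisted s f).
Proof.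
move=> sf; apply/funext => a; have ca := atlas_at hN a.
rewrite /jacobi_bracket -[biv_apply _ _ _ _]/(biv_in (chart_at a) _ _ _ _).
rewrite -![vf_apply _ _ _]/(vf_in (chart_at a) _ _ _).
rewrite (compat_linbas hc s ca sf) (compat_lin hc s ca) (compat_bas hc ca sf).
by rewrite mulr0 addr0 mulrN opprK.
Qed.

Lemma jacobi_bracket_baslin s f : smooth_fun f ->
  jacobi_bracket L E (basic_fun f) (linear_fun s) = basic_fun (fun p =>
    - twisted s f p).
Proof.
move=> sf; apply/funext => a; have ca := atlas_at hN a.
rewrite /jacobi_bracket -[biv_apply _ _ _ _]/(biv_in (chart_at a) _ _ _ _).
rewrite -![vf_apply _ _ _]/(vf_in (chart_at a) _ _ _).
rewrite (compat_baslin hc s ca sf) (compat_lin hc s ca) (compat_bas hc ca sf).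
by rewrite mulr0 subr0 mulrN -opprD.
Qed.

Lemma jacobi_bracket_basbas f g : smooth_fun f -> smooth_fun g ->
  jacobi_bracket L E (basic_fun f) (basic_fun g) = basic_fun (fun=> 0).
Proof.
move=> sf sg; apply/funext => a; have ca := atlas_at hN a.
rewrite /jacobi_bracket -[biv_apply _ _ _ _]/(biv_in (chart_at a) _ _ _ _).
rewrite -![vf_apply _ _ _]/(vf_in (chart_at a) _ _ _).
by rewrite (compat_basbas hc ca sf sg) !(compat_bas hc ca)// !mulr0 addr0 subrr.
Qed.

Lemma twistedN s f p : smooth_fun f -> twisted s (fun q => - f q)
  p = - twisted s f p.
Proof. by move=> sf; rewrite /twisted (vf_applyN hMa p (vr s) sf) mulNr opprD.
Qed.

Lemma twisted0 s p : twisted s (fun=> 0) p = 0.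
Proof. by rewrite /twisted vf_apply_cst mul0r addr0. Qed.

Lemma jacobiator_linlinlin s t u a :
  jacobiator L E (linear_fun s) (linear_fun t) (linear_fun u) a =
  linear_fun (br s (br t u)) a + linear_fun (br t (br u s))
    a + linear_fun (br u (br s t)) a.
Proof. by rewrite /jacobiator !jacobi_bracket_linlin. Qed.

(** One expression carries two conditions: the first part is the defect of the anchor as a morphism,
    the coefficient of [f] is the defect of the cocycle identity. *)
Lemma jacobiator_linlinbas s t f a : smooth_fun f -> let p := projT1 a in
  jacobiator L E (linear_fun s) (linear_fun t) (basic_fun f) a =
  (vf_apply (anchor_vf rho s) (vf_apply (anchor_vf rho t) f) p
   - vf_apply (anchor_vf rho t) (vf_apply (anchor_vf rho s) f) p
   - vf_apply (anchor_vf rho (br s t)) f p)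
  + f p * (vf_apply (anchor_vf rho s) (pairing phi t) p
   - vf_apply (anchor_vf rho t) (pairing phi s) p - pairing phi (br s t) p).
Proof.
move=> sf p; have st v := smooth_twisted v sf; have oT := mopenT hMa.
have stN v : smooth_fun (fun q => - twisted v f q).
  by apply: (smooth_fun_onN hMa) => //; exact: st.
rewrite /jacobiator jacobi_bracket_linlin (jacobi_bracket_linbas t sf).
rewrite (jacobi_bracket_baslin s sf) (jacobi_bracket_baslin (br s t) sf).
rewrite (jacobi_bracket_linbas s (st t)) (jacobi_bracket_linbas t (stN s)).
rewrite /basic_fun -/p twistedN// /twisted.
have sfp v : smooth_fun (fun q => f q * pairing phi v q).
  by apply: smooth_fun_onM => //; exact: sp.
rewrite !(vf_applyD hMa)//; try exact: sr.
rewrite (vf_applyM hMa p (vr s) sf (sp t)) (vf_applyM hMa p (vr t) sf (sp s)).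
move: (f _) (vf_apply _ _ _) (vf_apply _ _ _) (vf_apply _ _ _) (vf_apply _ _ _)
  (vf_apply _ _ _) (vf_apply _ _ _) (vf_apply _ _ _) (pairing _ _ _)
    (pairing _ _ _)
  (pairing _ _ _) => *; ring.
Qed.

Lemma jacobiator_linbasbas s f g a : smooth_fun f -> smooth_fun g ->
  jacobiator L E (linear_fun s) (basic_fun f) (basic_fun g) a = 0.
Proof.
move=> sf sg; have oT := mopenT hMa.
have s0 : smooth_fun (fun _ : M => (0 : R)) by exact: smooth_fun_on_cst.
have sf' := smooth_twisted s sf; have sg' := smooth_twisted s sg.
have sgN : smooth_fun (fun q => - twisted s g q).
  by apply: (smooth_fun_onN hMa).
rewrite /jacobiator (jacobi_bracket_basbas sf sg) (jacobi_bracket_baslin s sg).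
rewrite (jacobi_bracket_linbas s sf) (jacobi_bracket_linbas s s0).
rewrite (jacobi_bracket_basbas sf)// (jacobi_bracket_basbas sg sf').
by rewrite /basic_fun twisted0 !addr0.
Qed.

Lemma jacobiator_basbasbas f g h a : smooth_fun f -> smooth_fun g -> smooth_fun
  h ->
  jacobiator L E (basic_fun f) (basic_fun g) (basic_fun h) a = 0.
Proof.
move=> sf sg sh; have s0 : smooth_fun (fun _ : M => (0 : R))
  by exact: smooth_fun_on_cst.
rewrite /jacobiator (jacobi_bracket_basbas sf sg) (jacobi_bracket_basbas sg sh).
rewrite (jacobi_bracket_basbas sh sf) !jacobi_bracket_basbas//.
by rewrite /basic_fun !addr0.
Qed.

Lemma jacobiator_cycle F G H a : jacobiator L E F G H a = jacobiator L E G H F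
  a.
Proof. by rewrite /jacobiator -addrA addrC. Qed.

Lemma anchor_commutator s t f p : is_lie_algebroid br rho -> smooth_fun f ->
  vf_apply (anchor_vf rho s) (vf_apply (anchor_vf rho t) f) p
   - vf_apply (anchor_vf rho t) (vf_apply (anchor_vf rho s) f) p
   - vf_apply (anchor_vf rho (br s t)) f p = 0.
Proof.
move=> hbr sf; have cp := atlas_at hMa p.
rewrite (vf_apply_comm hMa (vr s) (vr t) sf cp) -(anchor_morphism hbr s t cp).
by rewrite (vf_applyE hMa (vfield_tangent (vr _) p) sf cp) subrr.
Qed.

Definition linear_or_basic (F : Astar -> R) : Prop :=
  (exists s, F = linear_fun s) \/ (exists2 f, smooth_fun f & F = basic_fun f).

Lemma algebroid_jacobiator F G H a :
  is_lie_algebroid br rho -> is_cocycle br rho phi ->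
  linear_or_basic F -> linear_or_basic G -> linear_or_basic H ->
  jacobiator L E F G H a = 0.
Proof.
move=> hbr hphi.
have llb s t f : smooth_fun f ->
    jacobiator L E (linear_fun s) (linear_fun t) (basic_fun f) a = 0.
  move=> sf; rewrite jacobiator_linlinbas// anchor_commutator// add0r.
  by rewrite [pairing _ _ _]hphi subrr mulr0.
case=> [[s ->]|[f sf ->]] [[t ->]|[g sg ->]] [[u ->]|[h sh ->]].
- rewrite jacobiator_linlinlin /linear_fun -!linearD.
  by rewrite (bracket_jacobi hbr) linear0.
- exact: llb.
- by rewrite jacobiator_cycle jacobiator_cycle llb.
- exact: jacobiator_linbasbas.
- by rewrite jacobiator_cycle llb.
- by rewrite jacobiator_cycle jacobiator_linbasbas.
- by rewrite jacobiator_cycle jacobiator_cycle jacobiator_linbasbas.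
- exact: jacobiator_basbasbas.
Qed.

Lemma algebroid_jacobi : is_bivfield L -> is_vfield E ->
  is_lie_algebroid br rho -> is_cocycle br rho phi -> is_jacobi L E.
Proof.
move=> bL vE hbr hphi.
suff loc c a : cdom c a ->
    (forall i j k, schouten_LL L c a i j k = 2 * wedge_EL E L c a i j k) /\
    (forall i j, schouten_EL E L c a i j = 0).
  by split => // c a ca; have [] := loc c a ca.
move=> ca; have [cp ip] := ca.
have [s [f [V [[oV Vp Vc] sf fE sE]]]] := local_coordinates hM hA cp ip.
have gT := grad_test_fun hM hA oV Vp Vc fE sE.
have lbT k : linear_or_basic (test_fun s f k).
  rewrite /test_fun; case: (fintype.split k) => j; last by left; exists (s j).
  by right; exists (f j).
(* The constant [1] is basic, so the Jacobiators that detect [[E, L]] are covered as well. *)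
have lb1 : linear_or_basic (fun=> 1).
  by right; exists (fun=> 1) => //; exact: smooth_fun_on_cst.
apply: (jacobiator_jacobi hN bL vE ca (fun k => smooth_test_fun hM hA s k sf)
  gT).
  by move=> i j k; exact: algebroid_jacobiator.
by move=> i j; exact: algebroid_jacobiator.
Qed.

(** For [f = 1] the anchor terms of the Jacobiator vanish and the cocycle defect remains; it is
    basic, so it can be evaluated at the zero covector. *)
Lemma jacobi_cocycle : is_jacobi L E -> is_cocycle br rho phi.
Proof.
move=> hJ s t p; have s1 : smooth_fun (fun _ : M => (1 : R))
  by exact: smooth_fun_on_cst.
pose a : Astar := existT (fun q : M => dual A q) p (0 : 'Hom(A p, R^o)).
have := jacobi_jacobiator hN (jacobi_bivfield hJ) (jacobi_vfield hJ)
  a hJ (sl s) (sl t) (sb s1).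
rewrite jacobiator_linlinbas// !vf_apply_cst.
rewrite (_ : vf_apply (anchor_vf rho t) (fun=> 1) = fun=> 0); last first.
  by apply/funext => q; rewrite vf_apply_cst.
rewrite (_ : vf_apply (anchor_vf rho s) (fun=> 1) = fun=> 0); last first.
  by apply/funext => q; rewrite vf_apply_cst.
rewrite !vf_apply_cst !subrr add0r mul1r => /eqP.
by rewrite subr_eq0 => /eqP/esym.
Qed.

Lemma jacobi_commutator s t f p : is_jacobi L E -> smooth_fun f ->
  vf_apply (anchor_vf rho s) (vf_apply (anchor_vf rho t) f) p
   - vf_apply (anchor_vf rho t) (vf_apply (anchor_vf rho s) f) p
  = vf_apply (anchor_vf rho (br s t)) f p.
Proof.
move=> hJ sf; pose a : Astar := existT (fun q : M => dual A q)
  p (0 : 'Hom(A p, R^o)).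
have := jacobi_jacobiator hN (jacobi_bivfield hJ) (jacobi_vfield hJ)
  a hJ (sl s) (sl t) (sb sf).
rewrite jacobiator_linlinbas// -[pairing phi (br s t) _]/(phi p (br s t p)).
rewrite (jacobi_cocycle hJ) subrr mulr0 addr0.
by move/eqP; rewrite subr_eq0 => /eqP.
Qed.

(** [L] is a derivation in its second argument, and the terms with [phi], being linear over
    functions in [u], cancel. The two-term form yields linearity for constant coefficients and the
    Leibniz rule for [g = 0]. *)
Lemma compatible_leibniz s t t' u f g p : smooth_fun f -> smooth_fun g ->
  (forall q, u q = f q *: t q + g q *: t' q) ->
  br s u p = (f p *: br s t p + vf_apply (anchor_vf rho s) f p *: t p)
    + (g p *: br s t' p + vf_apply (anchor_vf rho s) g p *: t' p).
Proof.
move=> sf sg uE; apply/eqP; rewrite -subr_eq0; apply/eqP;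
  apply: dual_separates => alpha.
pose a : Astar := existT _ p alpha; have ca := atlas_at hN a;
  set c := chart_at a in ca.
have luE : linear_fun u = (fun b : Astar => basic_fun f b * linear_fun t b
    + basic_fun g b * linear_fun t' b).
  by apply/funext => b; rewrite /linear_fun uE linearD !linearZ.
have puE : pairing phi u p = f p * pairing phi t p + g p * pairing phi t' p.
  by rewrite /pairing uE linearD !linearZ.
have oT := mopenT hN.
have sbl h v : smooth_fun h -> smooth_fun (fun b : Astar =>
  basic_fun h b * linear_fun v b).
  by move=> sh; apply: smooth_fun_onM => //; [exact: (sb sh)|exact: sl].
have := compat_linlin hc s u ca;
  rewrite luE (biv_inDr _ _ (sbl f t sf) (sbl g t' sg) ca).
rewrite (biv_inMr hN _ _ (sb sf) (sl t) ca) (biv_inMr hN _ _ (sb sg) (sl t')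
  ca).
rewrite !(compat_linlin hc _ _ ca) !(compat_linbas hc _ ca)// puE.
pose al (w : A p) : R := alpha w.
have alD w w' : al (w + w') = al w + al w' by rewrite /al linearD.
have alN w : al (- w) = - al w by rewrite /al linearN.
have alZ (b : R) w : al (b *: w) = b * al w by rewrite /al linearZ.
rewrite -[alpha _]/(al _) !(alD, alN, alZ) /basic_fun /= => h.
have lE v : linear_fun v a = al (v p) by [].
move: h; rewrite !lE.
move: (al _) (al _) (al _) (al _) (al _) (al _) (pairing _ _ _) (pairing _ _ _)
  (pairing _ _ _) (vf_apply _ _ _) (vf_apply _ _ _) (f p) (g p).
move=> a1 a2 a3 a4 a5 a6 p1 p2 p3 v1 v2 fp gp h.
by move/eqP: h; rewrite -subr_eq0 => /eqP h; rewrite -[RHS]oppr0 -h; ring.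
Qed.

Lemma compatible_bracket_skew s t p : br s t p = - br t s p.
Proof.
apply/eqP; rewrite -addr_eq0; apply/eqP; apply: dual_separates => alpha.
pose a : Astar := existT _ p alpha; have ca := atlas_at hN a.
have h1 := compat_linlin hc s t ca; have h2 := compat_linlin hc t s ca.
have h3 := biv_in_skew (linear_fun s) (linear_fun t) (compat_skew hc ca).
have -> : alpha (br s t p + br t s p) = linear_fun (br s t)
  a + linear_fun (br t s) a.
  by rewrite linearD.
move: h3; rewrite h1 h2.
move: (linear_fun (br s t) a) (linear_fun (br t s) a) (linear_fun s a)
  (linear_fun t a)
  (pairing _ _ _) (pairing _ _ _) => x y z w v u' h.
by move/eqP: h; rewrite -subr_eq0 => /eqP h; rewrite -[RHS]h; ring.
Qed.

Lemma jacobi_algebroid : is_jacobi L E -> is_lie_algebroid br rho.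
Proof.
move=> hJ; have cst (b : R) : smooth_fun (fun _ : M => b)
  by exact: smooth_fun_on_cst.
split => //.
- move=> b s t u w uE p.
  have uE' q : u q = b *: s q + 1 *: t q by rewrite uE scale1r.
  rewrite !(compatible_bracket_skew _ w) (compatible_leibniz w p (cst b)
    (cst 1) uE').
  by rewrite !vf_apply_cst !scale0r !addr0 scale1r opprD scalerN.
- exact: compatible_bracket_skew.
- move=> s t u p; apply: dual_separates => alpha.
  pose a : Astar := existT _ p alpha.
  have := jacobi_jacobiator hN (jacobi_bivfield hJ) (jacobi_vfield hJ)
    a hJ (sl s) (sl t) (sl u).
  by rewrite jacobiator_linlinlin => h; rewrite !linearD; exact: h.
- move=> s t c p cp; apply/rowP => l.
  (* Component [l] of a vector field is its value on a global function with the germ of coordinate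
     [l]. *)
  have [g [V [sg oV Vp Vc gE]]] := smooth_coord_germ hM l cp.
  have gg k : grad c g p k = (k == l)%:R.
    by rewrite -(cpartial_coord hMa l k cp);
      apply: (cpartial_ext hMa k oV Vp cp).
  rewrite -(dot_delta _ gg) -(dot_delta (lie_bracket _ _ _ _ _) gg).
  rewrite -(vf_apply_comm hMa (vr s) (vr t) sg cp)
    (jacobi_commutator s t p hJ sg).
  by rewrite (vf_applyE hMa (vfield_tangent (vr _) p) sg cp).
- move=> f s t u sf uE p.
  have uE' q : u q = f q *: t q + 0 *: t q by rewrite uE scale0r addr0.
  rewrite (compatible_leibniz s p sf (cst 0) uE').
  by rewrite vf_apply_cst !scale0r !addr0.
Qed.

End Integrability.

(** * Reconstruction of the Lie algebroid and the cocycle *)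

Section Reconstruction.
Context {R : realType} {m n : nat} {M : charted R m} {A : vbundle M n}.
Hypotheses (hM : is_manifold M) (hA : is_vbundle A) (hn : (0 < n)%N).
Let hMa : is_atlas M := manifold_atlas hM.
Local Notation Astar := (total_space (dual A)).
Let hN : is_atlas Astar := dual_atlas hM hA.
Implicit Types (s t u w : section A) (a b : Astar) (c : chart_idx Astar)
  (f g : M -> R).

Definition zero_covector (p : M) : Astar :=
  existT (fun q : M => dual A q) p (0 : 'Hom(A p, R^o)).

Lemma linear_fun_zero s p : linear_fun s (zero_covector p) = 0.
Proof. by rewrite /linear_fun /= zero_lfunE. Qed.

(* At a point [a], [F] is the fibre coordinate [mu_j] and
   [g a + mu_j (dg/dmu_j) a = (d(g F)/dmu_j) a], which also covers the points
   where [mu_j] vanishes. *)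
Lemma fibre_derivative (g : Astar -> R) a : smooth_fun g ->
  exists s (V : set M) (dg : R) (j : 'I_n) (i : triv_idx A),
    [/\ mopen M V, V (projT1 a), V `<=` tdom i,
        forall q, V q -> s q = frame i j q &
        forall G : Astar -> R, (forall b, g b * linear_fun s b = G b) ->
          g a + linear_fun s a * dg = grad (chart_at a) G a (rshift m j)].
Proof.
move=> sg; have ca := atlas_at hN a; set c := chart_at a in ca *;
  have [cp ip] := ca.
pose j := Ordinal hn; have [s [V [oV Vp Vi sE]]] := section_frame_exists hM hA
  j ip.
exists s, V, (grad c g a (rshift m j)), j, (c.2 : triv_idx A); split => // G GE.
have -> : G = fun b => g b * linear_fun s b by apply/funext => b; rewrite GE.
rewrite (gradM hN sg (smooth_linear_fun hM hA s) ca) (grad_linear_r hM hA)//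
  sE//.
by rewrite (triv_frame hA _ _ ip) eqxx mulr1.
Qed.

(** The product is constant along the fibres and zero on the zero section, hence zero. Where the
    fibre coordinate is nonzero, [g] vanishes by division; where it is zero, the fibre derivative of
    the product equals [g]. *)
Lemma fibre_constant_eq0 (g : Astar -> R) : smooth_fun g ->
  (forall s, exists h : M -> R, forall a, g a * linear_fun s a = h (projT1 a))
    ->
  forall a, g a = 0.
Proof.
move=> sg gh a; have [s [V [dg [j [i [oV Vp Vi sE dE]]]]]] := fibre_derivative
  a sg.
have [h hE] := gh s.
have g0 b : g b * linear_fun s b = 0.
  rewrite hE -[projT1 b]/(projT1 (zero_covector (projT1 b))) -hE.
  by rewrite linear_fun_zero mulr0.
have := dE (fun=> 0) g0; rewrite grad_cst.
have /eqP := g0 a; rewrite mulf_eq0 => /orP[/eqP//|/eqP->].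
by rewrite mul0r addr0.
Qed.

(** Take [t] to be a frame section near the base point, so that [linear_fun t] is [mu_j]. Evaluating
    [g mu_j = linear_fun w] at the dual basis covectors other than the one for [j] kills the other
    components of [w], and [g mu_j = w_j mu_j] gives [g = w_j], which depends on the base point
    only. *)
Lemma fibre_linear_basic (g : Astar -> R) : smooth_fun g ->
  (forall t, exists w, forall a, g a * linear_fun t a = linear_fun w a) ->
  smooth_fun (fun p => g (zero_covector p)) /\
  forall a, g a = g (zero_covector (projT1 a)).
Proof.
move=> sg gw.
have loc a : exists (i : triv_idx A) (j : 'I_n) w (V : set M), [/\ mopen M V,
  V (projT1 a), V `<=` tdom i &
    forall b, V (projT1 b) -> g b = triv i (w (projT1 b)) 0 j].
  have ip := triv_at_dom hA (projT1 a); pose j := Ordinal hn.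
  have [s [V [oV Vp Vi sE]]] := section_frame_exists hM hA j ip.
  have [w wE] := gw s; exists (triv_at A (projT1 a)), j, w, V; split => // b Vb.
  set i := triv_at A (projT1 a) in Vi sE *; have ib := Vi _ Vb.
  have sfib b' : V (projT1 b') -> linear_fun s b' = fibre_coord i b' j.
    by move=> Vb'; rewrite /linear_fun sE// /fibre_coord mxE.
  have w0 k : k != j -> triv i (w (projT1 b)) 0 k = 0.
    move=> kj; pose b' : Astar := existT (fun q : M => dual A q) (projT1 b)
      (untriv (v := dual A) i (projT1 b) (delta_mx 0 k)).
    have fb' l : fibre_coord i b' l = (l == k)%:R.
      rewrite /fibre_coord /b' [projT2 _]/=.
      by rewrite (untrivK (dual_vbundle hM hA) ib) mxE eqxx.
    have := wE b'; rewrite sfib// fb' eq_sym (negbTE kj) mulr0.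
    rewrite (@linear_funE _ _ _ _ _ hA i w b' ib) (bigD1 k)//= fb' eqxx mul1r.
    rewrite big1 ?addr0 => [<-//|l lk]; by rewrite fb' (negbTE lk) mul0r.
  have wb : linear_fun w b = fibre_coord i b j * triv i (w (projT1 b)) 0 j.
    by rewrite (linear_funE hA w ib) (bigD1 j)//= big1 ?addr0// => k /w0 ->;
      rewrite mulr0.
  have gb := wE b; rewrite wb sfib// in gb.
  have cb : cdom ((chart_at (projT1 b), i) : chart_idx Astar) b by split =>
    //; exact: (atlas_at hMa).
  have := grad_linear_r hM hA w j cb.
  have <- : (fun b => g b * linear_fun s b) = linear_fun w by apply/funext.
  rewrite (gradM hN sg (smooth_linear_fun hM hA s) cb) (grad_linear_r hM hA)//
    sE//=.
  rewrite (triv_frame hA _ _ ib) eqxx mulr1 sfib//.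
  (* Where [mu_j = 0], the identity differentiated along [mu_j] already reads [g = w_j]; elsewhere
     one divides. *)
  have [->|fj0] := eqVneq (fibre_coord i b j) 0; first by rewrite mul0r addr0.
  by move=> _; apply: (mulIf fj0); rewrite gb mulrC.
split=> [|a].
  apply: smooth_fun_on_local => p _.
  have [i [j [w [V [oV Vp Vi gE]]]]] := loc (zero_covector p).
  exists V => //; apply: (smooth_fun_on_ext hMa (f := fun q => triv i (w q)
    0 j)) => //.
    by move=> q Vq; rewrite gE.
  by apply: smooth_fun_on_sub (@smooth_component _ _ _ _ _ i j w).
have [i [j [w [V [oV Vp Vi gE]]]]] := loc a.
by rewrite gE// [RHS]gE.
Qed.

Variables (L : bivfield Astar) (E : vfield Astar).
Hypothesis hJ : is_jacobi L E.
Hypothesis C1 : forall s t, exists u,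
  jacobi_bracket L E (linear_fun s) (linear_fun t) = linear_fun u.
Hypothesis C2 : forall s, exists f, smooth_fun f /\
  jacobi_bracket L E (linear_fun s) (fun=> 1) = basic_fun f.

Let bL : is_bivfield L := jacobi_bivfield hJ.
Let vE : is_vfield E := jacobi_vfield hJ.
Let sl s : smooth_fun (linear_fun s) := smooth_linear_fun hM hA s.
Let sb f (sf : smooth_fun f) : smooth_fun (basic_fun f : Astar -> R) :=
  smooth_basic_fun hM hA sf.

Lemma linear_fun_scale f s u : (forall q, u q = f q *: s q) ->
  linear_fun u = (fun a : Astar => basic_fun f a * linear_fun s a).
Proof. by move=> uE; apply/funext => a; rewrite /linear_fun uE linearZ. Qed.

Lemma E_linear_basic s : exists2 f, smooth_fun f &
  forall a, vf_apply E (linear_fun s) a = - f (projT1 a).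
Proof.
have [f [sf fE]] := C2 s; exists f => // a; have := congr1 (fun F => F a) fE.
rewrite /jacobi_bracket -[biv_apply _ _ _ _]/(biv_in (chart_at a) _ _ _ _)
  biv_in_cstr.
by rewrite vf_apply_cst mulr0 !add0r mul1r /basic_fun => <-; rewrite opprK.
Qed.

(** By the product rule for [E] on [linear_fun] of [f s], the product of [E (basic_fun f)] and
    [linear_fun s] is a combination of functions that (C2) makes basic. *)
Lemma E_basic f a : smooth_fun f -> vf_apply E (basic_fun f) a = 0.
Proof.
move=> sf; apply: fibre_constant_eq0 a;
  first exact: (smooth_vf_apply hN vE (sb sf)).
move=> s; have [u uE] := section_scale_exists hM hA s sf.
have [h _ hE] := E_linear_basic s; have [h' _ h'E] := E_linear_basic u.
exists (fun p => - h' p + f p * h p) => a.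
have := h'E a; rewrite (linear_fun_scale uE) (vf_applyM hN a vE (sb sf)
  (sl s)) hE => <-.
by rewrite /basic_fun; move: (vf_apply _ _ _) (linear_fun _ _) (f _) (h _) =>
  *; ring.
Qed.

(** As [E] kills basic functions, the bracket of [linear_fun s] with [linear_fun] of [f t], minus
    [f] times that with [linear_fun t], is [q] times [linear_fun t]; (C1) makes it linear. *)
Lemma biv_linear_basic s f : smooth_fun f ->
  let q := biv_apply L (linear_fun s) (basic_fun f) in
  smooth_fun (fun p => q (zero_covector p)) /\ forall a,
    q a = q (zero_covector (projT1 a)).
Proof.
move=> sf q; apply: fibre_linear_basic;
  first exact: (smooth_biv_apply hN bL (sl s) (sb sf)).
move=> t; have [u uE] := section_scale_exists hM hA t sf.
have [w1 w1E] := C1 s u; have [w2 w2E] := C1 s t.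
have s1 : smooth_fun (fun _ : M => (1 : R)) by exact: smooth_fun_on_cst.
have sNf : smooth_fun (fun p => - f p) by apply: (smooth_fun_onN hMa) => //;
  exact: mopenT.
have [w wE] := section_comb_exists hM hA w1 w2 s1 sNf.
exists w => a; have ca := atlas_at hN a.
have -> : linear_fun w a = linear_fun w1 a - f (projT1 a) * linear_fun w2 a.
  by rewrite /linear_fun wE scale1r scaleNr linearB linearZ.
rewrite -w1E -w2E /jacobi_bracket (linear_fun_scale uE).
rewrite (vf_applyM hN a vE (sb sf) (sl t)) E_basic//.
have -> : biv_apply L (linear_fun s) (fun b => basic_fun f b * linear_fun t b)
  a =
    basic_fun f a * biv_apply L (linear_fun s) (linear_fun t)
      a + linear_fun t a * q a.
  exact: (biv_inMr hN _ _ (sb sf) (sl t) ca).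
rewrite /basic_fun; move: (biv_apply _ _ _ _) (q a) (vf_apply _ _ _)
  (vf_apply _ _ _) => *.
by ring.
Qed.

(** Replacing [s] by [f s] in [L (linear_fun s, basic_fun g)], which is always basic, makes the
    product of [L (basic_fun f, basic_fun g)] and [linear_fun s] basic. *)
Lemma biv_basic_basic f g a : smooth_fun f -> smooth_fun g ->
  biv_apply L (basic_fun f) (basic_fun g) a = 0.
Proof.
move=> sf sg; apply: fibre_constant_eq0 a;
  first exact: (smooth_biv_apply hN bL (sb sf) (sb sg)).
move=> s; have [u uE] := section_scale_exists hM hA s sf.
have [_ h1] := biv_linear_basic s sg; have [_ h2] := biv_linear_basic u sg.
exists (fun p => biv_apply L (linear_fun u) (basic_fun g) (zero_covector p)
  - f p * biv_apply L (linear_fun s) (basic_fun g) (zero_covector p)) => a.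
rewrite -h2 -h1; have ca := atlas_at hN a; have Ls := bivfield_skew bL ca.
have skew F G : biv_apply L F G a = - biv_apply L G F a by exact: biv_in_skew.
rewrite [in RHS](skew (linear_fun u)) (linear_fun_scale uE).
have -> : biv_apply L (basic_fun g) (fun b => basic_fun f b * linear_fun s b)
  a =
   basic_fun f a * biv_apply L (basic_fun g) (linear_fun s) a
   + linear_fun s a * biv_apply L (basic_fun g) (basic_fun f) a.
  exact: (biv_inMr hN _ _ (sb sf) (sl s) ca).
rewrite (skew (basic_fun g)) (skew (basic_fun g) (basic_fun f)) /basic_fun.
by move: (biv_apply _ _ _ _) (biv_apply _ _ _ _) => *; ring.
Qed.

(* In the chart [(c, i)] the component of [L] on dmu_j and dx^l is constant
  along
   the fibres, so it can be read off on the zero section. *)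
Definition recon_anchor : @anchor_type _ _ _ _ A := fun p v (c : chart_idx M) =>
  \row_l \sum_j triv (triv_at A p) v 0 j
     * L ((c, triv_at A p) : chart_idx Astar) (zero_covector p) (rshift m j)
       (lshift n l).

(** On the zero section the [x]-derivatives of a linear function vanish, and a basic function has no
    [mu]-derivatives, so only the mixed block of [L] contributes. *)
Lemma recon_anchorE s f p (c : chart_idx M) : smooth_fun f -> cdom c p ->
  dot (recon_anchor (s p) c 0) (grad c f p) =
  biv_apply L (linear_fun s) (basic_fun f) (zero_covector p).
Proof.
move=> sf cp; set i := triv_at A p; have ip : tdom i p := triv_at_dom hA p.
have ca : cdom ((c, i) : chart_idx Astar) (zero_covector p) by [].
rewrite (biv_applyE hN bL (sl s) (sb sf) ca) /biv_in /bil big_split_ord /=.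
rewrite [X in _ = X + _]big1 ?add0r => [|k _]; last first.
  rewrite big1// => l _; rewrite (grad_linear_l hM hA)// big1 ?mulr0 ?mul0r//
    => j _.
  by rewrite /fibre_coord mxE zero_lfunE mul0r.
rewrite /dot; under [LHS]eq_bigr => l _ do rewrite mxE mulr_suml.
rewrite exchange_big; apply: eq_bigr => j _;
  rewrite big_split_ord /= [X in _ = _ + X]big1 => [|k _].
  rewrite addr0; apply: eq_bigr => l _;
    rewrite (grad_linear_r hM hA)// (grad_basic_l hM l sf ca).
  by rewrite /grad /=; ring.
by rewrite (grad_basic_r hM k sf ca) mulr0.
Qed.

Lemma recon_anchor_is_anchor : is_anchor recon_anchor.
Proof.
(* The components of the anchor become values of [L] on a linear and a basic function, whose chart
   independence and smoothness are known. *)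
have testE s (c : chart_idx M) l p : cdom c p -> exists (g : M -> R)
  (V : set M),
    [/\ smooth_fun g, mopen M V, V p, V `<=` cdom c &
      (forall q, V q -> g q = coords c q 0 l) /\
      (forall q, V q -> recon_anchor (s q) c 0 l =
        biv_apply L (linear_fun s) (basic_fun g) (zero_covector q))].
  move=> cp; have [g [V [sg oV Vp Vc gE]]] := smooth_coord_germ hM l cp.
  exists g, V; split => //; split => // q Vq; have cq := Vc _ Vq.
  rewrite -(recon_anchorE s sg cq) (dot_delta _ (k := l))// => k.
  by rewrite -(cpartial_coord hMa l k cq); apply: (cpartial_ext hMa k oV Vq cq).
split.
- move=> p v; split => [c ncp|c c' cp c'p].
    apply/rowP => l; rewrite !mxE big1// => j _.
    by rewrite (bivfield_out bL) ?mxE ?mulr0// => -[].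
  have [s sE] := section_value_exists hM hA v; apply/rowP => l.
  have [g [V [sg oV Vp Vc [gE aE]]]] := testE s c' l p c'p.
  rewrite -sE aE// -(recon_anchorE s sg cp) [RHS]mxE; apply: eq_bigr => k _.
  congr (_ * _); rewrite mxE; exact: (cpartial_ext hMa k oV Vp cp).
- move=> p x u v c; apply/rowP => l; rewrite !mxE mulr_sumr -big_split.
  apply: eq_bigr => j _ /=; rewrite (triv_linear hA (triv_at_dom hA p)) !mxE;
    ring.
- move=> i c j l; apply: smooth_fun_on_local => p [ip cp].
  have [s [V [oV Vp Vi sE]]] := section_frame_exists hM hA j ip.
  have [g [V' [sg oV' V'p V'c [gE aE]]]] := testE s c l p cp.
  exists (V `&` V') => //; apply: (smooth_fun_on_ext hMa (f := fun q =>
    biv_apply L (linear_fun s) (basic_fun g) (zero_covector q))).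
  + exact: mopenI.
  + by move=> q [Vq V'q]; rewrite -aE// sE.
  + by apply: smooth_fun_sub; case: (biv_linear_basic s sg).
Qed.

(** Since [E] should be minus the vertical lift, the covector is minus the fibre part of [E], read
    off on the zero section. *)
Definition recon_covector (p : M) : dual A p :=
  untriv (v := dual A) (triv_at A p) p
    (\row_j - E (chart_at (zero_covector p)) (zero_covector p) 0 (rshift m j)).

Lemma recon_covectorE s p :
  (recon_covector p : 'Hom(A p, R^o)) (s p) = - vf_apply E (linear_fun s)
    (zero_covector p).
Proof.
have ip := triv_at_dom hA p; have ca := atlas_at hN (zero_covector p).
rewrite /recon_covector (dual_untrivE hA _ _ ip).
rewrite -[vf_apply _ _ _]/(vf_in (chart_at (zero_covector p)) _ _ _)
  /vf_in /dot.
rewrite big_split_ord /= [X in - (X + _)]big1 ?add0r => [|l _]; last first.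
  rewrite (grad_linear_l hM hA)// big1 ?mulr0// => j _.
  by rewrite /fibre_coord mxE zero_lfunE mul0r.
rewrite -sumrN; apply: eq_bigr => j _; rewrite mxE (grad_linear_r hM hA)//.
by rewrite mulNr.
Qed.

Lemma recon_cocycle_exists : exists phi : section (dual A), forall p,
  phi p = recon_covector p.
Proof.
suff h (i : triv_idx (dual A)) k :
    smooth_fun_on (tdom i) (fun p => triv i (recon_covector p) 0 k).
  by exists (Section h).
apply: smooth_fun_on_local => p ip.
have [s [V [oV Vp Vi sE]]] := section_frame_exists hM hA k (ip : tdom (i :
  triv_idx A) p).
have [f sf fE] := E_linear_basic s.
exists V => //; apply: (smooth_fun_on_ext hMa (f := f)) => //;
  last exact: smooth_fun_sub.
by move=> q Vq; rewrite mxE -sE// recon_covectorE fE opprK.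
Qed.

Lemma reconstruction : exists (br : @bracket_type _ _ _ _ A)
  (phi : section (dual A)),
  is_anchor recon_anchor /\ compatible br recon_anchor phi L E.
Proof.
have [brf brE] := choice (fun st : section A * section A => C1 st.1 st.2).
have [phi phiE] := recon_cocycle_exists.
exists (fun s t => brf (s, t)), phi; split; first exact: recon_anchor_is_anchor.
have pE s a : vf_apply E (linear_fun s) a = - pairing phi s (projT1 a).
  have [f _ fE] := E_linear_basic s.
  by rewrite /pairing phiE recon_covectorE !fE !opprK.
have bivE c a F G : smooth_fun F -> smooth_fun G -> cdom c a ->
    biv_in c L F G a = biv_apply L F G a.
  by move=> sF sG ca; rewrite (biv_applyE hN bL sF sG ca).
have vfE c a F : smooth_fun F -> cdom c a -> vf_in c E F a = vf_apply E F a.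
  by move=> sF ca; rewrite (vf_applyE hN (vfield_tangent vE a) sF ca).
split.
- by move=> c a; exact: bivfield_skew.
- move=> c a s t ca; rewrite bivE// -(brE (s, t)) /jacobi_bracket !pE /=.
  by move: (biv_apply _ _ _ _) (pairing _ _ _) (pairing _ _ _) => *; ring.
- move=> c a s f ca sf; rewrite bivE//; last exact: sb.
  have [_ ->] := biv_linear_basic s sf.
  by rewrite -(recon_anchorE s sf (atlas_at hMa (projT1 a))).
- move=> c a f g ca sf sg; rewrite bivE//; try exact: sb.
  exact: biv_basic_basic.
- by move=> c a s ca; rewrite vfE// pE.
- by move=> c a f ca sf; rewrite vfE ?E_basic//; exact: sb.
Qed.

End Reconstruction.

(** * The bijection *)

Lemma section_eq (R : realType) (m n : nat) (M : charted R m) (B : vbundle M n)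
    (s t : section B) : (forall p, s p = t p) -> s = t.
Proof.
case: s t => s ss [t st] /= st'.
have e : s = t by exact: functional_extensionality_dep.
by case: _ / e in st st' *; congr Section; exact: Prop_irrelevance.
Qed.

Section Main.
Context {R : realType} {m n : nat} {M : charted R m} {A : vbundle M n}.
Hypotheses (hM : is_manifold M) (hA : is_vbundle A) (hn : (0 < n)%N).
Let hMa : is_atlas M := manifold_atlas hM.
Local Notation Astar := (total_space (dual A)).
Let hN : is_atlas Astar := dual_atlas hM hA.

Lemma Psi_set_fun : set_fun (algebroid_cocycles A)
  (linear_jacobi_structures A) (Psi A).
Proof.
move=> [[br rho] phi] [/= hbr hphi].
have hc := Psi_compatible hM hA phi hbr; have hrho := algebroid_anchor hbr.
have bL : is_bivfield (Psi A (br, rho, phi)).1.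
  apply: (compatible_bivfield hM hA hrho hc) => c a nca.
  by have [] := Psi_outside br rho phi nca.
have vE : is_vfield (Psi A (br, rho, phi)).2.
  apply: (compatible_vfield hM hA hc) => c a nca.
  by have [] := Psi_outside br rho phi nca.
split.
- exact: (algebroid_jacobi hM hA hrho hc).
- by move=> s t; exists (br s t); rewrite (jacobi_bracket_linlin hM hA hc).
- move=> s; have s1 : smooth_fun (fun _ : M => (1 : R))
  by exact: smooth_fun_on_cst.
  exists (twisted rho phi s (fun=> 1)); split;
    first exact: (smooth_twisted hM hA).
  by rewrite -(jacobi_bracket_linbas hM hA hc s s1).
Qed.

Lemma compatible_inj br rho phi br' rho' phi' (L : bivfield Astar)
  (E : vfield Astar) :
  is_anchor rho -> is_anchor rho' ->
  compatible br rho phi L E -> compatible br' rho' phi' L E ->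
  (br, rho, phi) = (br', rho', phi').
Proof.
move=> hrho hrho' hc hc'.
have phiE : phi = phi'.
  apply: section_eq => p; apply/lfunP => v.
  have [s <-] := section_value_exists hM hA v.
  have ca := atlas_at hN (zero_covector p).
  have := compat_lin hc s ca; rewrite (compat_lin hc' s ca).
  by move/oppr_inj.
rewrite -{}phiE in hc' *; congr (_, _, _).
- apply/funext => s; apply/funext => t; apply: section_eq => p.
  apply: (linear_fun_inj hA) => alpha.
  have ca := atlas_at hN (existT _ p alpha : Astar).
  have := compat_linlin hc s t ca; rewrite (compat_linlin hc' s t ca).
  by move/addIr/addIr.
- apply: functional_extensionality_dep => p; apply/funext => v;
  apply/funext => c.
  (* Outside the domain of [c] both anchors take the default value [0] of [is_tangent]. *)
  have [cp|ncp] := pselect (cdom c p); last first.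
    have [h _] := anchor_tangent hrho v; have [h' _] := anchor_tangent hrho' v.
    by rewrite h// h'.
  have [s <-] := section_value_exists hM hA v; apply/rowP => l.
  have [g [V [sg oV Vp Vc gE]]] := smooth_coord_germ hM l cp.
  have gg k : grad c g p k = (k == l)%:R.
    by rewrite -(cpartial_coord hMa l k cp);
      apply: (cpartial_ext hMa k oV Vp cp).
  have ca := atlas_at hN (zero_covector p).
  have vE r : is_anchor r -> vf_apply (anchor_vf r s) g p = r p (s p) c 0 l.
    move=> hr; rewrite (vf_applyE hMa (vfield_tangent (anchor_vfield hM hA hr
      s) p) sg cp).
    by rewrite /vf_in (dot_delta _ gg).
  rewrite -(vE rho)// -(vE rho')//.
  by have := compat_linbas hc s ca sg; rewrite (compat_linbas hc' s ca sg).
Qed.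

Lemma Psi_set_inj : set_inj (algebroid_cocycles A) (Psi A).
Proof.
move=> [[br rho] phi] [[br' rho'] phi'] /set_mem[/= hbr _] /set_mem[/= hbr' _]
  eqPsi.
have hc := Psi_compatible hM hA phi hbr;
  have hc' := Psi_compatible hM hA phi' hbr'.
have {}eqPsi : Psi A (br, rho, phi) = Psi A (br', rho', phi') := eqPsi.
rewrite eqPsi in hc.
exact: (compatible_inj (algebroid_anchor hbr) (algebroid_anchor hbr') hc hc').
Qed.

Lemma Psi_set_surj :
  set_surj (algebroid_cocycles A) (linear_jacobi_structures A) (Psi A).
Proof.
move=> [L E] [/= hJ C1 C2].
have [br [phi [hrho hc]]] := reconstruction hM hA hn hJ C1 C2.
pose rho : @anchor_type _ _ _ _ A := recon_anchor L.
have hbr : is_lie_algebroid br rho := jacobi_algebroid hM hA hrho hc hJ.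
have hphi : is_cocycle br rho phi := jacobi_cocycle hM hA hrho hc hJ.
exists (br, rho, phi) => //.
(* The image of the reconstructed triple and [(L, E)] are compatible with the same data, hence agree
   on chart domains; elsewhere both are [0] by convention. *)
have hc' := Psi_compatible hM hA phi hbr;
  have eqLE := compatible_unique hM hA hc' hc.
rewrite [LHS]surjective_pairing; congr (_, _); apply/funext => c;
  apply/funext => a.
  have [ca|nca] := pselect (cdom c a); first by have [] := eqLE c a ca.
  by rewrite (bivfield_out (jacobi_bivfield hJ))//;
    have [] := Psi_outside br rho phi nca.
have [ca|nca] := pselect (cdom c a); first by have [] := eqLE c a ca.
have [-> //] := vfield_tangent (jacobi_vfield hJ) a.
by have [] := Psi_outside br rho phi nca.
Qed.

End Main.

Theorem theorem3 (R : realType) (m n : nat) (M : charted R m)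
    (A : vbundle M n) (hM : is_manifold M) (hA : is_vbundle A)
    (hn : (0 < n)%N) :
  set_bij (algebroid_cocycles A) (linear_jacobi_structures A) (Psi A).
Proof.
split; first exact: Psi_set_fun.
- exact: Psi_set_inj.
- exact: Psi_set_surj.
Qed.
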